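(* Let $k\ge 1$ and $n$ be integers with $k<\frac n2$, and let $u:\mathbb{R}^n\to\mathbb{R}$ be a smooth function such that $(\mathcal{M}^n,g)=(\mathbb{R}^n,e^{-2u}\delta)$ is an asymptotically flat CF manifold of decay order $\tau>\frac{n-2k}{k+1}$ with $L_k(g)$ integrable over $(\mathcal{M},g)$. Assume further that $L_j(g)\ge 0$ on $\mathcal{M}$ for every $1\le j\le k$. Then the Gauss-Bonnet-Chern mass satisfies $m_k\ge 0$. Moreover, $m_k=0$ if and only if $u\equiv 0$, i.e. $(\mathcal{M},g)$ is the Euclidean space.
   Context: $\delta$ is the Euclidean metric on $\mathbb{R}^n$. The manifold $(\mathbb{R}^n,e^{-2u}\delta)$ is called an asymptotically flat CF (conformally flat) manifold of decay order $\tau$ if $|u|+|x||\nabla u|+|x|^2|\nabla^2u|=O(|x|^{-\tau})$ as $|x|\to\infty$ (Euclidean derivatives and norms). Gauss-Bonnet curvatures: with the summation convention and the generalized Kronecker delta $\delta^{j_1\cdots j_r}_{i_1\cdots i_r}=\det(\delta^{j_b}_{i_a})_{a,b=1}^r$, $$L_k=\frac1{2^k}\delta^{i_1i_2\cdots i_{2k-1}i_{2k}}_{j_1j_2\cdots j_{2k-1}j_{2k}}{R_{i_1i_2}}^{j_1j_2}\cdots{R_{i_{2k-1}i_{2k}}}^{j_{2k-1}j_{2k}},$$ where the Riemann tensor of $g$ has the sign convention for which $L_1$ is the scalar curvature (positive on round spheres). Set $$P_{(k)}^{stlm}=\frac1{2^k}\delta^{i_1\cdots i_{2k-2}\,s\,t}_{j_1\cdots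 j_{2k-2}j_{2k-1}j_{2k}}{R_{i_1i_2}}^{j_1j_2}\cdots{R_{i_{2k-3}i_{2k-2}}}^{j_{2k-3}j_{2k-2}}g^{j_{2k-1}l}g^{j_{2k}m},$$ so that $L_k=P_{(k)}^{ijlm}R_{ijlm}$. The Gauss-Bonnet-Chern mass is $$m_k=m_{GBC}=\frac{(n-2k)!}{2^{k-1}(n-1)!\,\omega_{n-1}}\lim_{r\to\infty}\int_{S_r}P_{(k)}^{ijlm}\,\partial_m g_{jl}\,\nu_i\,dS,$$ where $\omega_{n-1}$ is the volume of the unit sphere $\mathbb{S}^{n-1}$, $S_r$ is the Euclidean coordinate sphere of radius $r$, $dS$ its Euclidean area element, $\nu$ its Euclidean outward unit normal, and $\partial_m$ the ordinary partial derivative in the standard coordinates. The mass is well defined when $\tau>\frac{n-2k}{k+1}$ and $L_k$ is integrable over $\mathcal{M}$ (with respect to $dvol_g$). *)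

(* Defs.v *)
From HB Require Import structures.
From mathcomp Require Import all_boot all_order all_algebra.
From mathcomp Require Import all_classical all_reals all_analysis.
From mathcomp Require Import measurable_realfun.

Set Implicit Arguments.
Unset Strict Implicit.
Unset Printing Implicit Defensive.

Import Order.TTheory GRing.Theory Num.Theory.
Import numFieldNormedType.Exports.

Local Open Scope classical_set_scope.
Local Open Scope ring_scope.

(* The library norm of 'rV[R]_n is the sup norm, hence this one. *)
Definition enorm (R : realType) (n : nat) (v : 'rV[R]_n) : R :=
  Num.sqrt (\sum_(i < n) v 0 i ^+ 2).

(* 'rV[R]_n carries the sigma-algebra generated by the coordinates, as
   n.-tuple R does in the library. *)
Definition rV_display : measure_display. Proof. exact. Qed.

Section measurable_rV.
Context (R : realType) (n : nat).

Definition rV_coord (i : 'I_n) (v : 'rV[R]_n) : measurableTypeR R := v 0 i.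

Let rV_set0 : g_sigma_preimage rV_coord set0.
Proof. exact: sigma_algebra0. Qed.

Let rV_setC A : g_sigma_preimage rV_coord A -> g_sigma_preimage rV_coord (~` A).
Proof. exact: sigma_algebraC. Qed.

Let rV_bigcup (F : (set 'rV[R]_n)^nat) :
  (forall i, g_sigma_preimage rV_coord (F i)) ->
  g_sigma_preimage rV_coord (\bigcup_i (F i)).
Proof. exact: sigma_algebra_bigcup. Qed.

HB.instance Definition _ := @isMeasurable.Build rV_display
  'rV[R]_n (g_sigma_preimage rV_coord) rV_set0 rV_setC rV_bigcup.

Lemma measurable_rV_coord (i : 'I_n) : measurable_fun [set: 'rV[R]_n] (rV_coord i).
Proof.
move=> _ Y mY; rewrite setTI; apply: sub_sigma_algebra => /=.
rewrite -bigcup_seq/=; exists i => /=; first by rewrite mem_index_enum.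
by exists Y => //; rewrite setTI.
Qed.

Lemma measurable_fun_rV d (T : measurableType d) (f : T -> 'rV[R]_n) :
  (forall i, measurable_fun [set: T] (rV_coord i \o f)) ->
  measurable_fun [set: T] f.
Proof.
move=> mf.
have H : g_sigma_preimage (fun i => rV_coord i \o f) `<=` measurable.
  apply: smallest_sub; first exact: sigma_algebra_measurable.
  move=> A; rewrite -bigcup_seq/= => -[i _ [B mB <-]]; exact: mf.
move=> _ A mA; apply: H.
by rewrite g_sigma_preimage_comp; exists A.
Qed.

End measurable_rV.

Section lebesgue_rV.
Context (R : realType).

Definition cons_rV (n : nat) (p : measurableTypeR R * 'rV[R]_n) : 'rV[R]_n.+1 :=
  \row_(i < n.+1) if unlift ord0 i is Some j then p.2 0 j else p.1.

Lemma measurable_cons_rV n : measurable_fun setT (@cons_rV n).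
Proof.
apply: measurable_fun_rV => i.
have -> : rV_coord i \o @cons_rV n =
    (fun p => if unlift ord0 i is Some j then rV_coord j p.2 else p.1).
  by apply/funext => p; rewrite /rV_coord /= mxE.
case: unliftP => [j|] _; last exact: measurable_fst.
exact: (measurableT_comp (measurable_rV_coord j) measurable_snd).
Qed.


Definition uncons_rV (n : nat) (v : 'rV[R]_n.+1) : measurableTypeR R * 'rV[R]_n :=
  (v 0 ord0, \row_(j < n) v 0 (lift ord0 j)).

Lemma measurable_uncons_rV n : measurable_fun setT (@uncons_rV n).
Proof.
apply: measurable_fun_pair; first exact: (measurable_rV_coord ord0).
apply: measurable_fun_rV => j.
rewrite [X in measurable_fun _ X](_ : _ = rV_coord (lift ord0 j)).
  exact: measurable_rV_coord.
by apply/funext => v; rewrite /rV_coord /= mxE.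
Qed.

Lemma cons_rVK n : cancel (@cons_rV n) (@uncons_rV n).
Proof.
move=> [a v]; rewrite /uncons_rV /cons_rV; congr pair.
  by rewrite mxE unlift_none.
by apply/rowP => j; rewrite !mxE liftK.
Qed.

Section succ.
Context (n : nat) (mu : {sigma_finite_measure set 'rV[R]_n -> \bar R}).

Definition lebesgue_rV_succ : set 'rV[R]_n.+1 -> \bar R :=
  pushforward (@lebesgue_measure R \x mu)%E (@cons_rV n).

Let succ0 : lebesgue_rV_succ set0 = 0%E.
Proof. by rewrite /lebesgue_rV_succ /pushforward preimage_set0 measure0. Qed.

Let succ_ge0 A : (0 <= lebesgue_rV_succ A)%E.
Proof. by rewrite /lebesgue_rV_succ /pushforward measure_ge0. Qed.

Let succ_sigma_additive : semi_sigma_additive lebesgue_rV_succ.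
Proof.
have mC A : measurable A -> measurable (@cons_rV n @^-1` A).
  by move=> mA; rewrite -[X in measurable X]setTI; exact: measurable_cons_rV.
move=> F mF tF mUF; rewrite /lebesgue_rV_succ /pushforward preimage_bigcup.
apply: measure_semi_sigma_additive; first by move=> k; exact: mC.
- apply/trivIsetP => /= i j _ _ ij; rewrite -preimage_setI.
  by move/trivIsetP : tF => /(_ _ _ _ _ ij) ->//; rewrite preimage_set0.
- by rewrite -preimage_bigcup; exact: mC.
Qed.

HB.instance Definition _ := isMeasure.Build _ _ _ lebesgue_rV_succ
  succ0 succ_ge0 succ_sigma_additive.

Let succ_sigma_finite : sigma_finite setT lebesgue_rV_succ.
Proof.
have /sigma_finiteP[F [TF ndF Foo]] := sigma_finiteT (@lebesgue_measure R).
have /sigma_finiteP[G [TG ndG Goo]] := sigma_finiteT mu.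
exists (fun k => @uncons_rV n @^-1` (F k `*` G k)).
  rewrite -preimage_bigcup (_ : \bigcup_i _ = setT) ?preimage_setT//.
  rewrite -subTset => -[x y] _.
  have [k _ Fkx] : (\bigcup_i F i) x by rewrite -TF.
  have [l _ Gly] : (\bigcup_i G i) y by rewrite -TG.
  exists (maxn k l) => //; split.
    by move: x Fkx; exact/subsetPset/ndF/leq_maxl.
  by move: y Gly; exact/subsetPset/ndG/leq_maxr.
move=> k; have [mFk Fkoo] := Foo k; have [mGk Gkoo] := Goo k; split.
  rewrite -[X in measurable X]setTI; apply: measurable_uncons_rV => //.
  exact: measurableX.
rewrite /lebesgue_rV_succ /pushforward -comp_preimage.
rewrite (_ : _ \o _ = id); last exact/funext/cons_rVK.
by rewrite preimage_id product_measure1E// lte_mul_pinfty// ge0_fin_numE.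
Qed.

HB.instance Definition _ := Measure_isSigmaFinite.Build _ _ _ lebesgue_rV_succ
  succ_sigma_finite.

End succ.

(* Lebesgue measure on R^n, as the n-fold product of lebesgue_measure. *)
Fixpoint lebesgue_rV (n : nat) : {sigma_finite_measure set 'rV[R]_n -> \bar R} :=
  match n with
  | 0 => @dirac _ 'rV[R]_0 0 R
  | m.+1 => lebesgue_rV_succ (lebesgue_rV m)
  end.

End lebesgue_rV.

Section sphere.
Context (R : realType) (n : nat).

Definition punctured_ball : set 'rV[R]_n := [set x | 0 < enorm x <= 1].

Definition normalize (x : 'rV[R]_n) : 'rV[R]_n := (enorm x)^-1 *: x.

Lemma measurable_enorm : measurable_fun setT (@enorm R n : _ -> measurableTypeR R).
Proof.
apply: (@measurableT_comp _ _ _ _ _ _ (Num.sqrt : R -> R)).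
  exact: (continuous_measurable_fun (@sqrt_continuous R)).
apply: measurable_sum => i; apply: measurable_funX.
exact: measurable_rV_coord.
Qed.

Lemma measurable_punctured_ball : measurable punctured_ball.
Proof.
rewrite [X in measurable X](_ : _ = setT `&` @enorm R n @^-1` `]0, 1]).
  exact: measurable_enorm.
by rewrite setTI; apply/seteqP; split => x /=; rewrite in_itv.
Qed.

Lemma measurable_normalize : measurable_fun setT normalize.
Proof.
apply: measurable_fun_rV => i.
rewrite [X in measurable_fun _ X](_ : _ =
    (fun x => enorm x `^ (-1) * rV_coord i x)).
  apply: measurable_funM; last exact: measurable_rV_coord.
  exact: (measurableT_comp (measurable_powR (-1)) measurable_enorm).
by apply/funext => x; rewrite /rV_coord /= mxE powR_inv1// sqrtr_ge0.
Qed.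

Definition cone_measure (A : set 'rV[R]_n) : \bar R :=
  lebesgue_rV R n (punctured_ball `&` normalize @^-1` A).

Let cone0 : cone_measure set0 = 0%E.
Proof. by rewrite /cone_measure preimage_set0 setI0 measure0. Qed.

Let cone_ge0 A : (0 <= cone_measure A)%E.
Proof. exact: measure_ge0. Qed.

Let cone_sigma_additive : semi_sigma_additive cone_measure.
Proof.
have mC A : measurable A -> measurable (punctured_ball `&` normalize @^-1` A).
  move=> mA; apply: measurableI; first exact: measurable_punctured_ball.
  by rewrite -[X in measurable X]setTI; exact: measurable_normalize.
move=> F mF tF mUF; rewrite /cone_measure preimage_bigcup setI_bigcupr.
apply: measure_semi_sigma_additive; first by move=> k; exact: mC.
- apply/trivIsetP => /= i j _ _ ij; rewrite setIACA -preimage_setI.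
  by move/trivIsetP : tF => /(_ _ _ _ _ ij) ->//; rewrite preimage_set0 setI0.
- by rewrite -setI_bigcupr -preimage_bigcup; exact: mC.
Qed.

HB.instance Definition _ := isMeasure.Build _ _ _ cone_measure
  cone0 cone_ge0 cone_sigma_additive.

End sphere.

Section sphere_integral.
Context (R : realType) (n : nat).

(* Area measure of the unit sphere, as a measure on R^n carried by the sphere:
   sigma(E) = n * Leb {t y | 0 < t <= 1, y in E}, as in polar coordinates. *)
Definition sphere_measure : {measure set 'rV[R]_n -> \bar R} :=
  mscale n%:R%:nng (@cone_measure R n).

(* The integral over S_r is pulled back to the unit sphere by y |-> r y. *)
Definition sphere_integral (r : R) (f : 'rV[R]_n -> R) : R :=
  r ^+ n.-1 * \int[sphere_measure]_(y in [set y | enorm y = 1]) f (r *: y).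

Definition sphere_volume : R := fine (sphere_measure [set y | enorm y = 1]).

End sphere_integral.

Section calculus.
Context (R : realType) (n : nat).
Implicit Types (f : 'rV[R]_n -> R) (x : 'rV[R]_n).

Definition partial (i : 'I_n) f x : R := 'D_(delta_mx 0 i) f x.

Definition iter_partial (s : seq 'I_n) f : 'rV[R]_n -> R := foldr partial f s.

Definition smooth f : Prop := forall s : seq 'I_n,
  continuous (iter_partial s f) /\
  forall i x, derivable (iter_partial s f) x (delta_mx 0 i).

Definition gradient_norm f x : R :=
  Num.sqrt (\sum_(i < n) partial i f x ^+ 2).

Definition hessian_norm f x : R :=
  Num.sqrt (\sum_(i < n) \sum_(j < n) partial i (partial j f) x ^+ 2).

End calculus.

Section curvature.
Context (R : realType) (n : nat).
Variable g : 'rV[R]_n -> 'M[R]_n.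
Implicit Types (x : 'rV[R]_n) (i j k l m s t : 'I_n).

Definition metric_inv x : 'M[R]_n := invmx (g x).

Definition metric_partial m i j x : R := partial m (fun y => g y i j) x.

(* Gamma^k_ij *)
Definition christoffel k i j x : R :=
  2^-1 * \sum_l metric_inv x k l *
    (metric_partial i j l x + metric_partial j i l x - metric_partial l i j x).

(* The component R^l_{kij} of R(d_i, d_j) d_k along d_l, where
   R(X, Y) = [nabla_X, nabla_Y] - nabla_[X, Y]. *)
Definition riemann l k i j x : R :=
  partial i (christoffel l j k) x - partial j (christoffel l i k) x
  + \sum_m (christoffel l i m x * christoffel m j k x
            - christoffel l j m x * christoffel m i k x).

(* R_ij^kl; its contraction R_ij^ij is the scalar curvature, positive on round
   spheres. *)
Definition riemann_up i j k l x : R := \sum_m riemann k m i j x * metric_inv x m l.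

Definition gen_kronecker r (I J : r.-tuple 'I_n) : R :=
  \det (\matrix_(a < r, b < r) (tnth I a == tnth J b)%:R).

(* 0-based positions of i_(2a+1) and i_(2a+2) in i_1 ... i_(2q). *)
Lemma pair_fst_subproof q (a : 'I_q) : (a.*2 < q.*2)%N.
Proof. by rewrite ltn_double. Qed.

Lemma pair_snd_subproof q (a : 'I_q) : (a.*2.+1 < q.*2)%N.
Proof. by rewrite ltn_Sdouble. Qed.

Definition pair_fst q (a : 'I_q) : 'I_q.*2 := Ordinal (pair_fst_subproof a).
Definition pair_snd q (a : 'I_q) : 'I_q.*2 := Ordinal (pair_snd_subproof a).

Definition riemann_prod q (I J : q.*2.-tuple 'I_n) x : R :=
  \prod_(a < q) riemann_up (tnth I (pair_fst a)) (tnth I (pair_snd a))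
                           (tnth J (pair_fst a)) (tnth J (pair_snd a)) x.

Definition gauss_bonnet_curv (k : nat) x : R :=
  2 ^- k * \sum_(I : k.*2.-tuple 'I_n) \sum_(J : k.*2.-tuple 'I_n)
    gen_kronecker I J * riemann_prod I J x.

(* Meaningful for 0 < k only: P_(k) involves k - 1 curvature factors. *)
Definition gb_tensor (k : nat) s t l m x : R :=
  2 ^- k * \sum_(I : k.-1.*2.-tuple 'I_n) \sum_(J : k.-1.*2.-tuple 'I_n)
    \sum_(p < n) \sum_(q < n)
      gen_kronecker [tuple of rcons (rcons I s) t] [tuple of rcons (rcons J p) q]
      * riemann_prod I J x * metric_inv x p l * metric_inv x q m.

Definition volume_density x : R := Num.sqrt (\det (g x)).

Definition dvol_integrable (f : 'rV[R]_n -> R) : Prop :=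
  (lebesgue_rV R n).-integrable setT (fun x => (f x * volume_density x)%:E).

Definition mass_flux (k : nat) (r : R) : R :=
  sphere_integral r (fun x => \sum_i \sum_j \sum_l \sum_m
    gb_tensor k i j l m x * metric_partial m j l x * (x 0 i / enorm x)).

Definition mass_const (k : nat) : R :=
  (n - k.*2)`!%:R / (2 ^+ k.-1 * (n.-1)`!%:R * sphere_volume R n).

Definition gbc_mass (k : nat) : R := mass_const k * lim (mass_flux k r @[r --> +oo]).

(* Convergence of the limit defining gbc_mass. *)
Definition gbc_mass_defined (k : nat) : Prop := cvg (mass_flux k r @[r --> +oo]).

End curvature.

Section conformally_flat.
Context (R : realType) (n : nat).

Definition cf_metric (u : 'rV[R]_n -> R) (x : 'rV[R]_n) : 'M[R]_n :=
  (expR (- 2 * u x))%:M.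

Definition asymptotically_flat_cf (u : 'rV[R]_n -> R) (tau : R) : Prop :=
  exists C r0 : R, 0 < r0 /\ forall x, r0 <= enorm x ->
    `|u x| + enorm x * gradient_norm u x + enorm x ^+ 2 * hessian_norm u x
      <= C * enorm x `^ (- tau).

End conformally_flat.

(* Main.v *)
Require Import Defs.
From mathcomp Require Import all_boot all_order all_algebra fingroup perm.
From mathcomp Require Import all_classical all_reals all_analysis.
From mathcomp Require Import measurable_realfun.
From mathcomp Require Import ring lra zify.

Set Implicit Arguments.
Unset Strict Implicit.
Unset Printing Implicit Defensive.

Import Order.TTheory GRing.Theory Num.Theory.
Import numFieldNormedType.Exports.

Local Open Scope classical_set_scope.
Local Open Scope ring_scope.

(** Write [q = |grad u|^2] and let [W = Hess u + du du - (q/2) delta] be the Schouten tensor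
    of [g = exp(-2u) delta]. The Weyl tensor of [g] vanishes, so every contraction of
    curvatures with a generalized Kronecker delta reduces to one of copies of [W]: [L_k] is
    a positive multiple of [exp(2ku) sigma_k(W)], where [sigma_k] is the elementary symmetric
    function of the eigenvalues ([gauss_bonnet_curvE]), and the integrand of the mass is a
    positive multiple of [exp(2ku) <T_(k-1) grad u, nu>], where [T_b] are the Newton tensors
    of [W] ([flux_integrandE]).

    The Newton tensors satisfy
    [div T_b = (n - 2b) T_b grad u - (n - b) sigma_b grad u] ([newton_divE]). With positive
    weights [d_a], [d_0 = 1], the field [X = sum_(a < k) d_a q^a T_(k-1-a) grad u] therefore
    has divergence
    [k sigma_k + sum_(1 <= a <= k) d_(a-1) k (n - 2k) / (2a) q^a sigma_(k-a)]
    ([div_mass_field]): the weights are such that all terms [q^a <T_b grad u, grad u>] cancel.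
    Since [n > 2k] and all [sigma_j >= 0], this is at least a positive multiple of [q^k]
    ([mass_density_ge]).

    At infinity [X] differs from [exp(2ku) T_(k-1) grad u] by [O(r^(1 - 2k - (k+1) tau))], and
    the condition on [tau] says exactly that this is [o(r^(1-n))] ([mass_field_decay],
    [decay_exponent]). Hence the mass is a positive multiple of the limit of the fluxes of [X]
    through the spheres of radius [r]. For a field with nonnegative divergence the flux
    through a sphere lies between the integrals of the divergence over the ball bounded by the
    sphere and over any larger ball ([flux_bounds]). The integrals over balls increase with
    the radius and are bounded, by the integrability of [L_k] and the decay of [u]
    ([ball_integral_mass_field_bounded]); so the limit exists and equals the integral of
    [div X >= 0] over the whole space. If it vanishes, then [q = 0] everywhere, [u] is constant
    and, as it tends to zero, [u = 0].

    The divergence theorem enters only through [flux_bounds]. Against the weight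
    [r^2 - |x|^2], which vanishes on the sphere, it follows from Fubini and the fundamental
    theorem of calculus on the chords in each coordinate direction ([weighted_divergence]);
    subtracting the identities for two radii and letting them merge gives the flux, because
    the surface measure is defined by cones over the sphere. *)

(** * Contractions of the generalized Kronecker delta *)

Section kronecker.
Context (R : comNzRingType) (T : eqType).
Implicit Types (I J A B : seq T) (s t x y : T) (r : nat).

(** Index lists are read with [onth], which needs no default index. *)
Definition kron_det r I J : R := \det (\matrix_(a < r, b < r) (onth I a == onth J b)%:R).

Definition kron I J : R := kron_det (size I) I J.

Lemma kron_detC r I J : kron_det r I J = kron_det r J I.
Proof.
rewrite /kron_det -det_tr; congr (\det _); apply/matrixP => a b.
by rewrite !mxE eq_sym.
Qed.

Lemma kronC I J : size I = size J -> kron I J = kron J I.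
Proof. by rewrite /kron => ->; exact: kron_detC. Qed.

Lemma det_xcol n (A : 'M[R]_n) (i j : 'I_n) : i != j -> \det (xcol i j A) = - \det A.
Proof. by move=> ij; rewrite xcolE det_mulmx det_perm odd_tperm ij expr1 mulrN1. Qed.

Lemma onth_swap A x y B (a : nat) : onth (A ++ x :: y :: B) a =
  onth (A ++ y :: x :: B) (if a == size A then (size A).+1 else if a == (size A).+1 then size A else a).
Proof.
elim: A a => [|z A IH] [|a] //=; first by case: a => [|[|a]].
rewrite IH !eqSS; case: ifP => // _; by case: ifP.
Qed.

Lemma kron_swapr I A x y B : size I = size (A ++ x :: y :: B) ->
  kron I (A ++ x :: y :: B) = - kron I (A ++ y :: x :: B).
Proof.
rewrite /kron /kron_det => sI.
have ha : (size A < size I)%N by rewrite sI size_cat /=; lia.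
have hb : ((size A).+1 < size I)%N by rewrite sI size_cat /=; lia.
rewrite -(@det_xcol _ _ (Ordinal ha) (Ordinal hb)); last by rewrite -val_eqE /=; lia.
congr (\det _); apply/matrixP => a b; rewrite !mxE onth_swap.
congr ((_ == onth _ _)%:R); case: tpermP => [->|->|/eqP + /eqP] /=.
- by rewrite eqxx.
- by rewrite eqxx; case: eqP => //; lia.
- by rewrite -!val_eqE /= => /negbTE -> /negbTE ->.
Qed.

Lemma kron_swapl A x y B J : size J = size (A ++ x :: y :: B) ->
  kron (A ++ x :: y :: B) J = - kron (A ++ y :: x :: B) J.
Proof.
move=> sJ; rewrite kronC // kron_swapr // kronC //.
by rewrite sJ !size_cat.
Qed.

Lemma onth_set_nth J t a b : (a < size J)%N ->
  onth (set_nth t J a t) b = if b == a then Some t else onth J b.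
Proof. by elim: J a b => [|z J IH] [|a] [|b] //= aJ; rewrite IH // eqSS. Qed.

(** Expansion along the first row: moving the first column into place [a] costs one
    transposition. *)
Lemma kron_laplace s I t J : size I = size J ->
  kron (s :: I) (t :: J) = (s == t)%:R * kron I J
   - \sum_(a < size J) (Some s == onth J a)%:R * kron I (set_nth t J a t).
Proof.
move=> sIJ; rewrite /kron /kron_det /= (expand_det_row _ ord0) big_ord_recl.
congr (_ + _).
  rewrite !mxE /= /cofactor /= addn0 expr0 mul1r.
  by congr (_ * \det _); apply/matrixP => a b; rewrite !mxE.
rewrite -sIJ -sumrN; apply: eq_bigr => a _; rewrite !mxE /= -mulrN; congr (_ * _).
set M := (X in cofactor X _ _).
pose N : 'M[R]_((size I).+1) := \matrix_(i, j)
  if i == ord0 then (j == lift ord0 a)%:R else M i j.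
have -> : cofactor M ord0 (lift ord0 a) = \det N.
  rewrite (expand_det_row N ord0) (bigD1 (lift ord0 a)) //= big1 ?addr0; last first.
    by move=> j /negbTE ja; rewrite mxE eqxx ja mul0r.
  rewrite mxE !eqxx mul1r /cofactor; congr (_ * \det _).
  by apply/matrixP => i j; rewrite !mxE.
rewrite -[LHS]opprK -(@det_xcol _ _ ord0 (lift ord0 a)) //; congr (- _).
rewrite (expand_det_row _ ord0) (bigD1 ord0) //= big1 ?addr0; last first.
  move=> j /negbTE j0; rewrite !mxE eqxx.
  case: tpermP => [jj|->|_ /eqP/negbTE ->]; rewrite ?mul0r //.
    by rewrite jj eqxx in j0.
rewrite !mxE eqxx tpermL eqxx mul1r /cofactor /= addn0 expr0 mul1r.
congr (\det _); apply/matrixP => i j; rewrite !mxE /= onth_set_nth -?sIJ //.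
congr ((_ == _)%:R).
case: tpermP => [/eqP|/lift_inj ->|_ /eqP]; rewrite ?eqxx //.
by rewrite (inj_eq (@lift_inj _ ord0)) => ja; rewrite ifN.
Qed.

End kronecker.

Section newton.
Context (R : comNzRingType) (n : nat).
Implicit Types (W : 'M[R]_n) (S T : seq 'I_n) (k : nat) (i j s t x y : 'I_n).

(** The contraction of the generalized Kronecker delta with [k] copies of [W];
    [psi W k [::] [::]] is [k`!] times the [k]-th elementary symmetric function of
    the eigenvalues, and [psi W k [:: i] [:: j]] is [k`!] times the [(i, j)] entry of the
    [k]-th Newton tensor. *)
Fixpoint psi W k S T : R :=
  if k is k'.+1 then \sum_i \sum_j W i j * psi W k' (i :: S) (j :: T) else kron R S T.

Lemma psiS W k S T :
  psi W k.+1 S T = \sum_i \sum_j W i j * psi W k (i :: S) (j :: T).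
Proof. by []. Qed.

Lemma psi_swapr W k S A x y B : size S = size (A ++ x :: y :: B) ->
  psi W k S (A ++ x :: y :: B) = - psi W k S (A ++ y :: x :: B).
Proof.
elim: k S A => [|k IH] S A sS /=; first exact: kron_swapr.
rewrite -sumrN; apply: eq_bigr => i _; rewrite -sumrN; apply: eq_bigr => j _.
by rewrite -!cat_cons IH ?mulrN //= sS.
Qed.

Lemma psi_swapl W k A x y B T : size T = size (A ++ x :: y :: B) ->
  psi W k (A ++ x :: y :: B) T = - psi W k (A ++ y :: x :: B) T.
Proof.
elim: k T A => [|k IH] T A sT /=; first exact: kron_swapl.
rewrite -sumrN; apply: eq_bigr => i _; rewrite -sumrN; apply: eq_bigr => j _.
by rewrite -!cat_cons IH ?mulrN //= sT.
Qed.

Lemma psi_swap2 W k x y S x' y' T : size S = size T ->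
  psi W k (x :: y :: S) (x' :: y' :: T) = psi W k (y :: x :: S) (y' :: x' :: T).
Proof.
move=> sST.
have /= -> := @psi_swapr W k (x :: y :: S) [::] x' y' T; last by rewrite /= sST.
have /= -> := @psi_swapl W k [::] x y S (y' :: x' :: T); last by rewrite /= sST.
by rewrite opprK.
Qed.

Lemma psi_tr W k S T : size S = size T -> psi W k S T = psi W^T k T S.
Proof.
elim: k S T => [|k IH] S T sST /=; first exact: kronC.
rewrite exchange_big /=; apply: eq_bigr => i _; apply: eq_bigr => j _.
by rewrite mxE IH //= sST.
Qed.

(** Laplace expansion of the delta along the row of [s]: this row meets [t], one of the [k]
    contracted upper indices, which all contribute the same by antisymmetry, or an entry
    of [T]. *)
Lemma psi_laplace W k s S t T : size S = size T ->
  psi W k (s :: S) (t :: T) = (s == t)%:R * psi W k S T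
    - k%:R * \sum_i W i s * psi W k.-1 (i :: S) (t :: T)
    - \sum_(a < size T) (Some s == onth T a)%:R * psi W k S (set_nth t T a t).
Proof.
elim: k S T => [|k IH] S T sST; first by rewrite /= mul0r subr0 kron_laplace.
rewrite psiS.
transitivity (\sum_i \sum_j W i j * ((s == t)%:R * psi W k (i :: S) (j :: T)
    - k%:R * (\sum_l W l s * psi W k.-1 (l :: i :: S) (t :: j :: T))
    - ((s == j)%:R * psi W k (i :: S) (t :: T) +
       \sum_(a < size T) (Some s == onth T a)%:R
          * psi W k (i :: S) (j :: set_nth t T a t)))).
  apply: eq_bigr => i _; apply: eq_bigr => j _; rewrite psi_swap2 // IH /= ?sST //.
  by rewrite big_ord_recl /=.
under eq_bigr => i _ do under eq_bigr => j _ do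
  rewrite !mulrDr !mulrN mulrDr opprD addrA.
under eq_bigr => i _ do rewrite !sumrB.
rewrite !sumrB; congr (_ - _); last first.
  under eq_bigr => i _ do (under eq_bigr => j _ do rewrite mulr_sumr; rewrite exchange_big).
  rewrite exchange_big; apply: eq_bigr => a _ /=; rewrite mulr_sumr.
  by apply: eq_bigr => i _; rewrite mulr_sumr; apply: eq_bigr => j _; rewrite mulrCA.
rewrite -addrA; congr (_ + _).
  rewrite mulr_sumr; apply: eq_bigr => i _; rewrite mulr_sumr.
  by apply: eq_bigr => j _; rewrite mulrCA.
rewrite -opprD; congr (- _).
rewrite mulrSr mulrDl mul1r; congr (_ + _); last first.
  apply: eq_bigr => i _; rewrite (bigD1 s) //= eqxx mul1r big1 ?addr0 //.
  by move=> j /negbTE; rewrite eq_sym => ->; rewrite mul0r mulr0.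
case: k IH => [|k] _ //=.
  by rewrite mul0r; apply: big1 => i _; apply: big1 => j _; rewrite mul0r mulr0.
under eq_bigr => i _ do under eq_bigr => j _ do rewrite mulrCA.
under eq_bigr => i _ do rewrite -mulr_sumr.
rewrite -mulr_sumr; congr (_ * _).
transitivity (\sum_i \sum_l \sum_j
    W l s * (W i j * psi W k [:: i, l & S] [:: j, t & T])).
  apply: eq_bigr => i _; rewrite [RHS]exchange_big /=; apply: eq_bigr => j _.
  rewrite mulr_sumr; apply: eq_bigr => l _.
  by rewrite mulrCA psi_swap2.
rewrite exchange_big; apply: eq_bigr => l _ /=; rewrite mulr_sumr.
by apply: eq_bigr => i _; rewrite mulr_sumr.
Qed.

(** Up to factorials, the recursion [T_(k+1) = sigma_(k+1) - W^T T_k] of the Newton tensors. *)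
Lemma psi_newton W k s t : psi W k.+1 [:: s] [:: t] =
  (s == t)%:R * psi W k.+1 [::] [::] - k.+1%:R * \sum_i W i s * psi W k [:: i] [:: t].
Proof. by rewrite psi_laplace // big_ord0 subr0. Qed.

(** Tracing a pair of indices of a generalized delta on [r + 1] indices multiplies the delta
    on the other [r] by [n - r]. *)
Lemma psi_trace W k S T : size S = size T ->
  \sum_i psi W k (i :: S) (i :: T) = (n%:R - (k + size S)%:R) * psi W k S T.
Proof.
elim: k S T => [|k IH] S T sST.
  rewrite add0n /=.
  under eq_bigr => i _ do rewrite kron_laplace // eqxx mul1r.
  rewrite sumrB sumr_const card_ord exchange_big /= mulrBl [n%:R * _]mulr_natl; congr (_ - _).
  transitivity (\sum_(a < size T) kron R S T).
    apply: eq_bigr.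
    move=> a _; have [z Ez] : exists z, onth T a = Some z.
      by have := ltn_ord a; rewrite -onthTE; case: onth => // z _; exists z.
    rewrite (bigD1 z) //= Ez eqxx mul1r big1 ?addr0; last first.
      by move=> i /negbTE iz; rewrite (inj_eq Some_inj) iz mul0r.
    congr (kron _ _ _); move: (a : nat) Ez; clear.
    by elim: T => [|y T IH] [|b] //= => [[->] //|/IH ->].
  by rewrite sumr_const card_ord sST mulr_natl.
under eq_bigr => i _ do rewrite psiS.
rewrite exchange_big /= mulr_sumr; apply: eq_bigr => l _.
rewrite exchange_big /= mulr_sumr; apply: eq_bigr => j _.
rewrite -mulr_sumr.
under eq_bigr => i _ do rewrite psi_swap2 //.
by rewrite IH /= ?sST // mulrCA addSnnS.
Qed.

End newton.

(** * Curvature products as Kronecker contractions *)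

Section tuple_sums.
Context (R : comNzRingType) (n : nat).
Implicit Types (i j : 'I_n) (S T : seq 'I_n).

Lemma sum_tuple_rcons r (F : r.+1.-tuple 'I_n -> R) :
  \sum_I F I = \sum_(I : r.-tuple 'I_n) \sum_i F [tuple of rcons I i].
Proof.
rewrite pair_big /=.
pose h (p : r.-tuple 'I_n * 'I_n) : r.+1.-tuple 'I_n := [tuple of rcons p.1 p.2].
rewrite (reindex h) //; apply: onW_bij; apply: inj_card_bij.
  move=> [I i] [J j] /(congr1 val) /= /rcons_inj [IJ ->].
  by congr (_, _); apply: val_inj.
by rewrite card_prod !card_tuple card_ord expnSr.
Qed.

Context (Q : 'I_n -> 'I_n -> 'I_n -> 'I_n -> R).

Definition quad_prod k (I J : k.*2.-tuple 'I_n) : R :=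
  \prod_(a < k) Q (tnth I (pair_fst a)) (tnth I (pair_snd a))
                  (tnth J (pair_fst a)) (tnth J (pair_snd a)).

(** The tuple sums in the definition of the Gauss-Bonnet curvatures, summed one curvature
    factor at a time. *)
Fixpoint quad_contraction k S T : R :=
  if k is k'.+1 then
    \sum_i \sum_i' \sum_j \sum_j'
      Q i i' j j' * quad_contraction k' (i :: i' :: S) (j :: j' :: T)
  else kron R S T.

Lemma tnth_rcons_lt r (I : r.-tuple 'I_n) i (a : 'I_r.+1) (b : 'I_r) :
  a = b :> nat -> tnth [tuple of rcons I i] a = tnth I b.
Proof.
by move=> ab; rewrite !(tnth_nth i) /= nth_rcons size_tuple ab ltn_ord.
Qed.

Lemma tnth_rcons_eq r (I : r.-tuple 'I_n) i (a : 'I_r.+1) :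
  a = r :> nat -> tnth [tuple of rcons I i] a = i.
Proof.
by move=> ar; rewrite (tnth_nth i) /= nth_rcons size_tuple ar ltnn eqxx.
Qed.

Lemma quad_prod_rcons k (I J : k.*2.-tuple 'I_n) i i' j j' :
  @quad_prod k.+1 [tuple of rcons (rcons I i) i'] [tuple of rcons (rcons J j) j'] =
  quad_prod I J * Q i i' j j'.
Proof.
have tl (L : k.*2.-tuple 'I_n) l l' (a : 'I_(k.*2.+2)) (b : 'I_k.*2) :
    a = b :> nat -> tnth [tuple of rcons (rcons L l) l'] a = tnth L b.
  move=> ab; have bs : (b < (k.*2).+1)%N by rewrite ltnS ltnW.
  rewrite (@tnth_rcons_lt _ [tuple of rcons L l] l' a (Ordinal bs)) //.
  exact: tnth_rcons_lt.
have t1 (L : k.*2.-tuple 'I_n) l l' (a : 'I_(k.*2.+2)) :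
    a = k.*2 :> nat -> tnth [tuple of rcons (rcons L l) l'] a = l.
  move=> ab; have bs : (k.*2 < (k.*2).+1)%N by [].
  rewrite (@tnth_rcons_lt _ [tuple of rcons L l] l' a (Ordinal bs)) //.
  exact: tnth_rcons_eq.
rewrite /quad_prod big_ord_recr /=; congr (_ * _).
  by apply: eq_bigr => a _; congr Q; apply: tl.
by congr Q; [exact: t1|exact: (@tnth_rcons_eq _ [tuple of rcons I i])
             |exact: t1|exact: (@tnth_rcons_eq _ [tuple of rcons J j])].
Qed.

Lemma sum_quad_prod k S T :
  \sum_(I : k.*2.-tuple 'I_n) \sum_(J : k.*2.-tuple 'I_n)
    kron R (I ++ S) (J ++ T) * quad_prod I J = quad_contraction k S T.
Proof.
elim: k S T => [|k IH] S T.
  transitivity (\sum_(I : 0.-tuple 'I_n) \sum_(J : 0.-tuple 'I_n) kron R S T).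
    apply: eq_bigr => I _; apply: eq_bigr => J _.
    by rewrite (tuple0 I) (tuple0 J) /quad_prod big_ord0 mulr1.
  by rewrite !sumr_const !card_tuple !expn0.
transitivity (\sum_(I : k.*2.-tuple 'I_n) \sum_i \sum_i' \sum_(J : k.*2.-tuple 'I_n)
   \sum_j \sum_j' kron R (rcons (rcons I i) i' ++ S) (rcons (rcons J j) j' ++ T)
     * (quad_prod I J * Q i i' j j')).
  etransitivity; first exact: (@sum_tuple_rcons (k.*2).+1).
  etransitivity; first exact: (@sum_tuple_rcons (k.*2)).
  apply: eq_bigr => I _; apply: eq_bigr => i _; apply: eq_bigr => i' _.
  etransitivity; first exact: (@sum_tuple_rcons (k.*2).+1).
  etransitivity; first exact: (@sum_tuple_rcons (k.*2)).
  apply: eq_bigr => J _; apply: eq_bigr => j _; apply: eq_bigr => j' _.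
  by rewrite quad_prod_rcons.
rewrite exchange_big; apply: eq_bigr => i _ /=.
rewrite exchange_big; apply: eq_bigr => i' _ /=.
transitivity (\sum_(I : k.*2.-tuple 'I_n) \sum_j \sum_j' \sum_(J : k.*2.-tuple 'I_n)
   kron R (rcons (rcons I i) i' ++ S) (rcons (rcons J j) j' ++ T)
     * (quad_prod I J * Q i i' j j')).
  apply: eq_bigr => I _; rewrite exchange_big; apply: eq_bigr => j _ /=.
  by rewrite exchange_big.
rewrite exchange_big; apply: eq_bigr => j _ /=.
rewrite exchange_big; apply: eq_bigr => j' _ /=.
rewrite -/(quad_contraction k _ _) -IH mulr_sumr; apply: eq_bigr => I _; rewrite mulr_sumr; apply: eq_bigr => J _.
by rewrite !cat_rcons mulrA mulrC.
Qed.

End tuple_sums.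

Section knprod.
Context (R : comNzRingType) (n : nat).
Implicit Types (W : 'M[R]_n) (S T : seq 'I_n).

(** The curvature of a metric [c^-1 delta] with Schouten tensor [W]: the
    Kulkarni-Nomizu product of [W] with the Euclidean metric. *)
Definition knprod (c : R) W i j k l : R :=
  c * (W i k * (j == l)%:R + (i == k)%:R * W j l
       - W i l * (j == k)%:R - (i == l)%:R * W j k).

Lemma sum_delta2 (F : 'I_n -> 'I_n -> 'I_n -> 'I_n -> R) (A : 'I_n -> 'I_n -> R) :
  \sum_i \sum_j \sum_k \sum_l A i k * (j == l)%:R * F i j k l =
  \sum_i \sum_j \sum_k A i k * F i j k j.
Proof.
apply: eq_bigr => i _; apply: eq_bigr => j _; apply: eq_bigr => k _.
rewrite (bigD1 j) //= eqxx mulr1 big1 ?addr0 // => l /negbTE.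
by rewrite eq_sym => ->; rewrite mulr0 mul0r.
Qed.

(** By the antisymmetry of [F] the four terms of the product contribute equally. *)
Lemma sum_knprod c W (F : 'I_n -> 'I_n -> 'I_n -> 'I_n -> R) :
  (forall i j k l, F j i k l = - F i j k l) ->
  (forall i j k l, F i j l k = - F i j k l) ->
  \sum_i \sum_j \sum_k \sum_l knprod c W i j k l * F i j k l =
  4 * c * \sum_i \sum_j \sum_k W i k * F i j k j.
Proof.
move=> Fl Fr.
pose G i j k l := W i k * (j == l)%:R * F i j k l.
transitivity (c * \sum_i \sum_j \sum_k \sum_l (G i j k l + G j i l k + G i j l k + G j i k l)).
  rewrite mulr_sumr; apply: eq_bigr => i _; rewrite mulr_sumr; apply: eq_bigr => j _.
  rewrite mulr_sumr; apply: eq_bigr => k _; rewrite mulr_sumr; apply: eq_bigr => l _.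
  rewrite /G /knprod (Fl i j l k) (Fr i j k l) (Fl i j k l); ring.
under eq_bigr => i _ do under eq_bigr => j _ do under eq_bigr => k _ do rewrite !big_split.
under eq_bigr => i _ do under eq_bigr => j _ do rewrite !big_split.
under eq_bigr => i _ do rewrite !big_split.
rewrite !big_split /=.
set S1 := \sum_i \sum_j \sum_k \sum_l G i j k l.
have -> : \sum_i \sum_j \sum_k \sum_l G j i l k = S1.
  rewrite exchange_big; apply: eq_bigr => i _; apply: eq_bigr => j _.
  by rewrite exchange_big.
have -> : \sum_i \sum_j \sum_k \sum_l G i j l k = S1.
  by apply: eq_bigr => i _; apply: eq_bigr => j _; rewrite exchange_big.
have -> : \sum_i \sum_j \sum_k \sum_l G j i k l = S1 by rewrite exchange_big.
rewrite -sum_delta2 -/S1; ring.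
Qed.

(** The factors [n - r] of the traces taken when the [k] metric factors are contracted; [4] is
    the number of terms of a Kulkarni-Nomizu product. *)
Fixpoint knprod_const k s : R :=
  if k is k'.+1 then 4 * (n%:R - (k + s)%:R) * knprod_const k' s.+2 else 1.

(** Each factor supplies a copy of [W] and a copy of the metric; contracting the metric
    traces the generalized delta. *)
Lemma quad_contraction_knprod c W k S T : size S = size T ->
  quad_contraction (knprod c W) k S T =
  c ^+ k * knprod_const k (size S) * psi W k S T.
Proof.
elim: k S T => [|k IH] S T sST /=; first by rewrite expr0 !mul1r.
rewrite sum_knprod; last 2 first.
- move=> i j l m; rewrite !IH /= ?sST //.
  have /= -> := @psi_swapl R n W k [::] j i S (l :: m :: T); last by rewrite /= sST.
  by rewrite mulrN.
- move=> i j l m; rewrite !IH /= ?sST //.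
  have /= -> := @psi_swapr R n W k (i :: j :: S) [::] m l T; last by rewrite /= sST.
  by rewrite mulrN.
transitivity (4 * c * (\sum_i \sum_l c ^+ k * knprod_const k (size S).+2 *
   (W i l * ((n%:R - (k + (size S).+1)%:R) * psi W k (i :: S) (l :: T))))).
  congr (_ * _); apply: eq_bigr => i _; rewrite exchange_big; apply: eq_bigr => l _ /=.
  rewrite -/(size (i :: S)) -psi_trace /= ?sST // !mulr_sumr; apply: eq_bigr => j _.
  by rewrite IH /= ?sST // psi_swap2 //; ring.
rewrite !mulr_sumr; apply: eq_bigr => i _; rewrite !mulr_sumr; apply: eq_bigr => l _.
by rewrite addSnnS exprS; ring.
Qed.

End knprod.

Lemma knprod_const_gt0 (R : realDomainType) n k s : (k.*2 + s <= n)%N ->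
  0 < @knprod_const R n k s.
Proof.
elim: k s => [|k IH] s kn //=.
rewrite !mulr_gt0 ?IH //; last by rewrite doubleS in kn; lia.
by rewrite subr_gt0 ltr_nat; lia.
Qed.

Lemma gen_kroneckerE (R : realType) n r (I J : r.-tuple 'I_n) :
  gen_kronecker R I J = kron R I J.
Proof.
rewrite /kron /gen_kronecker size_tuple /kron_det; congr (\det _).
apply/matrixP => a b; rewrite !mxE; congr (nat_of_bool _)%:R.
have onthE (L : r.-tuple 'I_n) (c : 'I_r) : onth L c = Some (tnth L c).
  have x0 := tnth L c; rewrite (tnth_nth x0).
  by rewrite onthE (nth_map x0) ?size_tuple.
by rewrite !onthE.
Qed.

(** * Continuously differentiable functions *)

Section line_derivative.
Context (R : realType) (n : nat).
Implicit Types (f g : 'rV[R]_n -> R) (x v : 'rV[R]_n).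

Lemma derive_line f x v : 'D_v f x = 'D_1 (fun h : R => f (h *: v + x)) 0.
Proof.
rewrite /derive; set g1 := fun h => h^-1 *: _; set g2 := fun h => h^-1 *: _.
suff -> : g1 = g2 by [].
by apply/funext => h; rewrite /g1 /g2 /= addr0 scale0r add0r [_%:A]mulr1.
Qed.

Lemma is_derive_line f x v (t : R) : derivable f (t *: v + x) v ->
  is_derive t 1 (fun h : R => f (h *: v + x)) ('D_v f (t *: v + x)).
Proof.
move=> df.
have E : (fun h : R => h^-1 *: (((fun h => f (h *: v + x)) \o shift t) (h *: 1) -
    f (t *: v + x))) =
  (fun h : R => h^-1 *: ((f \o shift (t *: v + x)) (h *: v) - f (t *: v + x))).
  by apply/funext => h /=; rewrite [_%:A]mulr1 scalerDl addrA.
by apply: DeriveDef; rewrite /derivable /derive E.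
Qed.

End line_derivative.

Section continuously_differentiable.
Context (R : realType) (n : nat).
Implicit Types (f g : 'rV[R]_n -> R) (x v : 'rV[R]_n) (i j : 'I_n).

Definition C1 f : Prop := continuous f /\
  forall i, (forall x, derivable f x (delta_mx 0 i)) /\ continuous (partial i f).

Lemma continuous_add f g : continuous f -> continuous g -> continuous (fun x => f x + g x).
Proof. by move=> cf cg x; exact: (continuousD (cf x) (cg x)). Qed.

Lemma continuous_mul f g : continuous f -> continuous g -> continuous (fun x => f x * g x).
Proof. by move=> cf cg x; exact: (continuousM (cf x) (cg x)). Qed.

Lemma continuous_exp f : continuous f -> continuous (fun x => expR (f x)).
Proof.
move=> cf x; apply: (@continuous_comp _ _ _ f (@expR R)); first exact: cf.
exact: continuous_expR.
Qed.

Lemma continuous_bigsum (I : Type) (s : seq I) (G : I -> 'rV[R]_n -> R) :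
  (forall a, continuous (G a)) -> continuous (fun x => \sum_(a <- s) G a x).
Proof.
move=> cG; elim: s => [|i s IH].
  by under eq_fun do rewrite big_nil; exact: cst_continuous.
by under eq_fun do rewrite big_cons; exact: continuous_add.
Qed.

Lemma continuous_norm f : continuous f -> continuous (fun x => `|f x|).
Proof.
move=> cf x; apply: (@continuous_comp _ _ _ f (@Num.norm _ R)); first exact: cf.
exact: norm_continuous.
Qed.

Lemma C1_continuous f : C1 f -> continuous f. Proof. by case. Qed.

Lemma C1_derivable f i x : C1 f -> derivable f x (delta_mx 0 i).
Proof. by case=> _ /(_ i) []. Qed.

Lemma C1_partial f i : C1 f -> continuous (partial i f).
Proof. by case=> _ /(_ i) []. Qed.

Lemma C1_intro f (df : 'I_n -> 'rV[R]_n -> R) : continuous f ->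
  (forall i x, is_derive x (delta_mx 0 i) f (df i x)) ->
  (forall i, continuous (df i)) -> C1 f.
Proof.
move=> cf Hdf cdf; split=> // i; split=> [x|]; first by case: (Hdf i x).
by rewrite (_ : partial i f = df i) //; apply/funext => x; case: (Hdf i x).
Qed.

Lemma C1_cst (c : R) : C1 (fun=> c).
Proof.
apply: (@C1_intro _ (fun _ _ => 0)).
  exact: cst_continuous.
by move=> i; exact: cst_continuous.
Qed.

Lemma partial_cst (c : R) i x : partial i (fun=> c) x = 0.
Proof. exact: derive_cst. Qed.

Lemma partialD f g i x : C1 f -> C1 g ->
  partial i (fun y => f y + g y) x = partial i f x + partial i g x.
Proof. by move=> cf cg; apply: deriveD; exact: C1_derivable. Qed.

Lemma C1D f g : C1 f -> C1 g -> C1 (fun x => f x + g x).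
Proof.
move=> cf cg; apply: (@C1_intro _ (fun i x => partial i f x + partial i g x)).
- exact: continuous_add (C1_continuous cf) (C1_continuous cg).
- move=> i x; apply: is_deriveD; apply: derivableP; exact: C1_derivable.
- by move=> i; exact: continuous_add (C1_partial cf) (C1_partial cg).
Qed.

Lemma partialM f g i x : C1 f -> C1 g ->
  partial i (fun y => f y * g y) x = partial i f x * g x + f x * partial i g x.
Proof.
move=> cf cg; rewrite /partial.
have := deriveM (C1_derivable (i := i) (x := x) cf) (C1_derivable (i := i) (x := x) cg).
by rewrite /GRing.scale /= => ->; rewrite addrC [g x * _]mulrC.
Qed.

Lemma C1M f g : C1 f -> C1 g -> C1 (fun x => f x * g x).
Proof.
move=> cf cg; split; first exact: continuous_mul (C1_continuous cf) (C1_continuous cg).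
move=> i; split; first by move=> x; apply: derivableM; exact: C1_derivable.
rewrite (_ : partial i _ = fun x => partial i f x * g x + f x * partial i g x).
  apply: continuous_add; apply: continuous_mul.
  - exact: (C1_partial cf).
  - exact: (C1_continuous cg).
  - exact: (C1_continuous cf).
  - exact: (C1_partial cg).
by apply/funext => x; exact: partialM.
Qed.

Lemma partialZ (c : R) f i x : C1 f -> partial i (fun y => c * f y) x = c * partial i f x.
Proof.
by move=> cf; rewrite partialM // ?partial_cst ?mul0r ?add0r //; exact: C1_cst.
Qed.

Lemma partialZr (c : R) f i x : C1 f -> partial i (fun y => f y * c) x = partial i f x * c.
Proof.
move=> cf; rewrite mulrC -(partialZ c i x cf).
by have -> : (fun y => f y * c) = (fun y => c * f y) by apply/funext => y; rewrite mulrC.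
Qed.

Lemma C1Z (c : R) f : C1 f -> C1 (fun x => c * f x).
Proof. by move=> cf; apply: C1M => //; exact: C1_cst. Qed.

Lemma C1N f : C1 f -> C1 (fun x => - f x).
Proof.
move=> cf; rewrite (_ : (fun x => - f x) = (fun x => -1 * f x)); first exact: C1Z.
by apply/funext => x; rewrite mulN1r.
Qed.

Lemma partialN f i x : C1 f -> partial i (fun y => - f y) x = - partial i f x.
Proof.
move=> cf; rewrite -mulN1r -partialZ //; congr (partial _ _ _).
by apply/funext => y; rewrite mulN1r.
Qed.

Lemma C1B f g : C1 f -> C1 g -> C1 (fun x => f x - g x).
Proof. by move=> cf cg; apply: C1D => //; exact: C1N. Qed.

Lemma partialB f g i x : C1 f -> C1 g ->
  partial i (fun y => f y - g y) x = partial i f x - partial i g x.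
Proof. by move=> cf cg; rewrite partialD ?partialN //; exact: C1N. Qed.

Lemma C1_sum (I : Type) (s : seq I) (F : I -> 'rV[R]_n -> R) :
  (forall a, C1 (F a)) -> C1 (fun x => \sum_(a <- s) F a x).
Proof.
move=> cF; elim: s => [|a s IH].
  rewrite (_ : (fun x => _) = fun=> 0); first exact: C1_cst.
  by apply/funext => x; rewrite big_nil.
rewrite (_ : (fun x => _) = fun x => F a x + \sum_(b <- s) F b x); first exact: C1D.
by apply/funext => x; rewrite big_cons.
Qed.

Lemma partial_sum (I : Type) (s : seq I) (F : I -> 'rV[R]_n -> R) i x :
  (forall a, C1 (F a)) ->
  partial i (fun y => \sum_(a <- s) F a y) x = \sum_(a <- s) partial i (F a) x.
Proof.
move=> cF; elim: s => [|a s IH].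
  rewrite big_nil (_ : (fun y => _) = fun=> 0) ?partial_cst //.
  by apply/funext => y; rewrite big_nil.
rewrite big_cons -IH -partialD //; last exact: C1_sum.
by congr (partial _ _ _); apply/funext => y; rewrite big_cons.
Qed.

Lemma C1X f m : C1 f -> C1 (fun x => f x ^+ m).
Proof.
move=> cf; elim: m => [|m IH].
  by rewrite (_ : (fun x => _) = fun=> 1); [exact: C1_cst|apply/funext => x; rewrite expr0].
rewrite (_ : (fun x => _) = fun x => f x * f x ^+ m); first exact: C1M.
by apply/funext => x; rewrite exprS.
Qed.

Lemma partialX f m i x : C1 f ->
  partial i (fun y => f y ^+ m) x = m%:R * f x ^+ m.-1 * partial i f x.
Proof.
move=> cf; elim: m => [|m IH].
  rewrite (_ : (fun x => _) = fun=> 1); first by rewrite partial_cst !mul0r.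
  by apply/funext => y; rewrite expr0.
rewrite (_ : (fun x => _) = fun x => f x * f x ^+ m); last first.
  by apply/funext => y; rewrite exprS.
rewrite partialM ?IH //=; last exact: C1X.
by case: m {IH} => [|m]; rewrite ?expr0 /= ?exprS -?natr1; ring.
Qed.

Lemma is_derive_exp f i x : C1 f ->
  is_derive x (delta_mx 0 i) (fun y => expR (f y)) (partial i f x * expR (f x)).
Proof.
move=> cf.
have := is_derive_line (t := 0) (f := f) (x := x) (v := delta_mx 0 i).
rewrite scale0r add0r => /(_ (C1_derivable cf)) dl.
have dexp : is_derive (f (0 *: delta_mx 0 i + x)) 1 (@expR R) (expR (f x)).
  by rewrite scale0r add0r; exact: is_derive_expR.
have [d1 d2] := @is_derive1_comp R (@expR R) (fun h : R => f (h *: delta_mx 0 i + x))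
  0 _ _ dexp dl.
apply: DeriveDef; first by apply/derivable1P.
by rewrite derive_line; rewrite mulrC; exact: d2.
Qed.

Lemma C1_exp f : C1 f -> C1 (fun x => expR (f x)).
Proof.
move=> cf; apply: (@C1_intro _ (fun i x => partial i f x * expR (f x))).
- exact: continuous_exp (C1_continuous cf).
- by move=> i x; exact: is_derive_exp.
- by move=> i; exact: continuous_mul (C1_partial cf) (continuous_exp (C1_continuous cf)).
Qed.

Lemma partial_exp f i x : C1 f ->
  partial i (fun y => expR (f y)) x = partial i f x * expR (f x).
Proof. by move=> cf; case: (is_derive_exp i x cf). Qed.

Lemma continuous_coord i : continuous (fun x : 'rV[R]_n => x 0 i).
Proof. exact: coord_continuous. Qed.

Lemma is_derive_coord i j x :
  is_derive x (delta_mx 0 i) (fun y : 'rV[R]_n => y 0 j) (j == i)%:R.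
Proof.
have E : (fun h : R => h^-1 *: (((fun y : 'rV[R]_n => y 0 j) \o shift x) (h *: delta_mx 0 i) - x 0 j))
   @ 0^' --> ((j == i)%:R : R).
  apply: cvg_near_cst; near=> h.
  rewrite /= !mxE eqxx /= addrK scalerA mulVf ?scale1r //.
  by near: h; exact: nbhs_dnbhs_neq.
apply: DeriveDef; first by apply/cvg_ex; eexists; exact: E.
by apply/cvg_lim => //; exact: E.
Unshelve. all: by end_near. Qed.

Lemma C1_coord j : C1 (fun x : 'rV[R]_n => x 0 j).
Proof.
apply: (@C1_intro _ (fun i _ => (j == i)%:R)).
- exact: continuous_coord.
- by move=> i x; exact: is_derive_coord.
- by move=> i; exact: cst_continuous.
Qed.

Lemma partial_coord i j x : partial i (fun x : 'rV[R]_n => x 0 j) x = (j == i)%:R.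
Proof. by case: (is_derive_coord i j x). Qed.

End continuously_differentiable.

(** * Symmetry of mixed partial derivatives *)

Section mixed_partials.
Context (R : realType) (n : nat).
Implicit Types (f g : 'rV[R]_n -> R) (x : 'rV[R]_n) (i j : 'I_n).

Local Notation e i := (delta_mx 0 i : 'rV[R]_n).

Lemma mean_value_line f i x (h : R) : 0 < h -> C1 f ->
  exists2 c, 0 < c < h &
    f (h *: e i + x) - f x = partial i f (c *: e i + x) * h.
Proof.
move=> h0 cf.
have dl (t : R) : is_derive t 1 (fun s : R => f (s *: e i + x)) (partial i f (t *: e i + x)).
  by apply: is_derive_line; exact: C1_derivable.
have [|c] := @MVT R (fun s : R => f (s *: e i + x))
  (fun s : R => partial i f (s *: e i + x)) 0 h h0 (fun t _ => dl t).
  apply: derivable_within_continuous => t _.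
  by case: (dl t).
by rewrite in_itv /= scale0r add0r subr0 => ch ->; exists c.
Qed.

Definition second_difference f i j x (h : R) : R :=
  f (h *: e i + (h *: e j + x)) - f (h *: e i + x) - (f (h *: e j + x) - f x).

Lemma second_differenceE f i j x (h : R) : 0 < h ->
  C1 f -> C1 (partial i f) ->
  exists c d, [/\ 0 < c < h, 0 < d < h &
  second_difference f i j x h = partial j (partial i f) (d *: e j + (c *: e i + x)) * h ^+ 2].
Proof.
move=> h0 cf cdf.
have shift_line (t : R) y : is_derive t 1 (fun s : R => f (s *: e i + y)) (partial i f (t *: e i + y)).
  by apply: is_derive_line; exact: C1_derivable.
have dl (t : R) : is_derive t 1
    (fun s : R => f (s *: e i + (h *: e j + x)) - f (s *: e i + x))
    (partial i f (t *: e i + (h *: e j + x)) - partial i f (t *: e i + x)).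
  exact: is_deriveB.
have [|c] := @MVT R (fun s : R => f (s *: e i + (h *: e j + x)) - f (s *: e i + x))
  (fun t : R => partial i f (t *: e i + (h *: e j + x)) - partial i f (t *: e i + x))
  0 h h0 (fun t _ => dl t).
  apply: derivable_within_continuous => t _.
  by case: (dl t).
rewrite in_itv /= => ch.
rewrite !scale0r !add0r subr0 => E.
have [d dh E2] := mean_value_line j (c *: e i + x) h0 cdf.
exists c, d; split => //.
by rewrite /second_difference E [c *: _ + _]addrCA E2 -mulrA -expr2.
Qed.

Lemma second_differenceC f i j x (h : R) :
  second_difference f i j x h = second_difference f j i x h.
Proof. by rewrite /second_difference addrCA; ring. Qed.

Lemma continuous_at_corner g i j x (eps : R) : continuous g -> 0 < eps ->
  exists2 del : R, 0 < del & forall c d, 0 < c < del -> 0 < d < del ->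
    `|g x - g (d *: e j + (c *: e i + x))| < eps.
Proof.
move=> cg eps0.
have /nbhs_ballP[r /= r0 br] : \forall y \near x, `|g x - g y| < eps.
  by apply: (@cvgr_dist_lt _ _ _ (nbhs x)) => //; exact: cg.
exists (r / 2); first by rewrite divr_gt0.
move=> c d /andP[c0 cr] /andP[d0 dr]; apply: br; split => // a b.
rewrite !mxE /ball /= [a]ord1 eqxx /= addrA opprD addrCA subrr addr0 normrN.
by case: (b == i); case: (b == j); rewrite ?mulr1 ?mulr0 ?addr0 ?add0r ?normr0 //
  ger0_norm; lra.
Qed.

Lemma dist_le_halves (a b z eps : R) :
  `|a - z| < eps / 2 -> `|b - z| < eps / 2 -> `|a - b| <= eps.
Proof. by rewrite !ltr_norml ler_norml; lra. Qed.

(** By the mean value theorem, used once in each variable, the second difference over a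
    small square is [h^2] times a mixed derivative at a nearby point, in either order of
    differentiation. *)
Lemma partialC f i j x : C1 f -> C1 (partial i f) -> C1 (partial j f) ->
  partial i (partial j f) x = partial j (partial i f) x.
Proof.
move=> cf ci cj; apply/eqP; rewrite -subr_eq0 -normr_le0.
apply/ler_addgt0Pl => eps eps0; rewrite addr0.
have e20 : 0 < eps / 2 by rewrite divr_gt0.
have [d1 d10 H1] := continuous_at_corner j i x (C1_partial (i := i) cj) e20.
have [d2 d20 H2] := continuous_at_corner i j x (C1_partial (i := j) ci) e20.
pose h := Num.min d1 d2.
have h0 : 0 < h by rewrite lt_min d10 d20.
have [c [d [ch dh E1]]] := second_differenceE j x h0 cf ci.
have [c' [d' [ch' dh' E2]]] := second_differenceE i x h0 cf cj.
have := second_differenceC f i j x h; rewrite {}E1 {}E2.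
move/mulIf => /(_ _)/wrap[]; first by rewrite expf_neq0 // gt_eqF.
have lt12 a : 0 < a < h -> 0 < a < d1 /\ 0 < a < d2.
  by rewrite /h lt_min => /andP[-> /andP[-> ->]].
have := H2 c d (lt12 _ ch).2 (lt12 _ dh).2.
have := H1 c' d' (lt12 _ ch').1 (lt12 _ dh').1.
move=> A B E; rewrite E in B.
set z := partial i (partial j f) _ in A B.
exact: (dist_le_halves A B).
Qed.

Lemma smooth_C1 f (s : seq 'I_n) : smooth f -> C1 (iter_partial s f).
Proof.
move=> sf; split; first by case: (sf s).
move=> i; split; first by case: (sf s).
by case: (sf (i :: s)).
Qed.

End mixed_partials.

(** * Elementary symmetric functions and Newton tensors *)

Section newton_tensor.
Context (R : numFieldType) (n : nat).
Implicit Types (W : 'M[R]_n) (b : nat).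

Definition sigma W b : R := psi W b [::] [::] / b`!%:R.

Definition newton W b : 'M[R]_n := \matrix_(i, j) (psi W b [:: i] [:: j] / b`!%:R).

Lemma fact_neq0 b : b`!%:R != 0 :> R.
Proof. by rewrite pnatr_eq0 -lt0n fact_gt0. Qed.

Lemma sigma0 W : sigma W 0 = 1.
Proof. by rewrite /sigma /= /kron /kron_det det_mx00 divr1. Qed.

Lemma newton0 W : newton W 0 = 1%:M.
Proof.
apply/matrixP => i j; rewrite !mxE /= divr1 /kron /kron_det /= [X in \det X]mx11_scalar.
by rewrite det_scalar1 !mxE.
Qed.

Lemma sigmaS W b : b.+1%:R * sigma W b.+1 = \tr (W^T *m newton W b).
Proof.
rewrite /sigma factS natrM invfM mulrCA mulVKf ?pnatr_eq0 //.
rewrite mulrC psiS /mxtrace exchange_big /= ?mulr_sumr.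
under [RHS]eq_bigr => i _ do rewrite mxE.
apply: eq_bigr => j _; rewrite mulr_sumr; apply: eq_bigr => i _.
by rewrite !mxE; ring.
Qed.

Lemma newtonS W b : newton W b.+1 = (sigma W b.+1)%:M - W^T *m newton W b.
Proof.
apply/matrixP => i j; rewrite !mxE psi_newton mulrBl; congr (_ - _).
  by rewrite -[RHS]mulr_natl /sigma mulrA.
rewrite factS natrM -mulf_div divff ?pnatr_eq0 // mul1r mulr_suml.
by apply: eq_bigr => l _; rewrite !mxE mulrA.
Qed.

Lemma mxtrace_newton W b : \tr (newton W b) = (n%:R - b%:R) * sigma W b.
Proof.
rewrite /mxtrace; under eq_bigr => i _ do rewrite mxE.
by rewrite -mulr_suml psi_trace //= addn0 mulrA.
Qed.

Lemma newton_tr W b : W^T = W -> (newton W b)^T = newton W b.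
Proof. by move=> sW; apply/matrixP => i j; rewrite !mxE psi_tr // sW. Qed.

Lemma newton_comm W b : W^T = W -> newton W b *m W = W *m newton W b.
Proof.
move=> sW.
have : (W *m newton W b)^T = W *m newton W b.
  have -> : W *m newton W b = (sigma W b.+1)%:M - newton W b.+1.
    by rewrite newtonS sW opprB addrC subrK.
  by rewrite linearB /= tr_scalar_mx newton_tr.
by rewrite trmx_mul newton_tr // sW.
Qed.

Lemma newtonS_mul W b m (v : 'M[R]_(n, m)) : W^T = W ->
  W *m (newton W b *m v) = sigma W b.+1 *: v - newton W b.+1 *m v.
Proof.
by move=> sW; rewrite newtonS sW mulmxBl mul_scalar_mx opprB addrC subrK mulmxA.
Qed.

(** The induction step for the divergence of the Newton tensors of the Schouten
    tensor [W = H + p p^T - |p|^2/2]: the left-hand side is what the product rule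
    gives for [div (newton W b.+1)], where [V] stands for [div (newton W b)] and the
    terms in [H] come from the defect of [W] from being a Codazzi tensor. *)
Lemma newton_divergence_step W (H : 'M[R]_n) (p V : 'cV[R]_n) (q : R) b :
  W^T = W -> H = W - p *m p^T + (q / 2)%:M -> p^T *m p = q%:M ->
  V = (n%:R - b.*2%:R) *: (newton W b *m p) - ((n%:R - b%:R) * sigma W b) *: p ->
  H *m (newton W b *m p) - \tr (newton W b *m H) *: p - \tr (newton W b) *: (H *m p)
   + newton W b *m (H *m p) - W *m V =
  (n%:R - b.+1.*2%:R) *: (newton W b.+1 *m p) - ((n%:R - b.+1%:R) * sigma W b.+1) *: p.
Proof.
move=> sW -> pq ->; set T := newton W b.
have TW : T *m W = W *m T by exact: newton_comm.
pose z : R := (p^T *m (T *m p)) 0 0.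
have zE : p^T *m (T *m p) = z%:M by rewrite [LHS]mx11_scalar.
have trTH : \tr (T *m (W - p *m p^T + (q / 2)%:M)) =
    b.+1%:R * sigma W b.+1 - z + q / 2 * ((n%:R - b%:R) * sigma W b).
  have tr1 : \tr (T *m W) = b.+1%:R * sigma W b.+1 by rewrite sigmaS sW TW.
  have tr2 : \tr (T *m (p *m p^T)) = z.
    by rewrite mulmxA mxtrace_mulC zE mxtrace_scalar mulr1n.
  have tr3 : \tr (T *m (q / 2)%:M) = q / 2 * ((n%:R - b%:R) * sigma W b).
    by rewrite mul_mx_scalar mxtraceZ mxtrace_newton.
  by rewrite mulmxDr mulmxBr mxtraceD raddfB /= tr1 tr2 tr3.
rewrite trTH mxtrace_newton newtonS sW !mulmxBl !mulmxDl !mulNmx !mul_scalar_mx.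
rewrite -!mulmxA pq zE !mul_mx_scalar !mulmxDr !mulmxN -!scalemxAr.
rewrite [T *m (W *m p)]mulmxA TW -mulmxA -/T.
set v1 := W *m (T *m p); set v2 := T *m p; set v3 := W *m p.
apply/matrixP => i j; rewrite !mxE -!muln2 !natrM -!natr1.
move: (v1 i j) (v2 i j) (v3 i j) (p i j) => x1 x2 x3 x4.
by field; rewrite ?pnatr_eq0.
Qed.

End newton_tensor.

Section psi_calculus.
Context (R : realType) (n : nat) (W : 'rV[R]_n -> 'M[R]_n).
Hypothesis C1_W : forall i j, C1 (fun x => W x i j).

Lemma C1_psi k S T : C1 (fun x => psi (W x) k S T).
Proof.
elim: k S T => [|k IH] S T; first exact: C1_cst.
by apply: C1_sum => i; apply: C1_sum => j; exact: C1M.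
Qed.

(** The [k] copies of [W] enter multilinearly and symmetrically. *)
Lemma partial_psi m k S T x : size S = size T ->
  partial m (fun y => psi (W y) k S T) x =
  k%:R * \sum_i \sum_j partial m (fun y => W y i j) x * psi (W x) k.-1 (i :: S) (j :: T).
Proof.
elim: k S T => [|k IH] S T sST; first by rewrite mul0r partial_cst.
pose D i j := partial m (fun y => W y i j) x.
rewrite partial_sum; last by move=> i; apply: C1_sum => j; apply: C1M => //; exact: C1_psi.
transitivity (\sum_i \sum_j (D i j * psi (W x) k (i :: S) (j :: T) +
   k%:R * \sum_i' \sum_j' D i' j' * (W x i j * psi (W x) k.-1 (i :: i' :: S) (j :: j' :: T)))).
  apply: eq_bigr => i _.
  rewrite partial_sum; last by move=> j; apply: C1M => //; exact: C1_psi.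
  apply: eq_bigr => j _; rewrite partialM //; last exact: C1_psi.
  rewrite IH /= ?sST // mulrCA; congr (_ + _ * _).
  rewrite mulr_sumr; apply: eq_bigr => i' _; rewrite mulr_sumr; apply: eq_bigr => j' _.
  by rewrite mulrCA psi_swap2.
under eq_bigr => i _ do rewrite big_split.
rewrite big_split /= -natr1 mulrDl mul1r [RHS]addrC; congr (_ + _).
under eq_bigr => i _ do rewrite -mulr_sumr.
rewrite -mulr_sumr; case: k IH => [|k] _; first by rewrite !mul0r.
congr (_ * _).
transitivity (\sum_i \sum_i' \sum_j' \sum_j
  D i' j' * (W x i j * psi (W x) k [:: i, i' & S] [:: j, j' & T])).
  apply: eq_bigr => i _; rewrite exchange_big /=; apply: eq_bigr => i' _.
  by rewrite exchange_big.
rewrite exchange_big /=; apply: eq_bigr => i' _.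
rewrite exchange_big /=; apply: eq_bigr => j' _.
by rewrite mulr_sumr; apply: eq_bigr => i _; rewrite mulr_sumr.
Qed.

Lemma C1_sigma b : C1 (fun x => sigma (W x) b).
Proof. by apply: C1M; [exact: C1_psi|exact: C1_cst]. Qed.

Lemma C1_newton b i j : C1 (fun x => newton (W x) b i j).
Proof.
rewrite (_ : (fun x => _) = fun x => psi (W x) b [:: i] [:: j] / b`!%:R).
  by apply: C1M; [exact: C1_psi|exact: C1_cst].
by apply/funext => x; rewrite mxE.
Qed.

Lemma partial_sigma m b x : partial m (fun y => sigma (W y) b.+1) x =
  \sum_i \sum_j partial m (fun y => W y i j) x * newton (W x) b i j.
Proof.
rewrite /sigma partialM ?partial_cst ?mulr0 ?addr0 ?partial_psi //; last 2 first.
- exact: C1_psi.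
- exact: C1_cst.
rewrite factS natrM -mulf_div divff ?pnatr_eq0 // mul1r mulr_suml.
apply: eq_bigr => i _; rewrite mulr_suml; apply: eq_bigr => j _.
by rewrite mxE mulrA.
Qed.

End psi_calculus.

(** * The Schouten tensor of a conformally flat metric *)

Section kronecker_sums.
Context (R : nzRingType) (n : nat).

Lemma sum_mul_delta (F : 'I_n -> R) i : \sum_j F j * (i == j)%:R = F i.
Proof.
rewrite (bigD1 i) //= eqxx mulr1 big1 ?addr0 // => j /negbTE.
by rewrite eq_sym => ->; rewrite mulr0.
Qed.

End kronecker_sums.

Section schouten.
Context (R : realType) (n : nat) (u : 'rV[R]_n -> R).
Implicit Types (x : 'rV[R]_n) (i j l m : 'I_n).

Definition grad x : 'cV[R]_n := \col_i partial i u x.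
Definition hess x : 'M[R]_n := \matrix_(i, j) partial i (partial j u) x.
Definition gradsq x : R := \sum_i partial i u x ^+ 2.
(** The Schouten tensor of the metric [exp(-2u) delta]. *)
Definition schouten x : 'M[R]_n :=
  hess x + grad x *m (grad x)^T - (gradsq x / 2)%:M.

Lemma schoutenE x i j : schouten x i j =
  partial i (partial j u) x + partial i u x * partial j u x - gradsq x / 2 * (i == j)%:R.
Proof. by rewrite !mxE big_ord1 !mxE mulr_natr. Qed.

Hypothesis smooth_u : smooth u.

Lemma C1_u : C1 u. Proof. exact: (smooth_C1 [::] smooth_u). Qed.

Lemma C1_du i : C1 (partial i u). Proof. exact: (smooth_C1 [:: i] smooth_u). Qed.

Lemma C1_ddu i j : C1 (partial i (partial j u)).
Proof. exact: (smooth_C1 [:: i; j] smooth_u). Qed.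

Lemma ddu_sym i j x : partial i (partial j u) x = partial j (partial i u) x.
Proof. exact: (partialC x C1_u (C1_du i) (C1_du j)). Qed.

Lemma dddu_sym m i j x :
  partial m (partial i (partial j u)) x = partial i (partial m (partial j u)) x.
Proof. exact: (partialC x (C1_du j) (C1_ddu m j) (C1_ddu i j)). Qed.

Lemma C1_gradsq : C1 gradsq.
Proof. by apply: C1_sum => i; exact: (C1X 2 (C1_du i)). Qed.

Lemma partial_gradsq m x :
  partial m gradsq x = 2 * \sum_l partial m (partial l u) x * partial l u x.
Proof.
rewrite partial_sum; last by move=> i; exact: (C1X 2 (C1_du i)).
by rewrite mulr_sumr; apply: eq_bigr => i _; rewrite (partialX 2 m x (C1_du i)) expr1 mulrAC mulrA.
Qed.

Lemma gradsqE x : (grad x)^T *m grad x = (gradsq x)%:M.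
Proof.
rewrite [LHS]mx11_scalar; congr (_%:M); rewrite !mxE; apply: eq_bigr => i _.
by rewrite !mxE expr2.
Qed.

Lemma hess_tr x : (hess x)^T = hess x.
Proof. by apply/matrixP => i j; rewrite !mxE ddu_sym. Qed.

Lemma schouten_tr x : (schouten x)^T = schouten x.
Proof. by apply/matrixP => i j; rewrite mxE !schoutenE ddu_sym eq_sym [_ * partial i u x]mulrC. Qed.

Lemma hessE x : hess x = schouten x - grad x *m (grad x)^T + (gradsq x / 2)%:M.
Proof. by rewrite /schouten -[RHS]addrA [- _ + _]addrC addrA subrK addrK. Qed.

Lemma schouten_funE i j : (fun x => schouten x i j) = (fun x =>
  partial i (partial j u) x + partial i u x * partial j u x - gradsq x * (2^-1 * (i == j)%:R)).
Proof. by apply/funext => x; rewrite schoutenE mulrA. Qed.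

Lemma C1_schouten i j : C1 (fun x => schouten x i j).
Proof.
rewrite schouten_funE.
exact: (C1B (C1D (C1_ddu i j) (C1M (C1_du i) (C1_du j))) (C1M C1_gradsq (C1_cst _ _))).
Qed.

Lemma partial_schouten m i j x : partial m (fun y => schouten y i j) x =
  partial m (partial i (partial j u)) x + hess x m i * grad x j 0
  + grad x i 0 * hess x m j - (hess x *m grad x) m 0 * (i == j)%:R.
Proof.
have cg := C1_gradsq; have cA := C1_ddu i j.
have cB := C1M (C1_du i) (C1_du j).
have cD : C1 (fun _ : 'rV[R]_n => 2^-1 * (i == j)%:R) := C1_cst _ _.
rewrite schouten_funE (partialB m x (C1D cA cB) (C1M cg cD)) (partialD m x cA cB).
rewrite (partialM m x (C1_du i) (C1_du j)) (partialM m x cg cD) partial_cst mulr0 addr0.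
rewrite partial_gradsq mulrACA mulfV ?mul1r ?pnatr_eq0 // addrA !mxE.
by congr (_ + _ + _ - _ * _); apply: eq_bigr => l _; rewrite !mxE.
Qed.

(** The third derivatives of [u] cancel. The right-hand side is the Christoffel correction in
    the Codazzi equation of the conformal metric. *)
Lemma schouten_codazzi i j l x :
  partial i (fun y => schouten y l j) x - partial j (fun y => schouten y i l) x =
  grad x j 0 * hess x i l - grad x i 0 * hess x j l
  - (hess x *m grad x) i 0 * (l == j)%:R + (hess x *m grad x) j 0 * (i == l)%:R.
Proof.
rewrite !partial_schouten (dddu_sym j i l).
have h (a b : 'I_n) : hess x a b = hess x b a by rewrite -[in LHS]hess_tr mxE.
have -> : partial l (partial j u) = partial j (partial l u).
  by apply/funext => y; exact: ddu_sym.
rewrite (h j i); move: (partial i (partial j (partial l u)) x) (hess x i l) (hess x i j)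
  (hess x j l) (grad x j 0) (grad x i 0) (grad x l 0) ((hess x *m grad x) i 0)
  ((hess x *m grad x) j 0) (l == j)%:R (i == l)%:R => a1 a2 a3 a4 a5 a6 a7 a8 a9 a10 a11.
by ring.
Qed.

Local Notation T b := (fun x => newton (schouten x) b).
Local Notation s b := (fun x => sigma (schouten x) b).

Definition newton_div b x : 'cV[R]_n :=
  \col_i \sum_j partial j (fun y => newton (schouten y) b i j) x.

(** For the conformal metric [exp(-2u) delta] the mixed Newton tensors are
    divergence free; this is the same identity written with Euclidean derivatives. *)
Lemma newton_divE b x : newton_div b x =
  (n%:R - b.*2%:R) *: (newton (schouten x) b *m grad x)
  - ((n%:R - b%:R) * sigma (schouten x) b) *: grad x.
Proof.
elim: b => [|b IH].
  rewrite newton0 sigma0 mul1mx mulr1 double0 subrr.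
  apply/matrixP => i j; rewrite !mxE big1 // => l _.
  by rewrite (_ : (fun y => _) = fun=> 1%:M i l) ?partial_cst //; apply/funext => y; rewrite newton0.
rewrite -(newton_divergence_step (schouten_tr x) (hessE x) (gradsqE x) IH).
apply/colP => i; rewrite mxE.
have CT a c : C1 (fun y => newton (schouten y) b a c) by apply: C1_newton; exact: C1_schouten.
have Cs : C1 (fun y => sigma (schouten y) b.+1) by apply: C1_sigma; exact: C1_schouten.
transitivity (\sum_j (partial j (fun y => sigma (schouten y) b.+1) x * (i == j)%:R -
    \sum_l (partial j (fun y => schouten y i l) x * newton (schouten x) b l j +
            schouten x i l * partial j (fun y => newton (schouten y) b l j) x))).
  apply: eq_bigr => j _.
  rewrite (_ : (fun y => _) = fun y => sigma (schouten y) b.+1 * (i == j)%:R -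
    \sum_l schouten y i l * newton (schouten y) b l j); last first.
    by apply/funext => y; rewrite newtonS schouten_tr !mxE mulr_natr.
  rewrite partialB; last 2 first.
  - by apply: C1M => //; exact: C1_cst.
  - by apply: C1_sum => l; apply: C1M => //; exact: C1_schouten.
  rewrite partialM ?partial_cst ?mulr0 ?addr0 //; last exact: C1_cst.
  rewrite partial_sum; last by move=> l; apply: C1M => //; exact: C1_schouten.
  congr (_ - _); apply: eq_bigr => l _; rewrite partialM //; exact: C1_schouten.
rewrite sumrB sum_mul_delta (partial_sigma C1_schouten).
under [X in _ - X]eq_bigr => j _ do rewrite big_split.
rewrite big_split /= opprD addrA.
rewrite [X in X - _ - _]exchange_big /= -sumrB.
transitivity (\sum_j \sum_l (grad x j 0 * hess x i l - grad x i 0 * hess x j l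
  - (hess x *m grad x) i 0 * (l == j)%:R + (hess x *m grad x) j 0 * (i == l)%:R)
   * newton (schouten x) b l j - (schouten x *m newton_div b x) i 0).
  congr (_ - _).
    apply: eq_bigr => j _; rewrite -sumrB; apply: eq_bigr => l _.
    by rewrite -schouten_codazzi mulrBl.
  rewrite [RHS]mxE exchange_big /=; apply: eq_bigr => l _.
  by rewrite [newton_div b x l 0]mxE mulr_sumr.
rewrite [in RHS]mxE [X in _ = _ + X]mxE; congr (_ - _).
set N := newton _ _; set h := hess x; set p := grad x.
transitivity (\sum_j \sum_l (h i l * (N l j * p j 0) - N l j * h j l * p i 0
   - N l j * (l == j)%:R * (h *m p) i 0 + N l j * (i == l)%:R * (h *m p) j 0)).
  by apply: eq_bigr => j _; apply: eq_bigr => l _; ring.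
under eq_bigr => j _ do rewrite big_split sumrB sumrB /=.
rewrite big_split !sumrB /=.
have -> (A B C D : 'cV[R]_n) : (A - B - C + D) i 0 = A i 0 - B i 0 - C i 0 + D i 0.
  by rewrite !mxE.
rewrite [(h *m (N *m p)) i 0]mxE [(N *m (h *m p)) i 0]mxE.
have scE (c : R) (v : 'cV[R]_n) : (c *: v) i 0 = c * v i 0 by rewrite mxE.
rewrite !scE.
rewrite /mxtrace; congr (_ - _ - _ + _).
- rewrite exchange_big; apply: eq_bigr => l _ /=.
  by rewrite [(N *m p) l 0]mxE mulr_sumr.
- rewrite exchange_big mulr_suml; apply: eq_bigr => l _ /=.
  by rewrite [(N *m h) l l]mxE mulr_suml.
- rewrite mulr_suml; apply: eq_bigr => j _ /=; rewrite -mulr_suml.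
  under eq_bigr => l _ do rewrite eq_sym.
  by rewrite sum_mul_delta.
- apply: eq_bigr => j _ /=; rewrite -mulr_suml; congr (_ * _).
  exact: (sum_mul_delta (N ^~ j)).
Qed.

End schouten.

(** * A vector field with nonnegative divergence *)

Section mass_field.
Context (R : realType) (n : nat) (u : 'rV[R]_n -> R).
Hypothesis smooth_u : smooth u.
Implicit Types (x : 'rV[R]_n) (i j l m : 'I_n).

Local Notation T b x := (newton (schouten u x) b).
Local Notation s b x := (sigma (schouten u x) b).
Local Notation p := (grad u).
Local Notation q := (gradsq u).
Local Notation H := (hess u).

Definition newton_form b x : R := ((p x)^T *m (T b x *m p x)) 0 0.

Local Notation z := newton_form.

Lemma newton_form0 x : z 0 x = q x.
Proof. by rewrite /newton_form newton0 mul1mx gradsqE mxE mulr1n. Qed.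

Lemma newton_formE b x : (p x)^T *m (T b x *m p x) = (z b x)%:M.
Proof. by rewrite [LHS]mx11_scalar. Qed.

Definition newton_grad b i x : R := (T b x *m p x) i 0.

Lemma newton_gradE b i : newton_grad b i =
  fun x => \sum_j T b x i j * partial j u x.
Proof.
by apply/funext => x; rewrite /newton_grad mxE; apply: eq_bigr => j _; rewrite [p x j 0]mxE.
Qed.

Let C1T b i j : C1 (fun x => T b x i j).
Proof. exact: (C1_newton (C1_schouten smooth_u)). Qed.

Lemma C1_newton_grad b i : C1 (newton_grad b i).
Proof.
rewrite newton_gradE; apply: C1_sum => j.
exact: (C1M (C1T b i j) (C1_du smooth_u j)).
Qed.

Lemma mxtrace_newton_hess b x : \tr (T b x *m H x) =
  b.+1%:R * s b.+1 x - z b x + q x / 2 * ((n%:R - b%:R) * s b x).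
Proof.
rewrite hessE mulmxDr mulmxBr mxtraceD raddfB /=; congr (_ - _ + _).
- by rewrite sigmaS schouten_tr // newton_comm // schouten_tr.
- by rewrite mulmxA mxtrace_mulC newton_formE mxtrace_scalar mulr1n.
- by rewrite mul_mx_scalar mxtraceZ mxtrace_newton.
Qed.

(** The product rule, with [newton_divE] for the tensor and [hessE] for the Hessian of [u]. *)
Lemma div_newton_grad b x : \sum_i partial i (newton_grad b i) x =
  b.+1%:R * s b.+1 x - (n%:R - b%:R) / 2 * (q x * s b x)
  + (n%:R - b.*2%:R - 1) * z b x.
Proof.
transitivity (((p x)^T *m newton_div u b x) 0 0 + \tr (T b x *m H x)).
  transitivity (\sum_i \sum_j (partial i (fun y => T b y i j) x * partial j u x
      + T b x i j * partial i (partial j u) x)).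
    apply: eq_bigr => i _; rewrite newton_gradE partial_sum; last first.
      by move=> j; exact: (C1M (C1T b i j) (C1_du smooth_u j)).
    by apply: eq_bigr => j _; rewrite (partialM i x (C1T b i j) (C1_du smooth_u j)).
  under eq_bigr => i _ do rewrite big_split.
  rewrite big_split /=; congr (_ + _).
    rewrite exchange_big mxE; apply: eq_bigr => j _ /=.
    rewrite [newton_div u b x j 0]mxE [(p x)^T 0 j]mxE [p x j 0]mxE mulr_sumr.
    apply: eq_bigr => i _; rewrite mulrC; congr (_ * _).
    have -> : (fun y => T b y i j) = (fun y => T b y j i); last by [].
    by apply/funext => y; rewrite -[in LHS](newton_tr b (schouten_tr smooth_u y)) mxE.
  apply: eq_bigr => i _; rewrite [RHS]mxE; apply: eq_bigr => j _.
  by rewrite [H x j i]mxE ddu_sym.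
rewrite mxtrace_newton_hess newton_divE // mulmxBr -!scalemxAr newton_formE gradsqE.
move: (z b x) (q x) (s b.+1 x) (s b x) => zb qq s1 s0; rewrite !mxE -!muln2 !natrM.
by rewrite /= !mulr1n; field.
Qed.

Lemma dot_gradsq_newton_grad b x :
  \sum_i partial i q x * newton_grad b i x = 2 * q x * s b.+1 x - 2 * z b.+1 x - q x * z b x.
Proof.
transitivity (2 * ((p x)^T *m (H x *m (T b x *m p x))) 0 0).
  rewrite mulmxA mxE mulr_sumr; apply: eq_bigr => i _.
  rewrite (partial_gradsq smooth_u) -mulrA; congr (_ * (_ * _)); rewrite mxE.
  apply: eq_bigr => l _; rewrite [(p x)^T 0 l]mxE [p x l 0]mxE mulrC [H x l i]mxE.
  by rewrite ddu_sym.
rewrite hessE mulmxDl mulmxBl mulmxDr mulmxBr.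
have -> : schouten u x *m (T b x *m p x) = s b.+1 x *: p x - T b.+1 x *m p x.
  exact: newtonS_mul (schouten_tr smooth_u x).
rewrite mulmxBr -scalemxAr gradsqE newton_formE -!mulmxA newton_formE mul_scalar_mx.
rewrite mul_mx_scalar -!scalemxAr gradsqE newton_formE.
move: (z b x) (z b.+1 x) (q x) (s b.+1 x) => zb z1 qq s1; rewrite !mxE /= !mulr1n.
by field.
Qed.

Definition mass_term a b i x : R := q x ^+ a * newton_grad b i x.

Lemma C1_mass_term a b i : C1 (mass_term a b i).
Proof. exact: (C1M (C1X a (C1_gradsq smooth_u)) (C1_newton_grad b i)). Qed.

Lemma div_mass_term a b x : \sum_i partial i (mass_term a b i) x =
  (b.+1%:R + 2 * a%:R) * q x ^+ a * s b.+1 x - (n%:R - b%:R) / 2 * q x ^+ a.+1 * s b x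
  + (n%:R - b.*2%:R - 1 - a%:R) * q x ^+ a * z b x - 2 * a%:R * q x ^+ a.-1 * z b.+1 x.
Proof.
transitivity (a%:R * q x ^+ a.-1 * (\sum_i partial i q x * newton_grad b i x) +
  q x ^+ a * \sum_i partial i (newton_grad b i) x).
  rewrite !mulr_sumr -big_split; apply: eq_bigr => i _ /=.
  rewrite (partialM i x (C1X a (C1_gradsq smooth_u)) (C1_newton_grad b i)).
  by rewrite (partialX a i x (C1_gradsq smooth_u)) mulrA.
rewrite dot_gradsq_newton_grad div_newton_grad.
move: (z b x) (z b.+1 x) (q x) (s b.+1 x) (s b x) => zb z1 qq s1 s0.
case: a => [|a]; rewrite ?expr0 /= ?exprS; first by field.
by move: (qq ^+ a) => qa; field.
Qed.

Variable k : nat.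

(** The weights are chosen so that the terms [q^a z_b] telescope in the divergence
    of [mass_field]; the remaining coefficients then come out nonnegative. *)
Fixpoint mass_weight (a : nat) : R :=
  if a is a'.+1 then mass_weight a' * (n%:R - k.*2%:R + a%:R) / (2 * a%:R) else 1.

(** The leading term [a = 0] carries the mass; the others decay faster and make the
    divergence a sum of nonnegative terms. *)
Definition mass_field i x : R :=
  \sum_(a < k) mass_weight a * mass_term a (k.-1 - a) i x.

Definition mass_density x : R := k%:R * s k x +
  \sum_(a < k) mass_weight a * (k%:R * (n%:R - k.*2%:R)) / (2 * a.+1%:R)
     * (q x ^+ a.+1 * s (k.-1 - a) x).

Lemma C1_mass_field i : C1 (mass_field i).
Proof. by apply: C1_sum => a; apply: (C1M (C1_cst _ _)); exact: C1_mass_term. Qed.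

Lemma div_mass_field_partial x (m : nat) : (m <= k)%N -> (0 < k)%N ->
  \sum_(a < m) mass_weight a * (\sum_i partial i (mass_term a (k.-1 - a) i) x) =
  k%:R * s k x
  - (k%:R + m%:R) * mass_weight m * q x ^+ m * s (k - m) x
  + 2 * m%:R * mass_weight m * q x ^+ m.-1 * z (k - m) x
  + \sum_(a < m) mass_weight a * (k%:R * (n%:R - k.*2%:R)) / (2 * a.+1%:R)
     * (q x ^+ a.+1 * s (k.-1 - a) x).
Proof.
elim: m => [|m IH] mk k0.
  by rewrite !big_ord0 subn0 /= expr0; ring.
rewrite [LHS]big_ord_recr [in RHS]big_ord_recr /= IH ?(ltnW mk) // div_mass_term.
have -> : (k.-1 - m).+1 = (k - m)%N by lia.
have -> : (k - m.+1)%N = (k.-1 - m)%N by lia.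
have kE : k%:R = (k.-1 - m)%:R + m%:R + 1 :> R by rewrite -!natrD natr1; congr (_%:R); lia.
have -> : (k - m)%:R = (k.-1 - m)%:R + 1 :> R by rewrite natr1; congr (_%:R); lia.
rewrite -!muln2 !natrM kE.
move: (\sum_(i < m) _) => S.
move: (s k x) (s (k - m) x) (s (k.-1 - m) x) (z (k - m) x) (z (k.-1 - m) x) (mass_weight m)
  => s1 s2 s3 z1 z2 d.
have : m.+1%:R != 0 :> R by rewrite pnatr_eq0.
rewrite -natr1; move: (k.-1 - m)%:R (n%:R : R) => bb nn.
case: m {IH mk kE} => [|m] m1; rewrite /= ?expr0 !exprS.
  by move: (q x) => qq; field; rewrite ?m1.
by move: (q x) (q x ^+ m) => qq qm; field; rewrite ?m1.
Qed.

Lemma div_mass_field x : (0 < k)%N -> \sum_i partial i (mass_field i) x = mass_density x.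
Proof.
move=> k0.
transitivity (\sum_(a < k) mass_weight a * (\sum_i partial i (mass_term a (k.-1 - a) i) x)).
  transitivity (\sum_i \sum_(a < k) mass_weight a * partial i (mass_term a (k.-1 - a) i) x).
    apply: eq_bigr => i _; rewrite partial_sum; last first.
      by move=> a; apply: (C1M (C1_cst _ _)); exact: C1_mass_term.
    by apply: eq_bigr => a _; rewrite partialZ //; exact: C1_mass_term.
  by rewrite exchange_big; apply: eq_bigr => a _ /=; rewrite mulr_sumr.
rewrite div_mass_field_partial // subnn sigma0 newton_form0 /mass_density; congr (_ + _).
have -> : q x ^+ k = q x ^+ k.-1 * q x by rewrite -exprSr prednK.
by move: (mass_weight k) (q x) (q x ^+ k.-1) => *; ring.
Qed.

Lemma mass_weight_gt0 a : (k.*2 < n)%N -> 0 < mass_weight a.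
Proof.
move=> kn; elim: a => [|a IH] //=.
have c1 : 0 < n%:R - k.*2%:R :> R by rewrite subr_gt0 ltr_nat.
have c2 : 0 < a.+1%:R :> R by rewrite ltr0n.
apply: divr_gt0; last exact: mulr_gt0.
by apply: mulr_gt0 => //; exact: addr_gt0.
Qed.

(** Each term of the density is nonnegative, and the one with [s_0 = 1] is a positive
    multiple of [|grad u|^(2k)]. *)
Lemma mass_density_ge x : (0 < k)%N -> (k.*2 < n)%N ->
  (forall j : nat, (1 <= j <= k)%N -> 0 <= s j x) ->
  mass_weight k.-1 * (k%:R * (n%:R - k.*2%:R)) / (2 * k%:R) * q x ^+ k <= mass_density x.
Proof.
move=> k0 kn s0.
have c1 : 0 < n%:R - k.*2%:R :> R by rewrite subr_gt0 ltr_nat.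
have q0 : 0 <= q x by apply: sumr_ge0 => i _; exact: sqr_ge0.
have sk : 0 <= k%:R * s k x by apply: mulr_ge0 => //; apply: s0; rewrite k0 leqnn.
apply: (le_trans _ (ler_wpDl sk (lexx _))).
have kk : (k.-1 < k)%N by rewrite prednK.
rewrite (bigD1 (Ordinal kk)) //= prednK // subnn sigma0 mulr1.
rewrite lerDl; apply: sumr_ge0 => a ak.
have am : (a < k.-1)%N.
  have := ltn_ord a; rewrite -[X in (_ < X)%N -> _](prednK k0) ltnS leq_eqVlt.
  by case/orP => // /eqP E; move: ak; rewrite -val_eqE /= E eqxx.
apply: mulr_ge0.
  apply: divr_ge0; last exact: mulr_ge0.
  apply: mulr_ge0; first exact/ltW/mass_weight_gt0.
  by apply: mulr_ge0 => //; exact: ltW.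
by apply: mulr_ge0; [exact: exprn_ge0|apply: s0; lia].
Qed.

End mass_field.

(** * Gauss-Bonnet curvatures of a conformally flat metric *)

Section conformal_curvature.
Context (R : realType) (n : nat) (u : 'rV[R]_n -> R).
Hypothesis smooth_u : smooth u.
Implicit Types (x : 'rV[R]_n) (i j k l m : 'I_n).

Local Notation g := (cf_metric u).
Local Notation du i x := (partial i u x).
Local Notation e2 x := (expR (2 * u x)).

Lemma metric_invE x i j : metric_inv g x i j = e2 x * (i == j)%:R.
Proof.
rewrite /metric_inv /cf_metric invmx_scalar mxE -expRN mulNr opprK.
by rewrite mulr_natr.
Qed.

Lemma metric_partialE m i j x :
  metric_partial g m i j x = - 2 * du m x * expR (- 2 * u x) * (i == j)%:R.
Proof.
rewrite /metric_partial.
have -> : (fun y => g y i j) = (fun y => (i == j)%:R * expR (- 2 * u y)).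
  by apply/funext => y; rewrite /cf_metric mxE [RHS]mulr_natl.
have cu := C1Z (- 2) (C1_u smooth_u).
by rewrite (partialZ _ m x (C1_exp cu)) (partial_exp m x cu) (partialZ _ m x (C1_u smooth_u)) mulrC.
Qed.

Lemma christoffelE k i j x : christoffel g k i j x =
  du k x * (i == j)%:R - du i x * (j == k)%:R - du j x * (i == k)%:R.
Proof.
rewrite /christoffel.
under eq_bigr => l _ do rewrite metric_invE mulrAC.
rewrite (sum_mul_delta (fun l => e2 x * (metric_partial g i j l x +
  metric_partial g j i l x - metric_partial g l i j x))) !metric_partialE.
have E : e2 x * expR (- 2 * u x) = 1 by rewrite -expRD mulNr subrr expR0.
move: (expR (- 2 * u x)) (e2 x) E => a b E.
move: (du k x) (du i x) (du j x) (i == j)%:R (j == k)%:R (i == k)%:R => c1 c2 c3 d1 d2 d3.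
transitivity ((b * a) * (c1 * d1 - c2 * d2 - c3 * d3)); first by field.
by rewrite E mul1r.
Qed.

Lemma partial_christoffel m k i j x : partial m (christoffel g k i j) x =
  partial m (partial k u) x * (i == j)%:R - partial m (partial i u) x * (j == k)%:R
  - partial m (partial j u) x * (i == k)%:R.
Proof.
have -> : christoffel g k i j = (fun y =>
    du k y * (i == j)%:R - du i y * (j == k)%:R - du j y * (i == k)%:R).
  by apply/funext => y; exact: christoffelE.
have cD a (c : R) := C1M (C1_du smooth_u a) (C1_cst _ c).
rewrite (partialB m x (C1B (cD _ _) (cD _ _)) (cD _ _)) (partialB m x (cD _ _) (cD _ _)).
by rewrite !(partialZr _ m x (C1_du smooth_u _)).
Qed.

Lemma sum_delta_product (v : 'I_n -> R) (A B D E F : R) i j k l :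
  \sum_m (v k * (i == m)%:R - A * (m == k)%:R - v m * B) *
         (v m * F - D * (l == m)%:R - E * (j == m)%:R) =
  v k * (v i * F - D * (l == i)%:R - E * (j == i)%:R)
  - A * (v k * F - D * (l == k)%:R - E * (j == k)%:R)
  - B * (F * \sum_m v m ^+ 2 - D * v l - E * v j).
Proof.
pose X m := v m * F - D * (l == m)%:R - E * (j == m)%:R.
transitivity (\sum_m ((v k * X m) * (i == m)%:R - (A * X m) * (k == m)%:R
   - (B * F * v m ^+ 2 - B * D * v m * (l == m)%:R - B * E * v m * (j == m)%:R))).
  by apply: eq_bigr => m _; rewrite /X (eq_sym m k); ring.
rewrite !sumrB !sum_mul_delta -mulr_sumr /X.
by move: (\sum_m v m ^+ 2) => S; ring.
Qed.

Lemma christoffel_product i j k l x :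
  \sum_m christoffel g k i m x * christoffel g m j l x =
  du k x * (du i x * (j == l)%:R - du j x * (l == i)%:R - du l x * (j == i)%:R)
  - du i x * (du k x * (j == l)%:R - du j x * (l == k)%:R - du l x * (j == k)%:R)
  - (i == k)%:R * ((j == l)%:R * \sum_m du m x ^+ 2 - du j x * du l x - du l x * du j x).
Proof.
rewrite -(sum_delta_product (fun m => du m x)).
by apply: eq_bigr => m _; rewrite !christoffelE.
Qed.

(** The Weyl tensor of a conformally flat metric vanishes, so only the Schouten part of
    the curvature is left. *)
Lemma riemann_upE i j k l x :
  riemann_up g i j k l x = knprod (e2 x) (schouten u x) i j k l.
Proof.
rewrite /riemann_up.
under eq_bigr => m _ do rewrite metric_invE mulrA eq_sym.
rewrite (sum_mul_delta (fun m => riemann g k m i j x * e2 x)) mulrC /knprod.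
congr (_ * _); rewrite /riemann !partial_christoffel sumrB.
rewrite !christoffel_product.
rewrite !schoutenE /gradsq.
rewrite (ddu_sym smooth_u j i x) (eq_sym l k) (eq_sym l i) (eq_sym l j) (eq_sym j i).
move: (\sum_m du m x ^+ 2) (partial i (partial j u) x) (partial i (partial k u) x)
  (partial i (partial l u) x) (partial j (partial k u) x) (partial j (partial l u) x)
  (du i x) (du j x) (du k x) (du l x) (i == j)%:R (i == k)%:R (i == l)%:R (j == k)%:R
  (j == l)%:R (k == l)%:R => S h1 h2 h3 h4 h5 c1 c2 c3 c4 d1 d2 d3 d4 d5 d6.
by field.
Qed.

End conformal_curvature.

Section conformal_gauss_bonnet.
Context (R : realType) (n : nat) (u : 'rV[R]_n -> R).
Hypothesis smooth_u : smooth u.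
Implicit Types (x : 'rV[R]_n) (k : nat).

Local Notation g := (cf_metric u).
Local Notation e2 x := (expR (2 * u x)).

Lemma riemann_prodE k (I J : k.*2.-tuple 'I_n) x :
  riemann_prod g I J x = quad_prod (knprod (e2 x) (schouten u x)) I J.
Proof. by apply: eq_bigr => a _; rewrite riemann_upE. Qed.

Definition gb_const k : R := 2 ^- k * knprod_const R n k 0 * k`!%:R.

Lemma gauss_bonnet_curvE k x :
  gauss_bonnet_curv g k x = gb_const k * e2 x ^+ k * sigma (schouten u x) k.
Proof.
rewrite /gauss_bonnet_curv /gb_const.
transitivity (2 ^- k * quad_contraction (knprod (e2 x) (schouten u x)) k [::] [::]).
  congr (_ * _); rewrite -sum_quad_prod; apply: eq_bigr => I _; apply: eq_bigr => J _.
  by rewrite !cats0 gen_kroneckerE riemann_prodE.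
rewrite quad_contraction_knprod //= /sigma.
have := @fact_neq0 R k; move: (k`!%:R) (2 ^- k) => f c f0; field; exact: f0.
Qed.

Lemma gb_const_gt0 k : (k.*2 <= n)%N -> 0 < gb_const k.
Proof.
move=> kn; rewrite /gb_const !mulr_gt0 ?invr_gt0 ?exprn_gt0 ?ltr0n ?fact_gt0 //.
by apply: knprod_const_gt0; rewrite addn0.
Qed.

Lemma gb_tensorE k s t l m x : gb_tensor g k.+1 s t l m x =
  2 ^- k.+1 * e2 x ^+ k.+2 * knprod_const R n k 2 * psi (schouten u x) k [:: s; t] [:: l; m].
Proof.
rewrite /gb_tensor /=.
transitivity (2 ^- k.+1 * (e2 x ^+ 2 *
   quad_contraction (knprod (e2 x) (schouten u x)) k [:: s; t] [:: l; m])).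
  congr (_ * _); rewrite -sum_quad_prod mulr_sumr.
  apply: eq_bigr => I _; rewrite mulr_sumr; apply: eq_bigr => J _.
  transitivity (\sum_p \sum_q ((e2 x * e2 x * quad_prod (knprod (e2 x) (schouten u x)) I J *
     kron R (I ++ [:: s; t]) (J ++ [:: p; q])) * (m == q)%:R) * (l == p)%:R).
    apply: eq_bigr => p _; apply: eq_bigr => q _.
    rewrite gen_kroneckerE riemann_prodE !metric_invE /= -!cats1 -!catA /=.
    by rewrite (eq_sym p) (eq_sym q); ring.
  under eq_bigr => p _ do rewrite -mulr_suml sum_mul_delta.
  rewrite (sum_mul_delta (fun p => e2 x * e2 x * quad_prod (knprod (e2 x) (schouten u x)) I J *
     kron R (I ++ [:: s; t]) (J ++ [:: p; m]))).
  by rewrite expr2 mulrAC mulrA.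
rewrite quad_contraction_knprod //; move: (2 ^- k.+1) (e2 x) => c a.
by rewrite !exprS expr0 /=; move: (a ^+ k) => ak; ring.
Qed.

Definition flux_const k : R :=
  2 ^- k * 2 * knprod_const R n k.-1 2 * (n%:R - k%:R) * (k.-1)`!%:R.

Lemma flux_const_gt0 k : (0 < k)%N -> (k.*2 <= n)%N -> 0 < flux_const k.
Proof.
case: k => // k _ kn; rewrite /flux_const.
have nk : 0 < n%:R - k.+1%:R :> R by rewrite subr_gt0 ltr_nat; lia.
rewrite !mulr_gt0 ?invr_gt0 ?exprn_gt0 ?ltr0n ?fact_gt0 //=.
by apply: knprod_const_gt0; rewrite doubleS in kn; lia.
Qed.

(** The metric and its derivatives are multiples of [delta], so the sum over [j] and [l]
    traces [P_(k)] and leaves a Newton tensor. *)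
Lemma flux_integrandE k x : (0 < k)%N ->
  \sum_i \sum_j \sum_l \sum_m
    gb_tensor g k i j l m x * metric_partial g m j l x * (x 0 i / enorm x) =
  flux_const k * e2 x ^+ k * \sum_i newton_grad u k.-1 i x * (x 0 i / enorm x).
Proof.
case: k => // k _; rewrite mulr_sumr; apply: eq_bigr => i _.
rewrite -[k.+1.-1]/k.
pose c := 2 ^- k.+1 * e2 x ^+ k.+1 * knprod_const R n k 2 * 2.
transitivity (\sum_j \sum_m c * (psi (schouten u x) k [:: j; i] [:: j; m]
   * partial m u x * (x 0 i / enorm x))).
  apply: eq_bigr => j _; rewrite exchange_big /=; apply: eq_bigr => m _.
  pose F l := 2 ^- k.+1 * e2 x ^+ k.+2 * knprod_const R n k 2 *
    psi (schouten u x) k [:: i; j] [:: l; m] * (-2 * partial m u x * expR (- 2 * u x))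
    * (x 0 i / enorm x).
  transitivity (\sum_l F l * (j == l)%:R).
    apply: eq_bigr => l _; rewrite /F metric_partialE // gb_tensorE.
    move: (x 0 i / enorm x) (psi _ _ _ _) (2 ^- k.+1) (knprod_const _ _ _ _) (j == l)%:R
      (partial m u x) (expR (- 2 * u x)) (e2 x ^+ k.+2) => *; ring.
  rewrite sum_mul_delta /F.
  have /= -> := @psi_swapr R n (schouten u x) k [:: i; j] [::] j m [::] erefl.
  rewrite psi_swap2 // /c [e2 x ^+ k.+2]exprSr.
  have E : e2 x * expR (- 2 * u x) = 1 by rewrite -expRD mulNr subrr expR0.
  move: (e2 x) (expR (- 2 * u x)) E => a b E.
  move: (a ^+ k.+1) (2 ^- k.+1) (psi _ _ _ _) (partial m u x) (x 0 i / enorm x) (knprod_const _ _ _ _)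
    => c1 c2 c3 c4 c5 c6.
  transitivity ((a * b) * (c2 * c1 * c6 * 2 * (c3 * c4 * c5))); first by ring.
  by rewrite E mul1r.
rewrite exchange_big /=.
transitivity (\sum_m c * ((n%:R - (k + 1)%:R) * psi (schouten u x) k [:: i] [:: m]
   * partial m u x * (x 0 i / enorm x))).
  apply: eq_bigr => m _; rewrite -mulr_sumr -!mulr_suml.
  by rewrite -(psi_trace (schouten u x) k (S := [:: i]) (T := [:: m])).
rewrite newton_gradE [in RHS]mulr_suml [RHS]mulr_sumr; apply: eq_bigr => m _.
rewrite [newton _ _ _ _]mxE /flux_const /c addn1.
have := @fact_neq0 R k; move: (x 0 i / enorm x) (2 ^- k.+1) (e2 x ^+ k.+1) => c1 c2 c3 f0.
by field; exact: f0.
Qed.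

End conformal_gauss_bonnet.

(** * Fubini and dilations for Lebesgue measure *)

Section measurability.
Context (R : realType) (n : nat).

Definition grid_point (m : nat) (z : {ffun 'I_n -> int}) : 'rV[R]_n :=
  \row_i ((z i)%:~R / m.+1%:R).

Definition grid_index (m : nat) (x : 'rV[R]_n) : {ffun 'I_n -> int} :=
  [ffun i => Num.floor (x 0 i * m.+1%:R)].

Lemma measurable_grid_index m (P : set {ffun 'I_n -> int}) :
  measurable (grid_index m @^-1` P).
Proof.
have -> : grid_index m @^-1` P = \bigcup_z (if z \in P then grid_index m @^-1` [set z] else set0).
  apply/seteqP; split => [x Px|x [z _]] /=.
    by exists (grid_index m x) => //=; rewrite mem_set.
  by case: ifPn => // /set_mem Pz /= ->.
apply: countable_bigcupT_measurable; first exact: countableP.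
move=> z; case: ifP => // _.
have -> : grid_index m @^-1` [set z] = \big[setI/setT]_(i < n)
    (rV_coord i @^-1` `[(z i)%:~R / m.+1%:R, (z i + 1)%:~R / m.+1%:R[%classic).
  apply/seteqP; split => x /=.
    move=> <-; rewrite -bigcap_seq => i _ /=; rewrite in_itv /= ffunE.
    by rewrite ler_pdivrMr ?ltr0n // ltr_pdivlMr ?ltr0n // floor_itv.
  rewrite -bigcap_seq => H; apply/ffunP => i; rewrite ffunE.
  have := H i; rewrite /= mem_index_enum in_itv /= => /(_ isT).
  rewrite ler_pdivrMr ?ltr0n // ltr_pdivlMr ?ltr0n // => zi.
  by apply/floor_def.
apply: bigsetI_measurable => i _.
by rewrite -[X in measurable X]setTI; apply: (@measurable_rV_coord R n i) => //; exact: measurable_itv.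
Qed.

Lemma grid_approx m (x : 'rV[R]_n) i :
  `|x 0 i - grid_point m (grid_index m x) 0 i| <= m.+1%:R^-1.
Proof.
rewrite mxE ffunE.
have m0 : 0 < m.+1%:R :> R by rewrite ltr0n.
have /andP[l u] := floor_itv (x 0 i * m.+1%:R).
rewrite ger0_norm; last by rewrite subr_ge0 ler_pdivrMr.
rewrite lerBlDr -[X in X + _]mul1r -mulrDl ler_pdivlMr //.
by move: u; rewrite intrD addrC => /ltW.
Qed.

(** A continuous function is the pointwise limit of its values at grid points. *)
Lemma continuous_measurable_rV (f : 'rV[R]_n -> R) : continuous f ->
  measurable_fun setT (f : 'rV[R]_n -> measurableTypeR R).
Proof.
move=> cf.
apply: (@measurable_fun_cvg _ _ _ setT
  (fun m x => f (grid_point m (grid_index m x)) : R)).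
- move=> m _ Y mY; rewrite setTI.
  exact: (measurable_grid_index m [set z | Y (f (grid_point m z))]).
- move=> x _.
  apply: (@cvg_comp _ _ _ (fun m => grid_point m (grid_index m x)) f _ (nbhs x)); last exact: cf.
  apply/cvg_ballP => eps eps0; near=> m; split=> // a i; rewrite [a]ord1 /ball /=.
  apply: (le_lt_trans (grid_approx m x i)).
  by near: m; exact: near_infty_natSinv_lt (PosNum eps0).
Unshelve. all: by end_near. Qed.

End measurability.

Section fubini_rV.
Context (R : realType).
Local Open Scope ereal_scope.
Local Notation lam := (lebesgue_rV R).
Local Notation leb := (@lebesgue_measure R).

Lemma measurable_cons_pair n (f : 'rV[R]_n.+1 -> \bar R) : measurable_fun setT f ->
  measurable_fun setT (fun p : measurableTypeR R * 'rV[R]_n => f (cons_rV p)).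
Proof. by move=> mf; apply: measurableT_comp mf _; exact: measurable_cons_rV. Qed.

Lemma ge0_integral_cons n (f : 'rV[R]_n.+1 -> \bar R) :
  measurable_fun setT f -> (forall x, 0 <= f x) ->
  \int[lam n.+1]_x f x = \int[leb]_a \int[lam n]_v f (cons_rV (a, v)).
Proof.
move=> mf f0.
have := @ge0_integral_pushforward _ _ _ _ R _ (measurable_cons_rV (n := n))
  (leb \x lam n) setT f measurableT mf (fun y _ => f0 y).
rewrite preimage_setT => E; rewrite [LHS]E.
apply: (fubini_tonelli1 (f \o @cons_rV R n)); first exact: measurable_cons_pair.
by move=> x; exact: f0.
Qed.

Lemma measurable_cons_left n (f : 'rV[R]_n.+1 -> \bar R) a : measurable_fun setT f ->
  measurable_fun setT (fun v => f (cons_rV (a, v))).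
Proof.
move=> mf; have := measurable_cons_pair mf => mg.
exact: (measurableT_comp mg (measurable_pair1 a)).
Qed.

Definition scale1 (t : R) (x : measurableTypeR R) : measurableTypeR R := (t * x)%R.

Lemma measurable_scale1 t : measurable_fun setT (scale1 t).
Proof. exact: mulrl_measurable. Qed.

(** Uniqueness of Lebesgue measure reduces this to intervals. *)
Lemma lebesgue_measure_scale (t : R) (A : set R) : (0 < t)%R -> measurable A ->
  pushforward leb (scale1 t) A = (t^-1)%:E * leb A.
Proof.
move=> t0 mA.
have mt := measurable_scale1 t.
pose pf := measure_function_pushforward__canonical__measure_function_Measure leb mt.
pose nu : {measure set (measurableTypeR R) -> \bar R} := mscale (NngNum (ltW t0)) pf.
have E : leb A = nu A.
  apply: lebesgue_measure_unique => // _ [[a b]] _ <- /=.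
  have pre : scale1 t @^-1` `]a, b] = `](t^-1 * a)%R, (t^-1 * b)%R]%classic.
    by apply/seteqP; split => x /=; rewrite /scale1 !in_itv /= ltr_pdivrMl // ler_pdivlMl.
  transitivity (t%:E * leb `](t^-1 * a)%R, (t^-1 * b)%R]%classic); last first.
    by rewrite /nu /mscale /= /pushforward pre.
  rewrite !lebesgue_measure_itv /= !lte_fin ltr_pM2l ?invr_gt0 //.
  case: ifP => _; last by rewrite mule0.
  by rewrite -!EFinB -EFinM -mulrBr mulrA divff ?gt_eqF // mul1r.
rewrite E /nu /= /mscale /= muleA -EFinM mulVf ?gt_eqF // mul1e //.
Qed.

Lemma ge0_integral_scale1 (t : R) (f : measurableTypeR R -> \bar R) : (0 < t)%R ->
  measurable_fun setT f -> (forall x, 0 <= f x) ->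
  \int[leb]_x f (t * x)%R = (t^-1)%:E * \int[leb]_x f x.
Proof.
move=> t0 mf f0.
have mt := measurable_scale1 t.
have := @ge0_integral_pushforward _ _ _ _ R _ mt leb setT f measurableT mf (fun y _ => f0 y).
rewrite preimage_setT => <-.
have ti : (0 <= t^-1)%R by rewrite invr_ge0 ltW.
rewrite -(ge0_integral_mscale leb measurableT (NngNum ti)) //.
apply: eq_measure_integral => A mA _ /=.
exact: lebesgue_measure_scale.
Qed.

Lemma scale_cons n (t a : R) (v : 'rV[R]_n) :
  (t *: cons_rV (a, v))%R = cons_rV (t * a, t *: v)%R.
Proof. by apply/rowP => i; rewrite !mxE; case: unliftP => [j|] _ //=; rewrite mxE. Qed.

Lemma ge0_integral_scale n (t : R) (f : 'rV[R]_n -> \bar R) : (0 < t)%R ->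
  measurable_fun setT f -> (forall x, 0 <= f x) ->
  \int[lam n]_x f (t *: x)%R = (t ^- n)%:E * \int[lam n]_x f x.
Proof.
move=> t0; elim: n f => [|n IH] f mf f0.
  rewrite expr0 invr1 mul1e; apply: eq_integral => x _; congr f.
  by apply/rowP => -[].
have mscale : measurable_fun setT (fun x : 'rV[R]_n.+1 => (t *: x)%R).
  apply: measurable_fun_rV => i.
  rewrite [X in measurable_fun _ X](_ : _ = (fun x => t * rV_coord i x)%R).
    exact: measurable_funM (measurable_cst _) (measurable_rV_coord i).
  by apply/funext => x; rewrite /rV_coord /= mxE.
rewrite ge0_integral_cons //; last exact: (measurableT_comp mf mscale).
pose h (a : measurableTypeR R) := \int[lam n]_v f (cons_rV (a, v)).
have mh : measurable_fun setT h.
  apply: (measurable_fun_fubini_tonelli_F (fun p => f (cons_rV p))) => //.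
  exact: measurable_cons_pair.
have h0 a : 0 <= h a by apply: integral_ge0.
transitivity (\int[leb]_a ((t ^- n)%:E * h (t * a)%R)).
  apply: eq_integral => a _.
  under eq_integral => v _ do rewrite scale_cons.
  rewrite (IH (fun v => f (cons_rV (t * a, v)%R))) //.
  exact: measurable_cons_left.
have tn : (0 <= t ^- n)%R by rewrite invr_ge0 exprn_ge0 // ltW.
rewrite ge0_integralZl_EFin //; last first.
  by apply: (measurableT_comp mh); exact: mulrl_measurable.
rewrite ge0_integral_scale1 // muleA -EFinM -invfM -exprSr.
by rewrite ge0_integral_cons.
Qed.

End fubini_rV.

(** * Cubes and integration along lines *)

Section boxes.
Context (R : realType).
Local Notation lam := (lebesgue_rV R).
Local Notation leb := (@lebesgue_measure R).

Definition box n (c : 'rV[R]_n) (r : R) : set 'rV[R]_n :=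
  [set x | forall i, `|x 0 i - c 0 i| <= r].

Lemma measurable_box n (c : 'rV[R]_n) r : measurable (box c r).
Proof.
have -> : box c r = \big[setI/setT]_(i < n)
    (rV_coord i @^-1` `[c 0 i - r, c 0 i + r]%classic).
  rewrite -bigcap_seq; apply/seteqP; split => x /= H i.
    by move=> _ /=; rewrite in_itv /= -ler_distl; exact: H.
  by have := H i; rewrite /= mem_index_enum in_itv /= -ler_distl; exact.
apply: bigsetI_measurable => i _.
by rewrite -[X in measurable X]setTI; apply: (@measurable_rV_coord R n i) => //; exact: measurable_itv.
Qed.

Lemma box_cons n (c : 'rV[R]_n.+1) r (a : R) (v : 'rV[R]_n) :
  box c r (cons_rV (a, v)) <->
  a \in `[c 0 ord0 - r, c 0 ord0 + r] /\ box (\row_j c 0 (lift ord0 j)) r v.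
Proof.
rewrite in_itv /= -ler_distl; split => [H|[H0 H1] i].
  split; first by have := H ord0; rewrite mxE unlift_none.
  by move=> j; have := H (lift ord0 j); rewrite !mxE liftK.
rewrite mxE; case: unliftP => [j|] -> //=.
by have := H1 j; rewrite mxE.
Qed.

Lemma lebesgue_box n (c : 'rV[R]_n) (r : R) : 0 <= r ->
  lam n (box c r) = ((2 * r) ^+ n)%:E.
Proof.
move=> r0; elim: n c => [|n IH] c.
  rewrite expr0 /= diracE mem_set //.
  by move=> -[].
have E : @cons_rV R n @^-1` box c r =
    `[c 0 ord0 - r, c 0 ord0 + r]%classic `*` box (\row_j c 0 (lift ord0 j)) r.
  by apply/seteqP; split => -[a v] /= /box_cons.
have len : leb `[c 0 ord0 - r, c 0 ord0 + r]%classic = (2 * r)%:E.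
  rewrite lebesgue_measure_itv /= lte_fin; case: ifPn => [_|].
    by rewrite -EFinB; congr (_%:E); ring.
  by rewrite -leNgt => h; rewrite (_ : r = 0) ?mulr0 //; lra.
rewrite /= /lebesgue_rV_succ /pushforward E product_measure1E; last 2 first.
- exact: measurable_itv.
- exact: measurable_box.
transitivity ((2 * r)%:E * ((2 * r) ^+ n)%:E)%E; last by rewrite -EFinM -exprS.
by congr (_ * _)%E; [exact: len|exact: IH].
Qed.

Lemma bounded_support_integrable n (A : set 'rV[R]_n) (f : 'rV[R]_n -> R) (M : R) :
  measurable A -> (lam n A < +oo)%E ->
  measurable_fun A (f : _ -> measurableTypeR R) -> (forall x, A x -> `|f x| <= M) ->
  (lam n).-integrable A (EFin \o f).
Proof.
move=> mA fA mf fM; apply: measurable_bounded_integrable => //.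
exists M; split; first exact: num_real.
by move=> K MK x Ax; apply: (le_trans (fM x Ax)); exact: ltW.
Qed.

End boxes.

Section lines.
Context (R : realType).
Local Notation lam := (lebesgue_rV R).
Local Notation leb := (@lebesgue_measure R).

Lemma cons_rV_line0 n (a : R) (v : 'rV[R]_n) :
  cons_rV (a, v) = a *: delta_mx 0 ord0 + cons_rV (0, v).
Proof.
apply/rowP => i; rewrite !mxE eqxx /=; case: unliftP => [j|] -> /=.
  by rewrite mulr0 add0r.
by rewrite mulr1 addr0.
Qed.

Lemma cons_rV_line n (a t : R) (v : 'rV[R]_n) j :
  cons_rV (a, t *: delta_mx 0 j + v) = t *: delta_mx 0 (lift ord0 j) + cons_rV (a, v).
Proof.
apply/rowP => i; rewrite !mxE eqxx /=; case: unliftP => [l|] -> /=.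
  by rewrite !mxE eqxx (inj_eq (@lift_inj _ ord0)).
by rewrite mulr0 add0r.
Qed.

Lemma integral_cons_integrable n (f : 'rV[R]_n.+1 -> \bar R) :
  measurable_fun setT f -> (lam n.+1).-integrable setT f ->
  (leb \x lam n)%E.-integrable setT (f \o @cons_rV R n) /\
  (\int[lam n.+1]_x f x = \int[leb \x lam n]_p f (cons_rV p))%E.
Proof.
move=> mf /integrableP[_ intf].
have int2 : (leb \x lam n)%E.-integrable setT (f \o @cons_rV R n).
  apply/integrableP; split; first exact: measurable_cons_pair.
  apply: le_lt_trans intf.
  have mabs : measurable_fun setT (abse \o f) by exact: measurableT_comp.
  have := @ge0_integral_pushforward _ _ _ _ R _ (measurable_cons_rV (n := n))
    (leb \x lam n)%E setT (abse \o f) measurableT mabs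
    (fun y _ => abse_ge0 _).
  by rewrite preimage_setT => <-.
split => //.
have := @integral_pushforward _ _ _ _ R _ (measurable_cons_rV (n := n))
    (leb \x lam n)%E setT f mf.
by rewrite preimage_setT => ->.
Qed.

(** Fubini, integrating first in the direction [i]; boundedness and the support condition
    make [f] integrable. *)
Lemma integral_lines_eq0 n (i : 'I_n) (f : 'rV[R]_n -> R) (M r : R) : 0 <= r ->
  measurable_fun setT (f : _ -> measurableTypeR R) -> (forall x, `|f x| <= M) ->
  (forall x, ~ box 0 r x -> f x = 0) ->
  (forall x, \int[leb]_t (f (t *: delta_mx 0 i + x))%:E = 0)%E ->
  (\int[lam n]_x (f x)%:E = 0)%E.
Proof.
move=> r0; elim: n i f => [|n IH] i f mf fM f0 fl; first by case: i fl.
have mfE : measurable_fun setT (fun x => (f x)%:E) by exact/measurable_EFinP.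
have intf : (lam n.+1).-integrable setT (EFin \o f).
  have -> : EFin \o f = (EFin \o f) \_ (box 0 r).
    apply/funext => x; rewrite patchE; case: ifPn => // /negP xb /=.
    by rewrite f0 // => bx; apply: xb; rewrite inE.
  apply/(integrable_mkcond _ (measurable_box 0 r)).
  apply: (@bounded_support_integrable _ _ _ _ M) => //.
  - exact: measurable_box.
  - by rewrite lebesgue_box // ltry.
  - exact: measurable_funTS.
have [int2 ->] := integral_cons_integrable mfE intf.
case: (unliftP ord0 i) => [j|] iE.
  rewrite -(integral12_prod_meas1 int2) /fubini_F.
  apply: integral0_eq => a _ /=.
  apply: (IH j (fun v => f (cons_rV (a, v)))) => //.
  - by have /measurable_EFinP := measurable_cons_left a mfE.
  - move=> v nb; apply: f0 => /box_cons [_ bv]; apply: nb.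
    by move=> l; have := bv l; rewrite !mxE.
  - by move=> v; under eq_integral => t _ do rewrite cons_rV_line; rewrite -iE.
rewrite -(integral21_prod_meas1 int2) /fubini_G.
apply: integral0_eq => v _ /=.
by under eq_integral => t _ do rewrite cons_rV_line0; rewrite -iE.
Qed.

End lines.

(** * A weighted divergence theorem on balls *)

Section root_sum_squares.
Context (R : realType).

Lemma norm_le_sqrt_sum n (F : 'I_n -> R) i : `|F i| <= Num.sqrt (\sum_i F i ^+ 2).
Proof.
rewrite -sqrtr_sqr ler_wsqrtr // (bigD1 i) //= lerDl.
by apply: sumr_ge0 => j _; exact: sqr_ge0.
Qed.

Lemma norm_le_sqrt_sum2 n (F : 'I_n -> 'I_n -> R) i j :
  `|F i j| <= Num.sqrt (\sum_i \sum_j F i j ^+ 2).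
Proof.
apply: (le_trans (norm_le_sqrt_sum (F i) j)); rewrite ler_wsqrtr //.
rewrite [leRHS](bigD1 i) //= lerDl.
by apply: sumr_ge0 => l _; apply: sumr_ge0 => m _; exact: sqr_ge0.
Qed.

End root_sum_squares.

Section balls.
Context (R : realType) (n : nat).
Implicit Types (x : 'rV[R]_n) (f g : 'rV[R]_n -> R) (r : R).
Local Notation lam := (lebesgue_rV R n).
Local Notation leb := (@lebesgue_measure R).

Definition normsq x : R := \sum_i x 0 i ^+ 2.

Lemma normsq_ge0 x : 0 <= normsq x.
Proof. by apply: sumr_ge0 => i _; exact: sqr_ge0. Qed.

Lemma enorm_ge0 x : 0 <= enorm x. Proof. exact: sqrtr_ge0. Qed.

Lemma enorm_sqr x : enorm x ^+ 2 = normsq x.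
Proof. by rewrite sqr_sqrtr // normsq_ge0. Qed.

Lemma coord_le_enorm x i : `|x 0 i| <= enorm x.
Proof.
exact: (norm_le_sqrt_sum (fun i => x 0 i) i).
Qed.

Lemma enormZ (t : R) x : enorm (t *: x) = `|t| * enorm x.
Proof.
rewrite /enorm -sqrtr_sqr -sqrtrM ?sqr_ge0 // mulr_sumr.
by congr (Num.sqrt _); apply: eq_bigr => i _; rewrite mxE exprMn.
Qed.

Lemma C1_normsq : C1 normsq.
Proof. by apply: C1_sum => i; exact: (C1X 2 (C1_coord R i)). Qed.

Lemma partial_normsq i x : partial i normsq x = 2 * x 0 i.
Proof.
rewrite partial_sum; last by move=> j; exact: (C1X 2 (C1_coord R j)).
transitivity (\sum_j (2 * x 0 j) * (i == j)%:R); last exact: sum_mul_delta.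
by apply: eq_bigr => j _; rewrite (partialX 2 i x (C1_coord R j)) partial_coord expr1 eq_sym.
Qed.

Lemma normsq_line t x i :
  normsq (t *: delta_mx 0 i + x) = (t + x 0 i) ^+ 2 + (normsq x - x 0 i ^+ 2).
Proof.
transitivity (\sum_j (x 0 j ^+ 2 + (2 * t * x 0 j + t ^+ 2) * (i == j)%:R)).
  apply: eq_bigr => j _; rewrite !mxE eqxx /= (eq_sym j i).
  by case: (i == j) => /=; ring.
by rewrite big_split /= sum_mul_delta -/(normsq x); ring.
Qed.

Definition eball r : set 'rV[R]_n := [set x | enorm x <= r].

Lemma eballE r x : 0 <= r -> eball r x <-> normsq x <= r ^+ 2.
Proof. by move=> r0; rewrite /eball /= -enorm_sqr ler_pXn2r // nnegrE // enorm_ge0. Qed.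

Lemma measurable_eball r : measurable (eball r).
Proof.
rewrite [X in measurable X](_ : _ = setT `&` @enorm R n @^-1` `]-oo, r]).
  by apply: measurable_enorm => //; exact: measurable_itv.
by rewrite setTI; apply/seteqP; split => x /=; rewrite in_itv.
Qed.

Lemma eball_sub_box r : eball r `<=` box 0 r.
Proof. by move=> x xr i; rewrite mxE subr0 (le_trans (coord_le_enorm _ _)). Qed.

Lemma eball_finite r : (lam (eball r) < +oo)%E.
Proof.
have [r0|r0] := leP 0 r; last first.
  rewrite (_ : eball r = set0) ?measure0 ?ltry //; apply/seteqP; split => x //=.
  by rewrite /eball /= leNgt (lt_le_trans r0 (enorm_ge0 x)).
apply: (@le_lt_trans _ _ (lam (box 0 r))); last by rewrite lebesgue_box // ltry.
apply: le_measure; rewrite ?inE.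
- exact: measurable_eball.
- exact: measurable_box.
- exact: eball_sub_box.
Qed.

Lemma continuous_bounded_box f r : 0 <= r -> continuous f ->
  exists2 M, 0 <= M & forall x, box 0 r x -> `|f x| <= M.
Proof.
move=> r0 cf.
pose K : set 'rV[R]_n := [set v | forall i, `[- r, r]%classic (v ord0 i)].
have cK : compact K.
  by apply: (@rV_compact _ _ (fun=> `[- r, r]%classic)) => _; exact: segment_compact.
have K0 : K !=set0 by exists 0 => i; rewrite /= mxE in_itv /= oppr_le0 r0.
have cf' : {within K, continuous (fun x => `|f x|)}.
  apply: continuous_subspaceT => x; apply: (@continuous_comp _ _ _ f (@Num.norm _ R)); first exact: cf.
  exact: norm_continuous.
have [c cc fc] := EVT_max_rV K0 cK cf'.
exists `|f c|; first exact: normr_ge0.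
move=> x bx; apply: fc; rewrite inE => i /=; rewrite in_itv /= -ler_norml.
by have := bx i; rewrite mxE subr0.
Qed.

Lemma continuous_integrable_eball f r : continuous f -> lam.-integrable (eball r) (EFin \o f).
Proof.
move=> cf; have [M _ fM] := continuous_bounded_box (normr_ge0 r) cf.
apply: (@bounded_support_integrable _ _ _ _ M).
- exact: measurable_eball.
- exact: eball_finite.
- by apply: measurable_funTS; exact: continuous_measurable_rV.
- by move=> x xr; apply/fM/eball_sub_box; exact: (le_trans xr (ler_norm r)).
Qed.

(** The fundamental theorem of calculus on the chord cut out by the ball: [F] vanishes at its
    endpoints. *)
Lemma integral_line_eball F i r x : 0 <= r -> C1 F -> (forall y, normsq y = r ^+ 2 -> F y = 0) ->
  (\int[leb]_t ((partial i F \_ (eball r)) (t *: delta_mx 0 i + x))%:E = 0)%E.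
Proof.
move=> r0 cF F0.
pose s := normsq x - x 0 i ^+ 2.
have lineE t : normsq (t *: delta_mx 0 i + x) = (t + x 0 i) ^+ 2 + s by exact: normsq_line.
have [rs|sr] := ltP (r ^+ 2) s.
  apply: integral0_eq => t _; rewrite patchE; case: ifPn => // /set_mem.
  move=> /(eballE _ r0); rewrite lineE => h.
  exfalso; have sq0 := sqr_ge0 ((t : R) + x 0 i).
  by have := lt_le_trans rs (le_trans (ler_wpDl sq0 (lexx s)) h); rewrite ltxx.
pose c := Num.sqrt (r ^+ 2 - s).
have c2 : c ^+ 2 = r ^+ 2 - s by rewrite sqr_sqrtr // subr_ge0.
have c0 : 0 <= c by exact: sqrtr_ge0.
have dl (t : R) : is_derive t 1 (fun h : R => F (h *: delta_mx 0 i + x)) (partial i F (t *: delta_mx 0 i + x)).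
  by apply: is_derive_line; exact: C1_derivable.
pose phi (t : R) := F (t *: delta_mx 0 i + x).
pose dphi (t : R) := partial i F (t *: delta_mx 0 i + x).
have mem t : (t *: delta_mx 0 i + x \in eball r) = (t \in `[- c - x 0 i, c - x 0 i]).
  have sq : ((t + x 0 i) ^+ 2 <= c ^+ 2) = (t \in `[- c - x 0 i, c - x 0 i]).
    rewrite -real_normK ?num_real // ler_pXn2r ?nnegrE ?normr_ge0 // ler_norml in_itv /=.
    by rewrite lerBlDr lerBrDr.
  rewrite -sq c2 lerBrDr -lineE; apply/idP/idP.
    by move/set_mem/(eballE _ r0).
  by move=> h; apply/mem_set/(eballE _ r0).
transitivity (\int[leb]_(t in `[(- c - x 0 i)%R, (c - x 0 i)%R]) (dphi t)%:E)%E.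
  rewrite [RHS]integral_mkcond; apply: eq_integral => t _.
  rewrite !patchE mem; case: ifPn => [h|h].
    by rewrite ifT //; apply/mem_set.
  by rewrite ifN //; apply/negP => /set_mem; exact/negP.
have Fend t : (t + x 0 i) ^+ 2 = c ^+ 2 -> phi t = 0.
  by move=> h; apply: F0; rewrite lineE h c2 subrK.
have cline : continuous (fun t : R => t *: delta_mx 0 i + x).
  move=> t; apply: (@continuousD _ _ _ (fun t : R => t *: (delta_mx 0 i : 'rV[R]_n)) (fun=> x)).
    exact: scalel_continuous.
  exact: cst_continuous.
move: c0; rewrite le_eqVlt => /orP[/eqP c00|c0].
  by rewrite -c00 oppr0 set_itv1 integral_set1.
rewrite (@continuous_FTC2 _ dphi phi).
- rewrite !Fend ?subee //; ring.
- lra.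
- apply: continuous_subspaceT => t.
  by apply: (@continuous_comp _ _ _ (fun t : R => t *: delta_mx 0 i + x) (partial i F));
    [exact: cline|exact: C1_partial].
- have cphi : continuous phi.
    move=> t; apply: (@continuous_comp _ _ _ (fun t : R => t *: delta_mx 0 i + x) F); first exact: cline.
    exact: C1_continuous.
  split.
  + by move=> t _; case: (dl t).
  + exact/cvg_at_right_filter/cphi.
  + exact/cvg_at_left_filter/cphi.
- by move=> t _; rewrite derive1E; case: (dl t).
Qed.

Lemma integral_partial_eball F i r : 0 <= r -> C1 F -> (forall y, normsq y = r ^+ 2 -> F y = 0) ->
  \int[lam]_(x in eball r) partial i F x = 0.
Proof.
move=> r0 cF F0.
have cd := C1_partial (i := i) cF.
have [M M0 fM] := continuous_bounded_box r0 cd.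
rewrite Rintegral_mkcond /Rintegral.
rewrite (@integral_lines_eq0 _ _ i _ M r) //.
- apply/(measurable_restrictT _ (measurable_eball r)).
  by apply: measurable_funTS; exact: continuous_measurable_rV.
- move=> x; rewrite patchE; case: ifPn => [/set_mem xr|_].
    by apply/fM/eball_sub_box.
  by rewrite normr0.
- move=> x xb; rewrite patchE; case: ifPn => // /set_mem xr.
  by case: xb; exact: eball_sub_box.
- by move=> x; exact: integral_line_eball.
Qed.

(** The divergence theorem on the ball against the weight [r^2 - |x|^2], which makes
    the boundary term of each one-dimensional integration vanish. *)
Lemma weighted_divergence (X : 'I_n -> 'rV[R]_n -> R) r : 0 <= r -> (forall i, C1 (X i)) ->
  \int[lam]_(x in eball r) ((r ^+ 2 - normsq x) * \sum_i partial i (X i) x) =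
  \int[lam]_(x in eball r) (2 * \sum_i X i x * x 0 i).
Proof.
move=> r0 cX.
have cN : C1 (fun x => r ^+ 2 - normsq x) := C1B (C1_cst _ _) C1_normsq.
have cF i : C1 (fun x => (r ^+ 2 - normsq x) * X i x) := C1M cN (cX i).
apply/eqP; rewrite -subr_eq0 -RintegralB; last 3 first.
- exact: measurable_eball.
- apply: continuous_integrable_eball; apply: continuous_mul; first exact: C1_continuous.
  by apply: continuous_bigsum => i; exact: C1_partial.
- apply: continuous_integrable_eball; apply: continuous_mul; first exact: cst_continuous.
  by apply: continuous_bigsum => i; apply: continuous_mul; [exact: C1_continuous|exact: continuous_coord].
apply/eqP.
transitivity (\int[lam]_(x in eball r) \sum_i partial i (fun y => (r ^+ 2 - normsq y) * X i y) x).
  apply: eq_Rintegral => x _; rewrite !mulr_sumr -sumrB; apply: eq_bigr => i _.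
  rewrite (partialM i x cN (cX i)) (partialB i x (C1_cst _ _) C1_normsq) partial_cst partial_normsq.
  by move: (partial i (X i) x) => d; ring.
pose I s := \int[lam]_(x in eball r) \sum_(i <- s) partial i (fun y => (r ^+ 2 - normsq y) * X i y) x.
suff : forall s, I s = 0 by apply.
elim => [|i s IH]; rewrite /I.
  under eq_Rintegral do rewrite big_nil.
  by rewrite Rintegral_cst ?mul0r //; exact: measurable_eball.
under eq_Rintegral do rewrite big_cons.
rewrite RintegralD; last 3 first.
- exact: measurable_eball.
- by apply: continuous_integrable_eball; exact: C1_partial.
- apply: continuous_integrable_eball.
  elim: s {IH} => [|j s IH].
    by under eq_fun do rewrite big_nil; exact: cst_continuous.
  by under eq_fun do rewrite big_cons; apply: continuous_add => //; exact: C1_partial.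
rewrite -/(I s) IH addr0; apply: integral_partial_eball => // y yr.
by rewrite yr subrr mul0r.
Qed.

End balls.

(** * Polar coordinates *)

Section signed_integrals.
Context d1 d2 (T1 : measurableType d1) (T2 : measurableType d2) (R : realType).
Context (m1 : {measure set T1 -> \bar R}) (m2 : {measure set T2 -> \bar R}).
Context (A : set T1) (B : set T2) (phi : T2 -> T1) (c : R).

(** A change of variables extends from nonnegative to integrable functions by splitting
    [f] into its positive and negative parts. *)
Lemma integral_transfer (f : T1 -> \bar R) :
  (forall g : T1 -> \bar R, measurable_fun setT g -> (forall x, 0 <= g x)%E ->
    \int[m1]_(x in A) g x = c%:E * \int[m2]_(x in B) g (phi x))%E ->
  measurable_fun setT f -> measurable B -> m2.-integrable B (f \o phi) ->
  (\int[m1]_(x in A) f x = c%:E * \int[m2]_(x in B) f (phi x))%E.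
Proof.
move=> H mf mB fi; rewrite integralE [in RHS]integralE.
rewrite (H f^\+%E) ?(H f^\-%E) //; last 2 first.
- exact: measurable_funeneg.
- exact: measurable_funepos.
rewrite -muleBr //; last first.
  have h : m2.-integrable B (f^\- \o phi)%E.
    by rewrite -funeneg_comp; exact: integrable_funeneg.
  by apply: fin_num_adde_defl; rewrite fin_numN; exact: (@integrable_fin_num _ _ _ m2 B mB _ h).
by congr (_ * (_ - _))%E; apply: eq_integral => x _; rewrite ?(funepos_comp f phi) ?(funeneg_comp f phi).
Qed.

End signed_integrals.

Section sphere.
Context (R : realType) (n : nat).
Implicit Types (x : 'rV[R]_n) (F : 'rV[R]_n -> R) (r a b : R).
Local Notation lam := (lebesgue_rV R n).
Local Notation usphere := [set y : 'rV[R]_n | enorm y = 1].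
Local Notation P := (@punctured_ball R n).

Lemma enorm_eq0 : enorm (0 : 'rV[R]_n) = 0.
Proof. by rewrite -(scale0r 0) enormZ normr0 mul0r. Qed.

Lemma enorm_normalize x : 0 < enorm x -> enorm (normalize x) = 1.
Proof. by move=> x0; rewrite enormZ gtr0_norm ?invr_gt0 // mulVf // gt_eqF. Qed.

Lemma normalize_scale r x : 0 < r -> normalize (r *: x) = normalize x.
Proof.
move=> r0; rewrite /normalize enormZ gtr0_norm // scalerA invfM.
by rewrite mulrAC mulVf ?mul1r // gt_eqF.
Qed.

Lemma measurable_usphere : measurable usphere.
Proof.
rewrite [X in measurable X](_ : _ = setT `&` @enorm R n @^-1` [set 1]).
  by apply: measurable_enorm => //; exact: measurable_set1.
by rewrite setTI.
Qed.

Lemma measurable_patch_normalize :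
  measurable_fun setT (patch (fun=> (0 : 'rV[R]_n)) P (@normalize R n)).
Proof.
apply: measurable_fun_rV => i.
have -> : rV_coord i \o patch (fun=> 0) P (@normalize R n) =
    (fun x => normalize x 0 i : R) \_ P.
  by apply/funext => x; rewrite /= /rV_coord /patch; case: ifP => //; rewrite mxE.
apply/(measurable_restrictT _ (@measurable_punctured_ball R n)).
apply: measurable_funTS.
exact: (measurableT_comp (measurable_rV_coord i) (@measurable_normalize R n)).
Qed.

(** The sphere measure is [n] times the image under [normalize] of Lebesgue measure on the
    punctured ball. Off this set [normalize] is replaced by the constant [0], which does not
    lie on the sphere. *)
Lemma ge0_integral_sphere_measure (g : 'rV[R]_n -> \bar R) :
  measurable_fun setT g -> (forall x, 0 <= g x)%E ->
  (\int[sphere_measure R n]_(y in usphere) g y =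
   n%:R%:E * \int[lam]_(x in P) g (normalize x))%E.
Proof.
move=> mg g0; rewrite /sphere_measure /=.
have mS := measurable_usphere.
rewrite (ge0_integral_mscale _ mS _ (measurable_funTS mg)) //; congr (_ * _)%E.
pose phi := patch (fun=> (0 : 'rV[R]_n)) P (@normalize R n).
have mphi : measurable_fun setT phi := measurable_patch_normalize.
have phiS A : A `<=` usphere -> phi @^-1` A = P `&` @normalize R n @^-1` A.
  move=> AS; apply/seteqP; split => x /=.
    rewrite /phi /patch; case: ifPn => [/set_mem Px Ax //|_ A0].
    by have := AS _ A0; rewrite /= enorm_eq0 => /esym/eqP; rewrite oner_eq0.
  by case=> Px Ax; rewrite /phi /patch mem_set.
have phiU : phi @^-1` usphere = P.
  rewrite phiS //; apply/seteqP; split => [x [] //|x Px]; split => //=.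
  by apply: enorm_normalize; case/andP: Px.
transitivity (\int[pushforward lam phi]_(y in usphere) g y)%E.
  apply: eq_measure_integral => A mA AS /=.
  by rewrite /pushforward phiS.
rewrite (ge0_integral_pushforward mphi lam mS (measurable_funTS mg)) //.
rewrite phiU; apply: eq_integral => x xP /=.
by rewrite /phi /patch xP.
Qed.

Definition punctured r : set 'rV[R]_n := [set x | 0 < enorm x <= r].

Lemma measurable_punctured r : measurable (punctured r).
Proof.
rewrite [X in measurable X](_ : _ = setT `&` @enorm R n @^-1` `]0, r]).
  by apply: measurable_enorm => //; exact: measurable_itv.
by rewrite setTI; apply/seteqP; split => x /=; rewrite in_itv.
Qed.

Lemma punctured_finite r : (lam (punctured r) < +oo)%E.
Proof.
apply: le_lt_trans (eball_finite n r); apply: le_measure; rewrite ?inE.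
- exact: measurable_punctured.
- exact: measurable_eball.
- by move=> x /andP[].
Qed.

Section radial_extension.
Context (F : 'rV[R]_n -> R) (a : R).
Hypotheses (cF : continuous F) (a0 : 0 < a).

(** The extension of [F] from the sphere of radius [a], constant along rays. *)
Definition radial x : R := F (a *: normalize x).

Lemma measurable_radial : measurable_fun setT (radial : _ -> measurableTypeR R).
Proof.
have mF := continuous_measurable_rV cF.
have ms : measurable_fun setT (fun x : 'rV[R]_n => a *: normalize x).
  apply: measurable_fun_rV => i.
  rewrite [X in measurable_fun _ X](_ : _ = (fun x => a * (rV_coord i \o @normalize R n) x)).
    apply: measurable_funM; first exact: measurable_cst.
    exact: (measurableT_comp (measurable_rV_coord i) (@measurable_normalize R n)).
  by apply/funext => x; rewrite /rV_coord /= mxE.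
exact: (measurableT_comp mF ms).
Qed.

Lemma radial_bounded : exists2 M, 0 <= M & forall x, `|radial x| <= M.
Proof.
have [M M0 FM] := continuous_bounded_box (ltW a0) cF.
exists M => // x; apply/FM/eball_sub_box; rewrite /eball /= enormZ gtr0_norm //.
rewrite ler_piMr ?(ltW a0) //.
have := enorm_ge0 x; rewrite le_eqVlt => /orP[/eqP x0|x0].
  by rewrite /normalize -x0 invr0 scale0r enorm_eq0.
by rewrite enorm_normalize.
Qed.

Lemma radial_integrable (A : set 'rV[R]_n) : measurable A -> (lam A < +oo)%E ->
  lam.-integrable A (EFin \o radial).
Proof.
move=> mA fA; have [M M0 rM] := radial_bounded.
apply: (@bounded_support_integrable _ _ _ _ M) => //.
by apply: measurable_funTS; exact: measurable_radial.
Qed.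

Lemma sphere_integral_radial : sphere_integral a F =
  a ^+ n.-1 * (n%:R * \int[lam]_(x in P) radial x).
Proof.
rewrite /sphere_integral; congr (_ * _); rewrite /Rintegral.
have mP := @measurable_punctured_ball R n.
have mG : measurable_fun setT (fun y : 'rV[R]_n => (F (a *: y))%:E).
  apply/measurable_EFinP; apply: continuous_measurable_rV => y.
  apply: (@continuous_comp _ _ _ (fun y : 'rV[R]_n => a *: y) F); last exact: cF.
  exact: scaler_continuous.
have i1 : lam.-integrable P (EFin \o radial).
  by apply: radial_integrable => //; exact: (punctured_finite 1).
rewrite (integral_transfer (phi := @normalize R n) (m2 := lam) (B := P) (c := n%:R)) //.
  by rewrite fineM //; exact: (integrable_fin_num mP i1).
exact: ge0_integral_sphere_measure.
Qed.

(** Functions that are constant along rays are invariant under dilations. *)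
Lemma integral_radial_punctured r : 0 < r ->
  \int[lam]_(x in punctured r) radial x = r ^+ n * \int[lam]_(x in P) radial x.
Proof.
move=> r0; have mP := @measurable_punctured_ball R n.
have i1 : lam.-integrable P (EFin \o radial).
  by apply: radial_integrable => //; exact: (punctured_finite 1).
have ir : lam.-integrable (punctured r) (EFin \o radial).
  by apply: radial_integrable; [exact: measurable_punctured|exact: punctured_finite].
pose h := (EFin \o radial) \_ (punctured r).
have hi : lam.-integrable setT h by apply/(integrable_mkcond _ (measurable_punctured r)).
have hs x : h (r *: x) = ((EFin \o radial) \_ P) x.
  rewrite /h !patchE /= /radial normalize_scale //.
  have -> : (r *: x \in punctured r) = (x \in P) => //.
  have : punctured r (r *: x) <-> P x.
    rewrite /punctured /punctured_ball /= enormZ gtr0_norm //.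
    by rewrite pmulr_rgt0 // -[X in _ <= X]mulr1 ler_pM2l.
  by move=> H; apply/idP/idP => /set_mem ?; apply/mem_set; apply/H.
have E : (\int[lam]_x h x = (r ^+ n)%:E * \int[lam]_x h (r *: x))%E.
  apply: (@integral_transfer _ _ _ _ R lam lam setT setT (fun x => r *: x)) => //.
  - move=> g mg g0; rewrite ge0_integral_scale // muleA -EFinM divff ?mul1e //.
    by rewrite expf_neq0 // gt_eqF.
  - exact: (measurable_int _ hi).
  - have -> : h \o (fun x => r *: x) = (EFin \o radial) \_ P by apply/funext => x; exact: hs.
    by apply/(integrable_mkcond _ mP).
have E2 : (\int[lam]_x h (r *: x) = \int[lam]_(x in P) (radial x)%:E)%E.
  by rewrite [RHS]integral_mkcond; apply: eq_integral => x _; exact: hs.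
rewrite /Rintegral [in LHS]integral_mkcond [X in fine X]E E2.
by rewrite fineM //; exact: (integrable_fin_num mP i1).
Qed.

Definition annulus r b : set 'rV[R]_n := eball b `\` eball r.

Lemma measurable_annulus r b : measurable (annulus r b).
Proof. by apply: measurableD; exact: measurable_eball. Qed.

Lemma annulus_finite r b : (lam (annulus r b) < +oo)%E.
Proof.
apply: le_lt_trans (eball_finite n b); apply: le_measure; rewrite ?inE.
- exact: measurable_annulus.
- exact: measurable_eball.
- by move=> x [].
Qed.

Lemma integral_radial_annulus b : a < b ->
  \int[lam]_(x in annulus a b) radial x = (b ^+ n - a ^+ n) * \int[lam]_(x in P) radial x.
Proof.
move=> ab; have b0 := lt_trans a0 ab.
rewrite mulrBl -!integral_radial_punctured //.
have -> : punctured b = punctured a `|` annulus a b.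
  apply/seteqP; split => x /=.
    rewrite /punctured /annulus /eball /= => /andP[x0 xb].
    by have [xa|xa] := leP (enorm x) a; [left; rewrite x0|right; split => //; rewrite leNgt xa].
  rewrite /punctured /annulus /eball /= => -[/andP[-> xa]|[xb /negP]].
    by rewrite (le_trans xa) // ltW.
  by rewrite -ltNge => xa; rewrite xb (lt_trans a0 xa).
rewrite Rintegral_setU; first by rewrite addrAC subrr add0r.
- exact: measurable_punctured.
- exact: measurable_annulus.
- apply: radial_integrable; first by apply: measurableU; [exact: measurable_punctured|exact: measurable_annulus].
  apply: le_lt_trans (punctured_finite b); apply: le_measure; rewrite ?inE.
  + by apply: measurableU; [exact: measurable_punctured|exact: measurable_annulus].
  + exact: measurable_punctured.
  + move=> x; rewrite /punctured /annulus /eball /= => -[/andP[-> xa]|[xb /negP]].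
      by rewrite (le_trans xa) // ltW.
    by rewrite -ltNge => xa; rewrite xb (lt_trans a0 xa).
- apply/disj_setPS => x [] /=; rewrite /punctured /annulus /eball /=.
  by move=> /andP[_ xa] [_].
Qed.

End radial_extension.

End sphere.

Section sphere_volume.
Context (R : realType) (n : nat).
Hypothesis n0 : (0 < n)%N.
Local Notation lam := (lebesgue_rV R n).
Local Notation P := (@punctured_ball R n).

(** The ball contains a cube of positive side in the open positive orthant. *)
Lemma punctured_ball_gt0 : (0 < lam P)%E.
Proof.
(* All coordinates in this cube lie between [1/(4n)] and [3/(4n)]. *)
pose c : 'rV[R]_n := const_mx (2 * n%:R)^-1.
have n1 : 0 < n%:R :> R by rewrite ltr0n.
pose rho : R := (4 * n%:R)^-1.
have rho0 : 0 < rho by rewrite invr_gt0 mulr_gt0.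
apply: (@lt_le_trans _ _ (lam (box c rho))).
  by rewrite lebesgue_box ?(ltW rho0) // lte_fin exprn_gt0 // mulr_gt0.
apply: le_measure; rewrite ?inE; first exact: measurable_box.
  exact: measurable_punctured_ball.
move=> x bx.
have xi i : 0 < x 0 i <= n%:R^-1.
  have := bx i; rewrite mxE ler_distl => /andP[lo hi].
  have e1 : (2 * n%:R)^-1 - rho = rho by rewrite /rho; field; rewrite gt_eqF.
  have e2 : (2 * n%:R)^-1 + rho <= n%:R^-1.
    rewrite /rho -subr_ge0 (_ : _ - _ = (4 * n%:R)^-1) ?ltW //; field; rewrite gt_eqF //.
  by rewrite (lt_le_trans rho0) ?(le_trans hi) // -{1}e1.
rewrite /punctured_ball /=; apply/andP; split.
  have := coord_le_enorm x (Ordinal n0); apply: lt_le_trans.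
  by rewrite normr_gt0 gt_eqF //; case/andP: (xi (Ordinal n0)).
have : normsq x <= 1 ^+ 2.
  rewrite expr1n; apply: (le_trans (y := \sum_(i < n) (n%:R^-1 : R))).
    apply: ler_sum => i _; have /andP[x0 x1] := xi i.
    rewrite expr2; apply: (le_trans (y := 1 * n%:R^-1)); last by rewrite mul1r.
    have x1' : x 0 i <= 1 by apply: (le_trans x1); rewrite invf_le1 // ler1n.
    by apply: ler_pM => //; exact: ltW.
  by rewrite sumr_const card_ord -[X in X <= _]mulr_natl mulfV // gt_eqF.
by move/(eballE _ ler01).
Qed.

Lemma sphere_volume_gt0 : 0 < sphere_volume R n.
Proof.
rewrite /sphere_volume /sphere_measure /= /mscale /= /cone_measure.
have -> : P `&` @normalize R n @^-1` [set y | enorm y = 1] = P.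
  apply/seteqP; split => [x [] //|x Px]; split => //=.
  by apply: enorm_normalize; case/andP: Px.
have fin : (lam P < +oo)%E := punctured_finite n 1.
have pos := punctured_ball_gt0.
rewrite fineM //; last by rewrite ge0_fin_numE // ltW.
by rewrite mulr_gt0 //= ?ltr0n // fine_gt0 // pos.
Qed.

End sphere_volume.

(** * Fluxes through spheres and integrals over balls *)

Section lipschitz.
Context (R : realType) (n : nat).
Implicit Types (x y z : 'rV[R]_n) (F : 'rV[R]_n -> R).

Lemma line_increment F (M r h : R) i z : C1 F ->
  (forall y, box 0 r y -> `|partial i F y| <= M) ->
  box 0 r z -> box 0 r (h *: delta_mx 0 i + z) ->
  `|F (h *: delta_mx 0 i + z) - F z| <= M * `|h|.
Proof.
move=> cF dM bz bhz.
have seg c : Num.min 0 h <= c <= Num.max 0 h -> box 0 r (c *: delta_mx 0 i + z).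
  move=> /andP[lc ch] j; have := bz j; have := bhz j; rewrite !mxE !subr0 eqxx /= (eq_sym j i).
  case: eqP => [<-|_]; rewrite ?mulr1 ?mulr0 ?add0r // !ler_norml.
  by move: lc ch; rewrite ge_min le_max => /orP[] ? /orP[] ? /andP[? ?] /andP[? ?]; lra.
have [h0|h0|<-] := ltrgtP 0 h; last by rewrite scale0r add0r subrr !normr0 mulr0.
  have [c /andP[c0 ch] ->] := mean_value_line i z h0 cF.
  rewrite normrM ler_wpM2r //; apply/dM/seg.
  by rewrite ge_min le_max (ltW c0) (ltW ch) orbT.
have nh0 : 0 < - h by rewrite oppr_gt0.
have [c /andP[c0 ch] E] := mean_value_line i (h *: delta_mx 0 i + z) nh0 cF.
rewrite scaleNr addKr in E.
rewrite distrC E addrA -scalerDl normrM normrN ler_wpM2r //; apply/dM/seg.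
by rewrite ge_min le_max; apply/andP; split; apply/orP; [right|left]; lra.
Qed.

(** The coordinates are changed from those of [y] to those of [x] one at a time, without
    leaving the box. *)
Lemma C1_lipschitz_box F (r : R) : 0 <= r -> C1 F ->
  exists2 M, 0 <= M & forall x y, box 0 r x -> box 0 r y ->
    `|F x - F y| <= M * \sum_i `|x 0 i - y 0 i|.
Proof.
move=> r0 cF.
have cS : continuous (fun x => \sum_i `|partial i F x|).
  by apply: continuous_bigsum => i; apply: continuous_norm; exact: C1_partial.
have [M M0 MF] := continuous_bounded_box r0 cS.
exists M => // x y bx by_.
have dM i z : box 0 r z -> `|partial i F z| <= M.
  move=> bz; apply: (le_trans _ (MF z bz)); apply: (le_trans _ (ler_norm _)).
  by rewrite (bigD1 i) //= lerDl; apply: sumr_ge0.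
(* Coordinates in [s] are taken from [x], the others from [y]. *)
pose mix (s : seq 'I_n) : 'rV[R]_n := \row_j (if j \in s then x 0 j else y 0 j).
have bmix s : box 0 r (mix s).
  by move=> j; rewrite !mxE; case: ifP => _; [have := bx j|have := by_ j]; rewrite mxE.
suff H s : uniq s -> `|F (mix s) - F y| <= M * \sum_(i <- s) `|x 0 i - y 0 i|.
  have := H _ (index_enum_uniq 'I_n); congr (`|F _ - _| <= _).
  by apply/rowP => j; rewrite mxE mem_index_enum.
elim: s => [|i s IH] /=.
  move=> _; rewrite (_ : mix [::] = y) ?subrr ?normr0 ?big_nil ?mulr0 //.
  by apply/rowP => j; rewrite mxE.
move=> /andP[si us]; rewrite big_cons mulrDr.
have E : mix (i :: s) = (x 0 i - y 0 i) *: delta_mx 0 i + mix s.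
  apply/rowP => j; rewrite !mxE eqxx /= inE; case: eqP => [->|_].
    by rewrite (negbTE si) /= mulr1 subrK.
  by rewrite /= mulr0 add0r.
rewrite -(subrKA (F (mix s))); apply: (le_trans (ler_normD _ _)); apply: lerD; last exact: IH.
rewrite E; apply: (@line_increment F M r) => //; first exact: dM.
by rewrite -E; exact: bmix.
Qed.

End lipschitz.

Section limits.
Context (R : realType).

Lemma continuous_ge_right (Phi : R -> R) (a d e : R) : 0 < d ->
  {for a, continuous Phi} -> (forall b, a < b < a + d -> e <= Phi b) -> e <= Phi a.
Proof.
move=> d0 cPhi H; rewrite leNgt; apply/negP => lt.
have /nbhs_ballP[r /= r0 br] : \forall b \near a, `|Phi a - Phi b| < e - Phi a.
  by apply: (@cvgr_dist_lt _ _ _ (nbhs a)) => //; rewrite subr_gt0.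
pose m := Num.min r d / 2.
have m0 : 0 < m by rewrite divr_gt0 // lt_min r0 d0.
have mr : m < r by rewrite /m ltr_pdivrMr // gt_min; apply/orP; left; lra.
have md : m < d by rewrite /m ltr_pdivrMr // gt_min; apply/orP; right; lra.
have /H h : a < a + m < a + d by apply/andP; split; lra.
have /br : ball a r (a + m) by rewrite /ball /= opprD addNKr normrN gtr0_norm.
by rewrite ltr_norml => /andP[h1 h2]; lra.
Qed.

Lemma continuous_le_right (Phi : R -> R) (a d e : R) : 0 < d ->
  {for a, continuous Phi} -> (forall b, a < b < a + d -> Phi b <= e) -> Phi a <= e.
Proof.
move=> d0 cPhi H; rewrite -lerN2.
apply: (@continuous_ge_right (fun b => - Phi b) a d) => //; first exact: continuousN.
by move=> b /H; rewrite lerN2.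
Qed.

(** [(b^n - a^n) / (b^2 - a^2)], extended continuously to [b = a]. *)
Definition power_quotient (n : nat) (a b : R) : R :=
  (\sum_(i < n) b ^+ (n.-1 - i) * a ^+ i) / (b + a).

Lemma power_quotientE n a b : 0 < a -> a < b ->
  b ^+ n - a ^+ n = (b ^+ 2 - a ^+ 2) * power_quotient n a b.
Proof.
move=> a0 ab; have ba : b + a != 0 by rewrite gt_eqF // addr_gt0 // (lt_trans a0).
rewrite subrXX /power_quotient subr_sqr; field; exact: ba.
Qed.

Lemma power_quotient_diag n a : 0 < a -> power_quotient n a a * (2 * a) = n%:R * a ^+ n.-1.
Proof.
move=> a0; rewrite /power_quotient (eq_bigr (fun=> a ^+ n.-1)); last first.
  by move=> i _; rewrite -exprD subnK // -ltnS (leq_trans (ltn_ord i)) // leqSpred.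
rewrite sumr_const card_ord -[X in X / _]mulr_natl; move: (a ^+ n.-1) => c.
by field; rewrite gt_eqF // addr_gt0.
Qed.

Lemma continuous_power_quotient n a : 0 < a -> {for a, continuous (power_quotient n a)}.
Proof.
move=> a0; rewrite /power_quotient; apply: continuousM.
  have cs (s : seq 'I_n) : continuous (fun b : R => \sum_(i <- s) b ^+ (n.-1 - i) * a ^+ i).
    elim: s => [|i s IH].
      by under eq_fun do rewrite big_nil; exact: cst_continuous.
    under eq_fun do rewrite big_cons; move=> b.
    apply: (@continuousD _ _ _ (fun b : R => b ^+ (n.-1 - i) * a ^+ i)); last exact: IH.
    by apply: continuousM; [exact: exprn_continuous|exact: cst_continuous].
  exact: cs.
apply: continuousV; first by rewrite gt_eqF // addr_gt0.
by apply: continuousD; [exact: cvg_id|exact: cst_continuous].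
Qed.

End limits.

Section flux.
Context (R : realType) (n : nat) (X : 'I_n -> 'rV[R]_n -> R).
Hypothesis C1_X : forall i, C1 (X i).
Implicit Types (x : 'rV[R]_n) (f : 'rV[R]_n -> R) (a b r : R).
Local Notation lam := (lebesgue_rV R n).
Local Notation P := (@punctured_ball R n).

Definition divergence x : R := \sum_i partial i (X i) x.

Definition ball_integral r : R := \int[lam]_(x in eball r) divergence x.

Definition flux r : R := sphere_integral r (fun x => \sum_i X i x * (x 0 i / enorm x)).

Lemma continuous_divergence : continuous divergence.
Proof. by apply: continuous_bigsum => i; exact: C1_partial. Qed.

Lemma continuous_integrable_annulus f a b : continuous f ->
  lam.-integrable (annulus a b) (EFin \o f).
Proof.
move=> cf; apply: (integrableS (@measurable_eball R n b)).
- exact: measurable_annulus.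
- by move=> x [].
- exact: continuous_integrable_eball.
Qed.

Lemma Rintegral_eball_split f a b : a <= b -> continuous f ->
  \int[lam]_(x in eball b) f x =
  \int[lam]_(x in eball a) f x + \int[lam]_(x in annulus a b) f x.
Proof.
move=> ab cf.
have E : eball b = eball a `|` annulus a b :> set 'rV[R]_n.
  by rewrite /annulus setDUK // => x xa; exact: le_trans xa ab.
rewrite {1}E Rintegral_setU //.
- exact: measurable_eball.
- exact: measurable_annulus.
- by rewrite -E; exact: continuous_integrable_eball.
- by apply/disj_setPS => x [] xa [_] /(_ xa).
Qed.

Lemma C1_radial_part : C1 (fun x => \sum_i X i x * x 0 i).
Proof. by apply: C1_sum => i; exact: C1M (C1_X i) (C1_coord R i). Qed.

Lemma flux_radial a : 0 < a -> flux a =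
  a ^+ n.-1 * (n%:R * \int[lam]_(x in P)
     radial (fun x => a^-1 * \sum_i X i x * x 0 i) a x).
Proof.
move=> a0; rewrite -sphere_integral_radial //; last first.
  exact: continuous_mul (@cst_continuous _ _ _) (C1_continuous C1_radial_part).
rewrite /flux /sphere_integral; congr (_ * _); apply: eq_Rintegral => y /set_mem /= y1.
rewrite enormZ y1 mulr1 gtr0_norm // mulr_sumr; apply: eq_bigr => i _.
by rewrite mulrA mulrC.
Qed.

Hypothesis divergence_ge0 : forall x, 0 <= divergence x.

Lemma Rintegral_annulus_ge0 f a b : (forall x, 0 <= f x) ->
  0 <= \int[lam]_(x in annulus a b) f x.
Proof. by move=> f0; apply: Rintegral_ge0 => x _. Qed.

Lemma ball_integral_le a b : a <= b -> ball_integral a <= ball_integral b.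
Proof.
move=> ab; rewrite /ball_integral (Rintegral_eball_split ab continuous_divergence) lerDl.
exact: Rintegral_annulus_ge0.
Qed.

Lemma ball_integral_ge0 a : 0 <= ball_integral a.
Proof. by apply: Rintegral_ge0 => x _. Qed.

Lemma continuous_weight r : continuous (fun x => (r ^+ 2 - normsq x) * divergence x).
Proof.
apply: continuous_mul; last exact: continuous_divergence.
by apply: (@C1_continuous R n (fun x => r ^+ 2 - normsq x)); exact: C1B (C1_cst _ _) (C1_normsq R n).
Qed.

Lemma Rintegral_weight_shift (A : set 'rV[R]_n) a b : measurable A ->
  (forall f, continuous f -> lam.-integrable A (EFin \o f)) ->
  \int[lam]_(x in A) ((b ^+ 2 - normsq x) * divergence x) =
  (b ^+ 2 - a ^+ 2) * \int[lam]_(x in A) divergence x +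
  \int[lam]_(x in A) ((a ^+ 2 - normsq x) * divergence x).
Proof.
move=> mA iA; rewrite -RintegralZl //; last by apply: iA; exact: continuous_divergence.
rewrite -RintegralD //.
- by apply: eq_Rintegral => x _; rewrite -mulrDl; congr (_ * _); ring.
- by apply: iA; apply: continuous_mul; [exact: cst_continuous|exact: continuous_divergence].
- by apply: iA; exact: continuous_weight.
Qed.

(** The integral over the shell is the difference of the weighted divergence theorems on
    the two balls. The weights differ by the constant [b^2 - a^2], and on the shell the first
    is nonnegative and the second nonpositive. *)
Lemma annulus_mean_bounds a b : 0 < a -> a < b ->
  (b ^+ 2 - a ^+ 2) * ball_integral a <=
    \int[lam]_(x in annulus a b) (2 * \sum_i X i x * x 0 i) <=
  (b ^+ 2 - a ^+ 2) * ball_integral b.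
Proof.
move=> a0 ab; have b0 := lt_trans a0 ab.
have cF : continuous (fun x => 2 * \sum_i X i x * x 0 i).
  exact: continuous_mul (@cst_continuous _ _ _) (C1_continuous C1_radial_part).
have E : \int[lam]_(x in annulus a b) (2 * \sum_i X i x * x 0 i) =
    \int[lam]_(x in eball b) ((b ^+ 2 - normsq x) * divergence x) -
    \int[lam]_(x in eball a) ((a ^+ 2 - normsq x) * divergence x).
  rewrite (weighted_divergence (ltW b0) C1_X) (weighted_divergence (ltW a0) C1_X).
  by rewrite (Rintegral_eball_split (ltW ab) cF) addrAC subrr add0r.
have b2 : 0 <= b ^+ 2 - a ^+ 2 by rewrite subr_ge0 ler_pXn2r ?nnegrE // ltW.
rewrite {}E; apply/andP; split.
  rewrite (Rintegral_eball_split (ltW ab) (@continuous_weight b)).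
  rewrite (@Rintegral_weight_shift (eball a) a b); last 2 first.
  - exact: measurable_eball.
  - by move=> f; exact: continuous_integrable_eball.
  rewrite addrAC addrK lerDl; apply: Rintegral_ge0 => x [/(eballE _ (ltW b0)) xb _].
  by rewrite mulr_ge0 // subr_ge0.
rewrite (@Rintegral_weight_shift (eball b) a b); last 2 first.
- exact: measurable_eball.
- by move=> f; exact: continuous_integrable_eball.
rewrite (Rintegral_eball_split (ltW ab) (@continuous_weight a)) addrA addrAC addrK.
rewrite -[X in _ <= X]addr0 lerD2l -oppr_ge0 -mulN1r -RintegralZl; last 2 first.
- exact: measurable_annulus.
- exact/continuous_integrable_annulus/continuous_weight.
apply: Rintegral_ge0 => x [_ xa]; rewrite mulN1r -mulNr mulr_ge0 // oppr_ge0 subr_le0.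
by rewrite leNgt; apply/negP => h; apply/xa/(eballE _ (ltW a0))/ltW.
Qed.

Lemma radial_defect a x : 0 < a -> a < enorm x ->
  forall i, `|x 0 i - (a *: normalize x) 0 i| <= enorm x - a.
Proof.
move=> a0 ax i; have x0 := lt_trans a0 ax.
rewrite !mxE mulrA -[X in `|X - _|]mul1r -mulrBl normrM.
have -> : 1 - a / enorm x = (enorm x - a) / enorm x by rewrite mulrBl mulfV // gt_eqF.
rewrite ger0_norm ?divr_ge0 ?(ltW x0) ?subr_ge0 ?(ltW ax) //.
rewrite mulrAC ler_pdivrMr //; apply: ler_wpM2l; first by rewrite subr_ge0 ltW.
exact: coord_le_enorm.
Qed.

(** On a thin shell [X] is nearly constant along rays, with an error proportional to the
    thickness. *)
Lemma annulus_radial_approx a : 0 < a -> exists2 C, 0 <= C & forall b, a < b < a + a ->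
  `|\int[lam]_(x in annulus a b) (2 * \sum_i X i x * x 0 i) -
    2 * a * (b ^+ n - a ^+ n) * \int[lam]_(x in P)
       radial (fun x => a^-1 * \sum_i X i x * x 0 i) a x|
  <= C * (b - a) * (b ^+ n - a ^+ n).
Proof.
move=> a0; set F := fun x => a^-1 * \sum_i X i x * x 0 i.
have cF1 : C1 F by exact: C1Z C1_radial_part.
have cF := C1_continuous cF1.
have [M M0 LF] := C1_lipschitz_box (ltW (addr_gt0 a0 a0)) cF1.
pose V := \int[lam]_(x in P) (1 : R).
have V0 : 0 <= V by apply: Rintegral_ge0.
exists (2 * a * (M * n%:R) * V).
  by rewrite !mulr_ge0 // ltW.
move=> b /andP[ab b2].
have mA := @measurable_annulus R n a b.
have iF : lam.-integrable (annulus a b) (EFin \o F) by exact: continuous_integrable_annulus.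
have iR : lam.-integrable (annulus a b) (EFin \o radial F a).
  by apply: radial_integrable => //; exact: annulus_finite.
have i1 : lam.-integrable (annulus a b) (EFin \o (fun=> 1 : R)).
  by apply: continuous_integrable_annulus; exact: cst_continuous.
rewrite -mulrA -(integral_radial_annulus cF a0 ab).
have -> : \int[lam]_(x in annulus a b) (2 * \sum_i X i x * x 0 i) =
    2 * a * \int[lam]_(x in annulus a b) F x.
  rewrite -RintegralZl //; apply: eq_Rintegral => x _.
  by rewrite /F -mulrA mulVKf // gt_eqF.
rewrite -mulrBr -RintegralB // normrM ger0_norm; last by rewrite mulr_ge0 // ltW.
have -> : 2 * a * (M * n%:R) * V * (b - a) * (b ^+ n - a ^+ n) =
    2 * a * (M * n%:R * (b - a) * ((b ^+ n - a ^+ n) * V)) by ring.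
apply: ler_wpM2l; first by rewrite mulr_ge0 // ltW.
have -> : (b ^+ n - a ^+ n) * V = \int[lam]_(x in annulus a b) (1 : R).
  have := @integral_radial_annulus R n (fun=> 1) a (@cst_continuous _ _ _) a0 b ab.
  by rewrite /radial => ->.
rewrite -RintegralZl //.
have iB : lam.-integrable (annulus a b) (EFin \o (fun x => F x - radial F a x)).
  by have := integrableB mA iF iR; exact: eq_integrable.
apply: (le_trans (le_normr_Rintegral mA iB)); apply: le_Rintegral => //.
- by apply: (integrable_norm iB).
- by apply: (integrableZl mA (M * n%:R * (b - a)) i1).
move=> x [xb /negP]; rewrite /eball /= -ltNge => xa; rewrite mulr1.
have x0 := lt_trans a0 xa.
have := LF x (a *: normalize x).
have bx : box 0 (a + a) x by apply: eball_sub_box; exact: le_trans xb (ltW b2).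
have by_ : box 0 (a + a) (a *: normalize x).
  apply: eball_sub_box; rewrite /eball /= enormZ enorm_normalize // mulr1 gtr0_norm //.
  by rewrite lerDl ltW.
move=> /(_ bx by_) /le_trans; apply; rewrite -mulrA; apply: ler_wpM2l => //.
rewrite mulr_natl -[X in _ *+ X](card_ord n) -sumr_const; apply: ler_sum => i _.
apply: (le_trans (radial_defect a0 xa i)); rewrite lerD2r.
exact: xb.
Qed.

(** Divided by [b^2 - a^2], the shell integral tends to the flux as [b] decreases to [a], while
    [annulus_mean_bounds] keeps it between the integrals over the balls. *)
Lemma flux_bounds a : 0 < a -> ball_integral a <= flux a /\
  forall b, a < b -> flux a <= ball_integral b.
Proof.
move=> a0; rewrite flux_radial //; set c := \int[lam]_(x in P) _.
have [C C0 H] := annulus_radial_approx a0; rewrite -/c in H.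
pose Q := power_quotient n a.
have cQ : {for a, continuous Q} by exact: continuous_power_quotient.
have cPhi (e : R) : {for a, continuous (fun b => (2 * a * c + e * (b - a)) * Q b)}.
  apply: continuousM cQ; apply: continuousD; first exact: cst_continuous.
  apply: continuousM; first exact: cst_continuous.
  by apply: continuousB; [exact: cvg_id|exact: cst_continuous].
have Phia e : (2 * a * c + e * (a - a)) * Q a = a ^+ n.-1 * (n%:R * c).
  transitivity (Q a * (2 * a) * c); first by ring.
  by rewrite power_quotient_diag //; ring.
split.
  rewrite -(Phia C); apply: (continuous_ge_right a0 (cPhi C)) => b ab.
  have /andP[ab1 _] := ab.
  have d2 : 0 < b ^+ 2 - a ^+ 2 by rewrite subr_gt0 ltr_pXn2r ?nnegrE ?ltW // (lt_trans a0).
  have /andP[lo _] := annulus_mean_bounds a0 ab1.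
  have := H b ab; rewrite ler_norml => /andP[_ up].
  rewrite -(ler_pM2l d2); apply: (le_trans lo).
  move: up; rewrite (power_quotientE n a0 ab1) -/Q lerBlDl => /le_trans; apply.
  by rewrite le_eqVlt; apply/orP; left; apply/eqP; ring.
move=> b0 ab0; rewrite -(Phia (- C)).
have d0 : 0 < Num.min a (b0 - a) by rewrite lt_min a0 subr_gt0.
apply: (continuous_le_right d0 (cPhi (- C))) => b /andP[ab1 bd].
have [ba bb0] : b < a + a /\ b < b0.
  by move: bd; rewrite -ltrBlDl lt_min => /andP[h1 h2]; split; lra.
have d2 : 0 < b ^+ 2 - a ^+ 2 by rewrite subr_gt0 ltr_pXn2r ?nnegrE ?ltW // (lt_trans a0).
apply: le_trans (ball_integral_le (ltW bb0)).
have /andP[_ hi] := annulus_mean_bounds a0 ab1.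
have ab : a < b < a + a by rewrite ab1.
have := H b ab; rewrite ler_norml => /andP[lo _].
rewrite -(ler_pM2l d2); apply: le_trans hi.
move: lo; rewrite (power_quotientE n a0 ab1) -/Q lerBrDr => /(le_trans _); apply.
by rewrite le_eqVlt; apply/orP; left; apply/eqP; ring.
Qed.

End flux.

(** * Pointwise decay estimates *)

Section psi_bound.
Context (R : realFieldType) (n : nat).
Implicit Types (W : 'M[R]_n) (S T : seq 'I_n).

Lemma kron_bound S T : `|kron R S T| <= (size S)`!%:R.
Proof.
rewrite /kron /kron_det /determinant.
apply: (le_trans (ler_norm_sum _ _ _)).
rewrite -card_Sn -sum1_card natr_sum; apply: ler_sum => s _.
rewrite normrM normr_sign mul1r normr_prod.
apply: (le_trans (y := \prod_(i < size S) (1 : R))); last by rewrite big1_eq.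
apply: ler_prod => i _; rewrite normr_ge0 mxE.
by rewrite normr_nat lern1 leq_b1.
Qed.

Lemma psi_bound k m : exists2 K : R, 0 <= K & forall W M S T, size S = m ->
  (forall i j, `|W i j| <= M) -> `|psi W k S T| <= K * M ^+ k.
Proof.
elim: k m => [|k IH] m.
  exists m`!%:R => // W M S T <- _; rewrite expr0 mulr1; exact: kron_bound.
have [K K0 HK] := IH m.+1.
exists (n%:R * (n%:R * K)); first by rewrite !mulr_ge0.
move=> W M S T sS WM; rewrite psiS.
apply: (le_trans (ler_norm_sum _ _ _)).
apply: (le_trans (y := \sum_(i < n) (n%:R * K) * M ^+ k.+1)); last first.
  by rewrite sumr_const card_ord -[X in X <= _]mulr_natl mulrA.
apply: ler_sum => i _; apply: (le_trans (ler_norm_sum _ _ _)).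
apply: (le_trans (y := \sum_(i < n) K * M ^+ k.+1)); last first.
  by rewrite sumr_const card_ord -[X in X <= _]mulr_natl mulrA.
apply: ler_sum => j _; rewrite normrM exprS [K * _]mulrCA.
have sS1 : size (i :: S) = m.+1 by rewrite /= sS.
exact: ler_pM (normr_ge0 _) (normr_ge0 _) (WM i j) (HK W M _ _ sS1 WM).
Qed.

Lemma norm_sum_le (F : 'I_n -> R) M : (forall i, `|F i| <= M) -> `|\sum_i F i| <= n%:R * M.
Proof.
move=> FM; apply: (le_trans (ler_norm_sum _ _ _)).
rewrite mulr_natl -[X in _ *+ X](card_ord n) -sumr_const.
by apply: ler_sum => i _; exact: FM.
Qed.

Lemma sigma_bound b : exists2 K : R, 0 <= K & forall W M,
  (forall i j, `|W i j| <= M) -> `|sigma W b| <= K * M ^+ b.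
Proof.
have [K K0 HK] := psi_bound b 0; exists (K / b`!%:R); first by rewrite divr_ge0.
move=> W M WM; rewrite /sigma normrM normfV [`|b`!%:R|]ger0_norm // mulrAC.
by apply: ler_wpM2r; [rewrite invr_ge0|exact: HK].
Qed.

Lemma newton_bound b : exists2 K : R, 0 <= K & forall W M i j,
  (forall i j, `|W i j| <= M) -> `|newton W b i j| <= K * M ^+ b.
Proof.
have [K K0 HK] := psi_bound b 1; exists (K / b`!%:R); first by rewrite divr_ge0.
move=> W M i j WM; rewrite mxE normrM normfV [`|b`!%:R|]ger0_norm // mulrAC.
by apply: ler_wpM2r; [rewrite invr_ge0|exact: HK].
Qed.

End psi_bound.

Section decay.
Context (R : realType) (n : nat) (u : 'rV[R]_n -> R).
Implicit Types (x : 'rV[R]_n) (r t A : R).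

(** The decay hypotheses at [x], with [t] standing for [r^(-tau)] and [r] for [|x|]. *)
Definition decays_at A r t x : Prop := [/\ `|u x| <= A * t,
  forall i, `|partial i u x| <= A * (t / r) &
  forall i j, `|partial i (partial j u) x| <= A * (t / r ^+ 2)].

Context (A : R).
Hypothesis A0 : 0 <= A.

Lemma gradsq_decay r t x : decays_at A r t x -> gradsq u x <= n%:R * (A * (t / r)) ^+ 2.
Proof.
move=> [_ du _]; apply: (le_trans (ler_norm _)); apply: norm_sum_le => i.
by rewrite normrX lerXn2r ?nnegrE ?normr_ge0 ?(le_trans _ (du i)).
Qed.

Lemma gradsq_ge0 x : 0 <= gradsq u x.
Proof. by apply: sumr_ge0 => i _; exact: sqr_ge0. Qed.

Lemma sq_decay r t : 1 <= r -> 0 <= t <= 1 -> (t / r) ^+ 2 <= t / r ^+ 2.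
Proof.
move=> r1 /andP[t0 t1]; rewrite expr_div_n; apply: ler_wpM2r.
  by rewrite invr_ge0 exprn_ge0 // (le_trans _ r1).
by rewrite expr2 ler_piMl.
Qed.

Lemma schouten_decay r t x i j : 1 <= r -> 0 <= t <= 1 -> decays_at A r t x ->
  `|schouten u x i j| <= (A + A ^+ 2 + n%:R * A ^+ 2) * (t / r ^+ 2).
Proof.
move=> r1 t01 dx; have [_ du ddu] := dx.
have sq := sq_decay r1 t01.
have A2 : 0 <= A ^+ 2 by rewrite exprn_ge0.
rewrite schoutenE mulrDl mulrDl; apply: (le_trans (ler_normB _ _)); apply: lerD.
  apply: (le_trans (ler_normD _ _)); apply: lerD => //.
  apply: (le_trans (y := (A * (t / r)) ^+ 2)); last by rewrite exprMn ler_wpM2l.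
  by rewrite normrM expr2; apply: ler_pM.
apply: (le_trans (y := gradsq u x)).
  have q0 := gradsq_ge0 x.
  rewrite normrM ger0_norm ?divr_ge0 //; case: (i == j); rewrite ?normr1 ?normr0 ?mulr0 ?mulr1 //.
  by rewrite ler_pdivrMr // ler_peMr // ler1n.
apply: (le_trans (gradsq_decay dx)); rewrite exprMn [n%:R * (_ * _)]mulrA.
by apply: ler_wpM2l => //; rewrite mulr_ge0.
Qed.

(** With [eps = t / r^2] the Schouten tensor is O(eps) and the gradient O(eps r), so a
    product of [k] curvature-like factors is O(eps^k) up to gains of [t = eps r^2]. *)
Lemma newton_grad_decay b : exists2 K, 0 <= K & forall r t x i,
  1 <= r -> 0 <= t <= 1 -> decays_at A r t x ->
  `|newton_grad u b i x| <= K * ((t / r ^+ 2) ^+ b.+1 * r).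
Proof.
have [K K0 HK] := newton_bound R n b.
pose B := A + A ^+ 2 + n%:R * A ^+ 2.
have B0 : 0 <= B by rewrite !addr_ge0 ?mulr_ge0 ?exprn_ge0.
exists (n%:R * (K * B ^+ b * A)); first by rewrite !mulr_ge0 ?exprn_ge0.
move=> r t x i r1 t01 dx; have r0 : 0 < r by rewrite (lt_le_trans _ r1).
rewrite newton_gradE -[X in _ <= X]mulrA; apply: norm_sum_le => j; rewrite normrM.
have [_ du _] := dx.
have -> : K * B ^+ b * A * ((t / r ^+ 2) ^+ b.+1 * r) =
    (K * (B * (t / r ^+ 2)) ^+ b) * (A * (t / r)).
  have -> : t / r = t / r ^+ 2 * r by field; rewrite gt_eqF.
  move: (t / r ^+ 2) => e.
  by rewrite exprMn exprS; move: (e ^+ b) (B ^+ b) => *; ring.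
apply: ler_pM => //; apply: HK => a c; exact: schouten_decay.
Qed.

(** Each factor [gradsq] is [O(eps t)], one power of [t] better than a curvature. *)
Lemma gradsq_term_decay a b : exists2 K, 0 <= K & forall r t x,
  1 <= r -> 0 <= t <= 1 -> decays_at A r t x ->
  `|gradsq u x ^+ a.+1 * sigma (schouten u x) b| <= K * ((t / r ^+ 2) ^+ (a + b).+1 * t).
Proof.
have [K K0 HK] := sigma_bound R n b.
pose B := A + A ^+ 2 + n%:R * A ^+ 2.
have B0 : 0 <= B by rewrite !addr_ge0 ?mulr_ge0 ?exprn_ge0.
exists ((n%:R * A ^+ 2) ^+ a.+1 * (K * B ^+ b)); first by rewrite !mulr_ge0 ?exprn_ge0 ?mulr_ge0 ?exprn_ge0.
move=> r t x r1 t01 dx; have r0 : 0 < r by rewrite (lt_le_trans _ r1).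
have /andP[t0 t1] := t01.
have e0 : 0 <= t / r ^+ 2 by rewrite divr_ge0 // exprn_ge0 // ltW.
have qE : n%:R * (A * (t / r)) ^+ 2 = n%:R * A ^+ 2 * (t / r ^+ 2 * t).
  by rewrite exprMn expr_div_n; field; rewrite gt_eqF.
rewrite normrM normrX (ger0_norm (gradsq_ge0 x)).
apply: (le_trans (y := (n%:R * A ^+ 2 * (t / r ^+ 2 * t)) ^+ a.+1 * (K * (B * (t / r ^+ 2)) ^+ b))).
  apply: ler_pM; rewrite ?exprn_ge0 ?gradsq_ge0 //.
    rewrite -qE lerXn2r ?nnegrE ?gradsq_ge0 //; last exact: gradsq_decay.
    by rewrite mulr_ge0 // exprn_ge0 // mulr_ge0 // divr_ge0 // ltW.
  by apply: HK => i j; exact: schouten_decay.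
have -> : (n%:R * A ^+ 2 * (t / r ^+ 2 * t)) ^+ a.+1 * (K * (B * (t / r ^+ 2)) ^+ b) =
   (n%:R * A ^+ 2) ^+ a.+1 * (K * B ^+ b) * ((t / r ^+ 2) ^+ (a + b).+1 * t ^+ a.+1).
  move: (t / r ^+ 2) (n%:R * A ^+ 2) => e c; rewrite !exprMn -addSn exprD.
  by move: (e ^+ a.+1) (e ^+ b) (c ^+ a.+1) (t ^+ a.+1) (B ^+ b) => *; ring.
apply: ler_wpM2l; first by rewrite !mulr_ge0 ?exprn_ge0 ?mulr_ge0 ?exprn_ge0.
apply: ler_wpM2l; first by rewrite exprn_ge0.
by rewrite exprS ler_piMr // exprn_ile1.
Qed.

Lemma mass_term_decay a b : exists2 K, 0 <= K & forall r t x i,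
  1 <= r -> 0 <= t <= 1 -> decays_at A r t x ->
  `|mass_term u a.+1 b i x| <= K * ((t / r ^+ 2) ^+ (a.+1 + b).+1 * t * r).
Proof.
have [K K0 HK] := newton_grad_decay b.
exists ((n%:R * A ^+ 2) ^+ a.+1 * K); first by rewrite !mulr_ge0 ?exprn_ge0 ?mulr_ge0 ?exprn_ge0.
move=> r t x i r1 t01 dx; have r0 : 0 < r by rewrite (lt_le_trans _ r1).
have /andP[t0 t1] := t01.
have e0 : 0 <= t / r ^+ 2 by rewrite divr_ge0 // exprn_ge0 // ltW.
have qE : n%:R * (A * (t / r)) ^+ 2 = n%:R * A ^+ 2 * (t / r ^+ 2 * t).
  by rewrite exprMn expr_div_n; field; rewrite gt_eqF.
rewrite /mass_term normrM normrX (ger0_norm (gradsq_ge0 x)).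
apply: (le_trans (y := (n%:R * A ^+ 2 * (t / r ^+ 2 * t)) ^+ a.+1 * (K * ((t / r ^+ 2) ^+ b.+1 * r)))).
  apply: ler_pM; rewrite ?exprn_ge0 ?gradsq_ge0 //; last exact: HK.
  rewrite -qE lerXn2r ?nnegrE ?gradsq_ge0 //; last exact: gradsq_decay.
  by rewrite mulr_ge0 // exprn_ge0 // mulr_ge0 // divr_ge0 // ltW.
have -> : (n%:R * A ^+ 2 * (t / r ^+ 2 * t)) ^+ a.+1 * (K * ((t / r ^+ 2) ^+ b.+1 * r)) =
   (n%:R * A ^+ 2) ^+ a.+1 * K * ((t / r ^+ 2) ^+ (a.+1 + b).+1 * t ^+ a.+1 * r).
  move: (t / r ^+ 2) (n%:R * A ^+ 2) => e c; rewrite !exprMn -addnS exprD.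
  by move: (e ^+ a.+1) (e ^+ b.+1) (c ^+ a.+1) (t ^+ a.+1) => *; ring.
apply: ler_wpM2l; first by rewrite !mulr_ge0 ?exprn_ge0 ?mulr_ge0 ?exprn_ge0.
apply: ler_wpM2r; first exact: ltW.
apply: ler_wpM2l; first by rewrite exprn_ge0.
by rewrite exprS ler_piMr // exprn_ile1.
Qed.

Lemma expR_sub1_bound (y : R) : `|expR y - 1| <= expR `|y| * `|y|.
Proof.
have e1 (z : R) : 1 + z <= expR z := expR_ge1Dx z.
have [y0|y0] := leP 0 y.
  rewrite (ger0_norm y0) ger0_norm; last by rewrite subr_ge0 -expR0 ler_expR.
  have := e1 (- y); rewrite expRN => h.
  have E0 := expR_gt0 y.
  rewrite -(ler_pM2r (x := (expR y)^-1)) ?invr_gt0 //.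
  rewrite mulrBl mulfV ?gt_eqF // mul1r mulrAC mulfV ?gt_eqF // mul1r; lra.
rewrite (ltr0_norm y0) ler0_norm; last by rewrite subr_le0 -expR0 ler_expR ltW.
apply: (le_trans (y := - y)); first by have := e1 y; lra.
by rewrite ler_peMl ?oppr_ge0 ?(ltW y0) // -expR0 ler_expR oppr_ge0 ltW.
Qed.

Lemma conformal_factor_decay k : exists2 K, 0 <= K & forall r t x,
  0 <= t <= 1 -> decays_at A r t x -> `|expR (2 * u x) ^+ k - 1| <= K * t.
Proof.
exists (expR (k%:R * (2 * A)) * (k%:R * (2 * A))); first by rewrite !mulr_ge0 ?expR_ge0.
move=> r t x /andP[t0 t1] [ux _ _].
rewrite -expRM_natl; apply: (le_trans (expR_sub1_bound _)).
have h : `|k%:R * (2 * u x)| <= k%:R * (2 * A) * t.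
  by rewrite !normrM !normr_nat -!mulrA; do 2 apply: ler_wpM2l => //.
rewrite -mulrA; apply: ler_pM; rewrite ?expR_ge0 //.
rewrite ler_expR; apply: (le_trans h); rewrite ler_piMr // !mulr_ge0 //.
Qed.

End decay.

Section decay_sums.
Context (R : realType) (n : nat) (u : 'rV[R]_n -> R) (A : R).
Hypothesis A0 : 0 <= A.

Lemma sum_decay (m : nat) (F : nat -> R -> R -> 'rV[R]_n -> R) (eta : R -> R -> R)
    (good : R -> R -> 'rV[R]_n -> Prop) :
  (forall a, (a < m)%N -> exists2 K : R, 0 <= K &
     forall r t x, good r t x -> `|F a r t x| <= K * eta r t) ->
  exists2 K : R, 0 <= K &
     forall r t x, good r t x -> `|\sum_(a < m) F a r t x| <= K * eta r t.
Proof.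
elim: m => [|m IH] H.
  by exists 0 => // r t x _; rewrite big_ord0 normr0 mul0r.
have [K1 K10 H1] := IH (fun a am => H a (ltnW am)).
have [K2 K20 H2] := H m (ltnSn m).
exists (K1 + K2); first exact: addr_ge0.
move=> r t x g; rewrite big_ord_recr /= mulrDl.
by apply: (le_trans (ler_normD _ _)); apply: lerD; [exact: H1|exact: H2].
Qed.

Definition in_decay_regime r t x := [/\ 1 <= r, 0 <= t <= 1 & decays_at u A r t x].

(** The leading terms differ by the conformal factor, which is [1 + O(t)]. *)
Lemma mass_field_decay k i : (0 < k)%N -> exists2 K : R, 0 <= K &
  forall r t x, in_decay_regime r t x ->
  `|expR (2 * u x) ^+ k * newton_grad u k.-1 i x - mass_field u k i x| <=
     K * ((t / r ^+ 2) ^+ k * t * r).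
Proof.
case: k => // k _.
have [K1 K10 H1] := conformal_factor_decay u A0 k.+1.
have [K2 K20 H2] := newton_grad_decay u A0 k.
have [a ak|K3 K30 H3] := @sum_decay k
  (fun a r t x => mass_weight R n k.+1 a.+1 * mass_term u a.+1 (k - a.+1) i x)
  (fun r t => (t / r ^+ 2) ^+ k.+1 * t * r) in_decay_regime.
  have [K K0 HK] := mass_term_decay u A0 a (k - a.+1).
  exists (`|mass_weight R n k.+1 a.+1| * K); first by rewrite mulr_ge0.
  move=> r t x [r1 t1 d]; rewrite normrM -[X in _ <= X]mulrA ler_wpM2l //.
  have := HK r t x i r1 t1 d.
  by rewrite (_ : (a.+1 + (k - a.+1)).+1 = k.+1)%N //; lia.
exists (K1 * K2 + K3); first by rewrite addr_ge0 ?mulr_ge0.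
move=> r t x g; have [r1 t1 d] := g.
have -> : mass_field u k.+1 i x = newton_grad u k i x +
    \sum_(a < k) mass_weight R n k.+1 a.+1 * mass_term u a.+1 (k - a.+1) i x.
  by rewrite /mass_field big_ord_recl /= mul1r /mass_term expr0 mul1r subn0.
have E (e g1 S : R) : e * g1 - (g1 + S) = (e - 1) * g1 - S by ring.
rewrite {}E [X in _ <= X]mulrDl.
apply: (le_trans (ler_normB _ _)); apply: lerD; last exact: H3.
rewrite normrM.
have -> : K1 * K2 * ((t / r ^+ 2) ^+ k.+1 * t * r) =
  (K1 * t) * (K2 * ((t / r ^+ 2) ^+ k.+1 * r)) by ring.
exact: ler_pM (normr_ge0 _) (normr_ge0 _) (H1 r t x t1 d) (H2 r t x i r1 t1 d).
Qed.

Definition density_rest k (x : 'rV[R]_n) : R :=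
  \sum_(a < k) mass_weight R n k a * (k%:R * (n%:R - k.*2%:R)) / (2 * a.+1%:R)
     * (gradsq u x ^+ a.+1 * sigma (schouten u x) (k.-1 - a)).

Lemma density_rest_decay k : (0 < k)%N -> exists2 K : R, 0 <= K &
  forall r t x, in_decay_regime r t x ->
  `|density_rest k x| <= K * ((t / r ^+ 2) ^+ k * t).
Proof.
move=> k0; apply: (@sum_decay k (fun a r t x =>
   mass_weight R n k a * (k%:R * (n%:R - k.*2%:R)) / (2 * a.+1%:R)
     * (gradsq u x ^+ a.+1 * sigma (schouten u x) (k.-1 - a)))
  (fun r t => (t / r ^+ 2) ^+ k * t) in_decay_regime) => a ak.
have [K K0 HK] := gradsq_term_decay u A0 a (k.-1 - a).
set c := _ / _; exists (`|c| * K); first by rewrite mulr_ge0.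
move=> r t x [r1 t1 d]; rewrite normrM -[X in _ <= X]mulrA ler_wpM2l //.
have := HK r t x r1 t1 d.
by rewrite (_ : (a + (k.-1 - a)).+1 = k)%N //; lia.
Qed.

End decay_sums.

Section powers.
Context (R : realType).

Lemma powRN_small (delta eps : R) : 0 < delta -> 0 < eps ->
  exists2 r0 : R, 0 < r0 & forall r, r0 <= r -> r `^ (- delta) < eps.
Proof.
move=> d0 e0; pose y := eps^-1 + 1.
have y0 : 0 < y by rewrite addr_gt0 // invr_gt0.
exists (y `^ delta^-1); first exact: powR_gt0.
move=> r yr; have r0 : 0 < r by apply: lt_le_trans yr; exact: powR_gt0.
have h : y <= r `^ delta.
  have E : (y `^ delta^-1) `^ delta = y.
    by rewrite -powRrM mulVf ?gt_eqF // powRr1 // ltW.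
  rewrite -[X in X <= _]E; apply: (ge0_ler_powR (ltW d0) _ _ yr).
    by rewrite nnegrE powR_ge0.
  by rewrite nnegrE ltW.
rewrite powRN invf_plt ?posrE ?powR_gt0 //.
by apply: lt_le_trans h; rewrite ltrDl.
Qed.

(** With [r^n] for the volume, the error terms decay exactly when
    [tau > (n - 2k) / (k + 1)]. *)
Lemma decay_exponent (r tau : R) k n : 0 < r ->
  (r `^ (- tau) / r ^+ 2) ^+ k * r `^ (- tau) * r ^+ n =
  r `^ (- (tau * k.+1%:R - (n%:R - k.*2%:R))).
Proof.
move=> r0; have rn0 : r != 0 by rewrite gt_eqF.
have -> : - (tau * k.+1%:R - (n%:R - k.*2%:R)) = - tau * k.+1%:R + n%:R + - (k.*2%:R) by ring.
have E1 : r `^ (- tau * k.+1%:R) = (r `^ (- tau)) ^+ k.+1.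
  by rewrite powRrM powR_mulrn // powR_ge0.
have E2 : r `^ n%:R = r ^+ n by rewrite powR_mulrn // ltW.
have E3 : r `^ (- k.*2%:R) = (r ^+ k.*2)^-1 by rewrite powRN powR_mulrn // ltW.
rewrite !powRD ?rn0 ?implybT // E1 E2 E3 expr_div_n -exprM mul2n exprSr.
by rewrite -!mulrA; congr (_ * _); rewrite mulrC -mulrA.
Qed.

End powers.

(** * Comparison of fluxes and dyadic summation *)

Section flux_linearity.
Context (R : realType) (n : nat).
Implicit Types (X Y : 'I_n -> 'rV[R]_n -> R) (x : 'rV[R]_n).
Local Notation lam := (lebesgue_rV R n).
Local Notation P := (@punctured_ball R n).

Let mP : measurable P := @measurable_punctured_ball R n.
Let fP : (lam P < +oo)%E := punctured_finite n 1.

Lemma continuous_radial_part X r : (forall i, C1 (X i)) ->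
  continuous (fun x => r^-1 * \sum_i X i x * x 0 i).
Proof.
by move=> cX; exact: continuous_mul (@cst_continuous _ _ _) (C1_continuous (C1_radial_part cX)).
Qed.

Lemma flux_scale X c r : (forall i, C1 (X i)) -> 0 < r ->
  flux (fun i x => c * X i x) r = c * flux X r.
Proof.
move=> cX r0; have ccX i : C1 (fun x => c * X i x) := C1Z c (cX i).
rewrite !flux_radial // [RHS]mulrCA; congr (_ * _); rewrite [RHS]mulrCA; congr (_ * _).
rewrite -RintegralZl //; last by apply: radial_integrable => //; exact: continuous_radial_part.
apply: eq_Rintegral => x _; rewrite /radial [RHS]mulrCA; congr (_ * _).
by rewrite mulr_sumr; apply: eq_bigr => i _; rewrite mulrA.
Qed.

Lemma flux_dist X Y r kappa : (forall i, C1 (X i)) -> (forall i, C1 (Y i)) -> 0 < r -> 0 <= kappa ->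
  (forall i x, enorm x = r -> `|X i x - Y i x| <= kappa) ->
  `|flux X r - flux Y r| <= r ^+ n.-1 * kappa * (n%:R * n%:R * fine (lam P)).
Proof.
move=> cX cY r0 k0 XY; rewrite !flux_radial // -mulrBr -mulrBr.
set f := radial (fun x => r^-1 * \sum_i X i x * x 0 i) r.
set g := radial (fun x => r^-1 * \sum_i Y i x * x 0 i) r.
have iX : lam.-integrable P (EFin \o f).
  by apply: radial_integrable => //; exact: continuous_radial_part.
have iY : lam.-integrable P (EFin \o g).
  by apply: radial_integrable => //; exact: continuous_radial_part.
rewrite -RintegralB // normrM [`|r ^+ _|]ger0_norm ?exprn_ge0 ?(ltW r0) // -!mulrA.
apply: ler_wpM2l; first by rewrite exprn_ge0 // ltW.
rewrite normrM normr_nat mulrCA; apply: ler_wpM2l => //.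
have iB : lam.-integrable P (EFin \o (fun x => f x - g x)).
  by have := integrableB mP iX iY; exact: eq_integrable.
apply: (le_trans (le_normr_Rintegral mP iB)).
rewrite mulrA [kappa * _]mulrC -Rintegral_cst //.
apply: le_Rintegral => //.
- exact: (integrable_norm iB).
- apply: (@bounded_support_integrable _ _ _ _ (n%:R * kappa)) => //.
  by move=> x _; rewrite ger0_norm // mulr_ge0.
move=> x /andP[x0 x1]; rewrite /f /g /radial.
set y := r *: normalize x.
have yr : enorm y = r by rewrite enormZ enorm_normalize // mulr1 gtr0_norm.
rewrite -mulrBr -sumrB normrM normfV (gtr0_norm r0) [r^-1 * _]mulrC ler_pdivrMr // -[X in _ <= X]mulrA.
apply: norm_sum_le => i; rewrite -mulrBl normrM; apply: ler_pM => //; first exact: XY.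
by rewrite -[X in _ <= X]yr; exact: coord_le_enorm.
Qed.

End flux_linearity.

Section dyadic.
Context (R : realType) (n : nat).
Local Notation lam := (lebesgue_rV R n).
Implicit Types (f : 'rV[R]_n -> R).

Lemma Rintegral_annulus_le f (b M : R) : 0 < b -> 0 <= M -> continuous f ->
  (forall x, b < enorm x -> f x <= M) ->
  \int[lam]_(x in annulus b (b + b)) f x <= M * (4 * b) ^+ n.
Proof.
move=> b0 M0 cf fM.
have bb : 0 <= b + b by rewrite addr_ge0 // ltW.
have mA := @measurable_annulus R n b (b + b).
apply: (le_trans (y := \int[lam]_(x in annulus b (b + b)) M)).
  apply: le_Rintegral => //.
  - exact: continuous_integrable_annulus.
  - by apply: (@continuous_integrable_annulus _ _ (fun=> M)); exact: cst_continuous.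
  - by move=> x [_ /negP]; rewrite /eball /= -ltNge => /fM.
rewrite Rintegral_cst //; apply: ler_wpM2l => //.
rewrite -lee_fin fineK; last by rewrite ge0_fin_numE ?measure_ge0 //; exact: annulus_finite.
have -> : ((4 * b) ^+ n)%:E = lam (box 0 (b + b)).
  by rewrite lebesgue_box //; congr (_ ^+ _)%:E; ring.
apply: le_measure; rewrite ?inE //; first exact: measurable_box.
by move=> x [xb _]; exact: eball_sub_box.
Qed.

(** Dyadic summation: decay faster than [|x|^(-n)] bounds the integrals over balls. *)
Lemma ball_integral_bounded f (K delta r1 : R) : 0 < r1 -> 0 < delta -> 0 <= K ->
  continuous f -> (forall x, 0 <= f x) ->
  (forall b x, r1 <= b -> b < enorm x -> f x <= K * b `^ (- delta) / b ^+ n) ->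
  exists B : R, forall r, \int[lam]_(x in eball r) f x <= B.
Proof.
move=> r10 d0 K0 cf f0 fK.
pose I r := \int[lam]_(x in eball r) f x.
have Imono a b : a <= b -> I a <= I b.
  by move=> ab; rewrite /I (Rintegral_eball_split ab cf) lerDl; exact: Rintegral_ge0.
pose theta : R := 2 `^ (- delta).
have th1 : theta < 1.
  rewrite /theta powRN invf_lt1 ?powR_gt0 //.
  have h : (1 : R) `^ delta < 2 `^ delta.
    by apply: gt0_ltr_powR; rewrite ?nnegrE ?ltr1n.
  by rewrite powR1 in h.
(* [c] is the sum of the geometric series of bounds over the dyadic shells. *)
pose c := K * 4 ^+ n * r1 `^ (- delta) / (1 - theta).
have th : 0 < 1 - theta by rewrite subr_gt0.
have step j : I (r1 * 2 ^+ j.+1) <= I (r1 * 2 ^+ j) + c * (1 - theta) * theta ^+ j.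
  set b := r1 * 2 ^+ j.
  have b0 : 0 < b by rewrite mulr_gt0 // exprn_gt0.
  have rb : r1 <= b by rewrite ler_peMr ?(ltW r10) // exprn_ege1 // ler1n.
  have -> : r1 * 2 ^+ j.+1 = b + b by rewrite /b exprS; ring.
  rewrite /I (@Rintegral_eball_split _ _ f b (b + b)) //; last by rewrite lerDl ltW.
  rewrite lerD2l; apply: (le_trans (@Rintegral_annulus_le f b (K * b `^ (- delta) / b ^+ n) b0 _ cf _)).
  - by rewrite divr_ge0 ?mulr_ge0 ?powR_ge0 // exprn_ge0 // ltW.
  - by move=> x bx; exact: fK.
  have bE : b `^ (- delta) = r1 `^ (- delta) * theta ^+ j.
    have E2 : (2 ^+ j : R) `^ (- delta) = theta ^+ j.
      by rewrite -(@powR_mulrn _ 2 j) // powRAC -/theta powR_mulrn // powR_ge0.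
    by rewrite /b powRM ?(ltW r10) ?exprn_ge0 // E2.
  rewrite bE; clear bE rb; clearbody b.
  rewrite exprMn /c le_eqVlt; apply/orP; left; apply/eqP.
  have bn : b ^+ n != 0 by rewrite expf_neq0 // gt_eqF.
  move: (r1 `^ _) (theta ^+ j) (b ^+ n) bn => p q s s0.
  by field; rewrite s0 gt_eqF.
pose B := I r1 + c.
have bound j : I (r1 * 2 ^+ j) <= B - c * theta ^+ j.
  elim: j => [|j IH]; first by rewrite expr0 !mulr1 /B addrK.
  apply: (le_trans (step j)); rewrite exprS.
  by move: IH; rewrite -lerBrDr => IH; apply: le_trans IH _; rewrite le_eqVlt; apply/orP; left; apply/eqP; ring.
have c0 : 0 <= c by rewrite /c divr_ge0 ?mulr_ge0 ?powR_ge0 ?exprn_ge0 // ltW.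
exists B => r.
have [j rj] : exists j : nat, r <= r1 * 2 ^+ j.
  exists (Num.truncn (r / r1)).+1; rewrite mulrC -ler_pdivrMr //.
  apply: (le_trans (ltW (real_truncnS_gt (num_real (r / r1))))).
  by rewrite -natrX ler_nat ltnW // ltn_expl.
apply: (le_trans (Imono _ _ rj)); apply: (le_trans (bound j)).
by rewrite gerBl mulr_ge0 // exprn_ge0 // powR_ge0.
Qed.

End dyadic.

(** * Limits at infinity *)

Section squeeze.
Context (R : realType).

Lemma monotone_squeeze (E G : R -> R) (B : R) :
  (forall a b, a <= b -> E a <= E b) -> (forall r, E r <= B) ->
  (forall a, 0 < a -> E a <= G a /\ forall b, a < b -> G a <= E b) ->
  G r @[r --> +oo] --> sup (range E).
Proof.
move=> Emono EB EG; set L := sup _.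
have bE : has_sup (range E).
  by split; [exists (E 0), 0|exists B => _ [r _ <-]].
have EL r : E r <= L by apply: ub_le_sup; [case: bE|exists r].
apply/cvgrPdist_le => eps e0.
have [_ [r0 _ <-] h] := sup_adherent e0 bE.
exists (Num.max 0 r0); split; first exact: num_real.
move=> r; rewrite gt_max => /andP[r1 r2].
have [lo /(_ (r + 1))] := EG r r1; rewrite ltrDl ltr01 => /(_ isT) hi.
have h1 := le_trans hi (EL _); have h2 := le_trans (ltW h) (le_trans (Emono _ _ (ltW r2)) lo).
by rewrite ger0_norm ?subr_ge0 // lerBlDr -lerBlDl.
Qed.

Lemma cvg_decaying_diff (F G : R -> R) (K delta r1 L : R) : 0 < delta -> 0 <= K ->
  (forall r, r1 <= r -> `|F r - G r| <= K * r `^ (- delta)) ->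
  G r @[r --> +oo] --> L -> F r @[r --> +oo] --> L.
Proof.
move=> d0 K0 FG GL; apply/cvgrPdist_le => eps e0.
have [r0 r00 h] := powRN_small d0 (divr_gt0 (divr_gt0 e0 (ltr0n _ 2)) (ltr_wpDl K0 ltr01)).
have e2 : 0 < eps / 2 by rewrite divr_gt0.
have [M [_ HM]] : \forall r \near +oo, `|L - G r| <= eps / 2.
  by move: GL => /cvgrPdist_le /(_ _ e2).
exists (Num.max M (Num.max r0 r1)); split; first exact: num_real.
move=> r; rewrite !gt_max => /and3P[rM /ltW rr0 /ltW rr1].
have h1 := HM r rM; have h2 := FG r rr1; have h3 := h r rr0.
have K1 : 0 < K + 1 by rewrite ltr_wpDl.
have h4 : K * r `^ (- delta) <= eps / 2.
  apply: (le_trans (y := (K + 1) * r `^ (- delta))).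
    by rewrite ler_wpM2r ?powR_ge0 // lerDl.
  by rewrite mulrC -ler_pdivlMr // ltW.
have E (a b c : R) : a - b = (a - c) - (b - c) by ring.
rewrite (E _ _ (G r)) (le_trans (ler_normB _ _)) //.
by rewrite [leRHS](splitr eps) lerD // (le_trans h2).
Qed.

End squeeze.

Section positivity.
Context (R : realType) (n : nat).
Local Notation lam := (lebesgue_rV R n).
Implicit Types (f : 'rV[R]_n -> R) (x c : 'rV[R]_n).

Lemma box_sub_eball c rho : exists r, box c rho `<=` eball r.
Proof.
pose d := enorm c + `|rho|.
have d0 : 0 <= d by rewrite addr_ge0 ?enorm_ge0.
have [M M0 HM] := continuous_bounded_box d0 (C1_continuous (C1_normsq R n)).
exists (1 + M) => x xb; apply/eballE; first by rewrite addr_ge0.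
have bx : box 0 d x.
  move=> i; rewrite mxE subr0 -[x 0 i](subrK (c 0 i)) addrC.
  apply: (le_trans (ler_normD _ _)); apply: lerD; first exact: coord_le_enorm.
  by apply: (le_trans (xb i)); exact: ler_norm.
have h := le_trans (ler_norm _) (HM x bx).
apply: (le_trans h); rewrite expr2; move: M0; clear; nra.
Qed.

(** A continuous nonnegative function with vanishing integrals vanishes: it would otherwise
    be bounded below on a small cube, which has positive measure. *)
Lemma continuous_integral_eq0 f : continuous f -> (forall x, 0 <= f x) ->
  (forall r, \int[lam]_(x in eball r) f x <= 0) -> forall x, f x = 0.
Proof.
move=> cf f0 If x; apply/eqP; rewrite eq_le f0 andbT leNgt; apply/negP => fx.
have e2 : 0 < f x / 2 by rewrite divr_gt0.
have : \forall y \near x, `|f x - f y| <= f x / 2.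
  by have := cf x => /cvgrPdist_le /(_ _ e2).
move=> /nbhs_ballP[e /= e0 H].
pose rho := e / 2; have rho0 : 0 < rho by rewrite divr_gt0.
have lo y : box x rho y -> f x / 2 <= f y.
  move=> yb; have : `|f x - f y| <= f x / 2.
    apply: H; split => // i j; rewrite /ball /= ord1 distrC; apply: le_lt_trans (yb j) _.
    by rewrite /rho ltr_pdivrMr // ltr_pMr // ltr1n.
  by rewrite ler_norml; move: (f x) (f y); clear => a b; lra.
have [r br] := box_sub_eball x rho.
have mb := measurable_box x rho.
have mE := @measurable_eball R n r.
have iE := continuous_integrable_eball r cf.
have : 0 < \int[lam]_(y in eball r) f y.
  apply: (@lt_le_trans _ _ (\int[lam]_(y in box x rho) (f x / 2))).
    rewrite Rintegral_cst // [X in fine X](lebesgue_box x (ltW rho0)) /=.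
    by rewrite mulr_gt0 // exprn_gt0 // mulr_gt0.
  apply: (@le_trans _ _ (\int[lam]_(y in box x rho) f y)).
    apply: le_Rintegral => //.
    - apply: (@bounded_support_integrable _ _ _ _ (f x / 2)) => //.
        by rewrite lebesgue_box ?ltry // ltW.
      by move=> y _; rewrite ger0_norm // ltW.
    - exact: integrableS br iE.
  have -> : eball r = box x rho `|` (eball r `\` box x rho) by rewrite setDUK.
  rewrite Rintegral_setU //.
  - by rewrite lerDl; apply: Rintegral_ge0 => y _.
  - exact: measurableD.
  - by rewrite setDUK.
  - by apply/disj_setPS => y [] yb [].
by rewrite ltNge If.
Qed.

End positivity.

Section decay_at_infinity.
Context (R : realType) (n : nat) (u : 'rV[R]_n -> R) (tau : R).
Hypothesis (smooth_u : smooth u) (tau0 : 0 < tau).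

Lemma decay_components (C G H r t v : R) : 1 <= r -> 0 <= t -> 0 <= v -> 0 <= G -> 0 <= H ->
  v + r * G + r ^+ 2 * H <= C * t ->
  [/\ v <= `|C| * t, G <= `|C| * (t / r) & H <= `|C| * (t / r ^+ 2)].
Proof.
move=> r1 t0 v0 G0 H0 h.
have r0 : 0 < r by apply: lt_le_trans r1.
have h' : v + r * G + r ^+ 2 * H <= `|C| * t.
  by apply: (le_trans h); apply: ler_wpM2r => //; exact: ler_norm.
have rG : 0 <= r * G by rewrite mulr_ge0 // ltW.
have rH : 0 <= r ^+ 2 * H by rewrite mulr_ge0 // exprn_ge0 // ltW.
have r2 : 0 < r ^+ 2 by rewrite exprn_gt0.
by split; rewrite ?mulrA ?ler_pdivlMr // 1?[_ * r]mulrC 1?[_ * r ^+ 2]mulrC; lra.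
Qed.

Lemma asymptotic_decay : asymptotically_flat_cf u tau -> exists A r1 : R,
  [/\ 0 <= A, 1 <= r1 & forall x, r1 <= enorm x ->
    in_decay_regime u A (enorm x) (enorm x `^ (- tau)) x].
Proof.
move=> [C [r0 [r00 H]]]; exists `|C|, (Num.max 1 r0); split => //.
  by rewrite le_max lexx.
move=> x; rewrite ge_max => /andP[r1 /H h].
have t0 := powR_ge0 (enorm x) (- tau).
have G0 : 0 <= gradient_norm u x by exact: sqrtr_ge0.
have H0 : 0 <= hessian_norm u x by exact: sqrtr_ge0.
have [hv hG hH] := decay_components r1 t0 (normr_ge0 _) G0 H0 h.
split => //.
  rewrite t0 /= powRN invf_le1 ?powR_gt0 ?(lt_le_trans _ r1) //.
  have := ge0_ler_powR (ltW tau0) _ _ r1; rewrite !nnegrE powR1; apply => //.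
  exact: enorm_ge0.
split => // [i|i j].
  exact: (le_trans (norm_le_sqrt_sum (fun i => partial i u x) i) hG).
exact: (le_trans (norm_le_sqrt_sum2 (fun i j => partial i (partial j u) x) i j) hH).
Qed.

Context (A r1 : R).
Hypothesis (A0 : 0 <= A) (r11 : 1 <= r1).
Hypothesis decay_u : forall x, r1 <= enorm x ->
    in_decay_regime u A (enorm x) (enorm x `^ (- tau)) x.

Lemma bounded_conformal_exponent : exists2 U : R, 0 <= U & forall x, `|u x| <= U.
Proof.
have [M M0 HM] := continuous_bounded_box (le_trans ler01 r11) (C1_continuous (C1_u smooth_u)).
exists (M + A); first exact: addr_ge0.
move=> x; have [xr|/ltW rx] := leP (enorm x) r1.
  by apply: (le_trans (HM x _)); [exact: eball_sub_box|rewrite lerDl].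
have [_ /andP[t0 t1] [h _ _]] := decay_u rx.
by apply: (le_trans h); rewrite (le_trans (ler_piMr A0 t1)) // lerDr.
Qed.

(** Along a coordinate line a function with vanishing gradient is constant, hence equal to
    its limit at infinity. *)
Lemma gradient0_eq0 : (0 < n)%N -> (forall i x, partial i u x = 0) -> forall x, u x = 0.
Proof.
move=> n0 du x; apply/eqP; apply: contraT => ux.
pose i := Ordinal n0.
have A1 : 0 < A + 1 by rewrite ltr_wpDl.
have e0 : 0 < `|u x| / (A + 1) by rewrite divr_gt0 // normr_gt0.
have [r0 r00 small] := powRN_small tau0 e0.
(* Moving by [h] along the [i]-th axis leaves the balls of radii [r0] and [r1]. *)
pose h := `|x 0 i| + r0 + r1.
have h0 : 0 < h by rewrite addr_gt0 ?(lt_le_trans _ r11) // ltr_wpDl.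
have [c _] := mean_value_line i x h0 (C1_u smooth_u).
rewrite du mul0r => /eqP; rewrite subr_eq0 => /eqP uE.
set y := h *: _ + x in uE.
have yh : r0 + r1 <= enorm y.
  apply: le_trans (coord_le_enorm y i); rewrite !mxE !eqxx mulr1.
  apply: le_trans (ler_norm _).
  have -> : h + x 0 i = r0 + r1 + (`|x 0 i| + x 0 i) by rewrite /h; ring.
  by rewrite lerDl -lerBlDr sub0r -normrN ler_norm.
have r10 : 0 <= r1 by apply: le_trans r11.
have yr0 : r0 <= enorm y by rewrite (le_trans _ yh) // lerDl.
have yr1 : r1 <= enorm y by rewrite (le_trans _ yh) // lerDr ltW.
have [_ _ [hu _ _]] := decay_u yr1.
have := small _ yr0; rewrite ltr_pdivlMr // -uE => lt.
have := le_lt_trans hu; move=> /(_ `|u y|).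
suff -> : A * enorm y `^ (- tau) < `|u y| by rewrite ltxx => /(_ isT).
apply: le_lt_trans lt; rewrite mulrC ler_wpM2l ?powR_ge0 // lerDl //.
Qed.

Variable k : nat.
Hypothesis n0 : (0 < n)%N.
Hypothesis k0 : (0 < k)%N.
Let delta := tau * k.+1%:R - (n%:R - k.*2%:R).
Hypothesis delta0 : 0 < delta.

Let conformal_field i x := expR (2 * u x) ^+ k * newton_grad u k.-1 i x.

Lemma C1_conformal_field i : C1 (conformal_field i).
Proof.
apply: (C1M (C1X k (C1_exp (C1Z 2 (C1_u smooth_u)))) (C1_newton_grad smooth_u k.-1 i)).
Qed.

Lemma mass_flux_flux r : 0 < r ->
  mass_flux (cf_metric u) k r = flux_const R n k * flux conformal_field r.
Proof.
move=> r0; rewrite -flux_scale //; last exact: C1_conformal_field.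
rewrite /mass_flux /flux; congr (sphere_integral _ _); apply/funext => x.
rewrite flux_integrandE // mulr_sumr; apply: eq_bigr => i _.
by rewrite /conformal_field !mulrA.
Qed.

(** The integrands differ by [O(r^(1 - 2k - (k+1) tau))] and the sphere has area
    [O(r^(n-1))]. *)
Lemma flux_dist_decay : exists2 K : R, 0 <= K & forall r, r1 <= r ->
  `|flux conformal_field r - flux (mass_field u k) r| <= K * r `^ (- delta).
Proof.
have /choice[Kf HKf] : forall i, exists K : R, 0 <= K /\
    forall r t x, in_decay_regime u A r t x ->
    `|conformal_field i x - mass_field u k i x| <= K * ((t / r ^+ 2) ^+ k * t * r).
  by move=> i; have [K K0 HK] := @mass_field_decay R n u A A0 k i k0; exists K.
have Kf0 i : 0 <= Kf i by case: (HKf i).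
pose K := \sum_i Kf i.
have KK i : Kf i <= K by rewrite /K (bigD1 i) //= lerDl sumr_ge0.
have K0 : 0 <= K by rewrite sumr_ge0.
pose V := fine (lebesgue_rV R n (@punctured_ball R n)).
have V0 : 0 <= V by rewrite fine_ge0.
exists (K * (n%:R * n%:R * V)); first by rewrite !mulr_ge0.
move=> r rr1; have r0 : 0 < r by rewrite (lt_le_trans _ rr1) // (lt_le_trans _ r11).
pose e := (r `^ (- tau) / r ^+ 2) ^+ k * r `^ (- tau).
have e0 : 0 <= e by rewrite mulr_ge0 ?powR_ge0 // exprn_ge0 // divr_ge0 ?powR_ge0 // exprn_ge0 // ltW.
have kap0 : 0 <= K * (e * r) := mulr_ge0 K0 (mulr_ge0 e0 (ltW r0)).
have dist i x : enorm x = r -> `|conformal_field i x - mass_field u k i x| <= K * (e * r).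
  move=> xr; have reg : in_decay_regime u A r (r `^ (- tau)) x.
    by rewrite -xr; apply: decay_u; rewrite xr.
  apply: (le_trans ((HKf i).2 r (r `^ (- tau)) x reg)).
  by apply: ler_wpM2r (KK i); exact: mulr_ge0 e0 (ltW r0).
apply: (le_trans (flux_dist C1_conformal_field (C1_mass_field smooth_u k) r0 kap0 dist)).
rewrite /delta -decay_exponent // -/e -/V le_eqVlt; apply/orP; left; apply/eqP.
have -> : r ^+ n = r ^+ n.-1 * r by rewrite -exprSr prednK.
by ring.
Qed.

End decay_at_infinity.

(** * The mass *)

Section conformal_volume.
Context (R : realType) (n : nat) (u : 'rV[R]_n -> R) (U : R).
Hypothesis bounded_u : forall x, `|u x| <= U.
Local Notation lam := (lebesgue_rV R n).

Lemma volume_density_ge x :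
  Num.sqrt (expR (- 2 * U) ^+ n) <= volume_density (cf_metric u) x.
Proof.
rewrite /volume_density /cf_metric det_scalar ler_wsqrtr // lerXn2r ?nnegrE ?expR_ge0 //.
rewrite ler_expR !mulNr lerN2 ler_pM2l //.
exact: le_trans (ler_norm _) (bounded_u x).
Qed.

Lemma conformal_weight_ge k x : expR (- 2 * U) ^+ k <= expR (2 * u x) ^+ k.
Proof.
rewrite lerXn2r ?nnegrE ?expR_ge0 // ler_expR mulNr -mulrN ler_pM2l //.
exact: lerNnormlW.
Qed.

Lemma sigma_le_curvature (b e w v v0 s c : R) : 0 < b -> 0 < w -> w <= e -> 0 < v0 -> v0 <= v ->
  0 <= s -> 0 <= c -> c * s <= c / (b * w * v0) * `|b * e * s * v|.
Proof.
move=> b0 w0 we v00 vv s0 c0.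
have e0 : 0 <= e := le_trans (ltW w0) we.
have v1 : 0 <= v := le_trans (ltW v00) vv.
rewrite ger0_norm; last by rewrite !mulr_ge0 // ltW.
rewrite -[X in _ <= X]mulrA ler_wpM2l //.
rewrite mulrC ler_pdivlMr ?mulr_gt0 //.
have -> : s * (b * w * v0) = (b * s) * (w * v0) by ring.
have -> : b * e * s * v = (b * s) * (e * v) by ring.
apply: ler_wpM2l; first by rewrite mulr_ge0 // ltW.
by apply: ler_pM => //; exact: ltW.
Qed.

Lemma Rintegral_eball_le_setT f r : lam.-integrable setT (EFin \o f) -> (forall x, 0 <= f x) ->
  \int[lam]_(x in eball r) f x <= \int[lam]_x f x.
Proof.
move=> fi f0; have mE := @measurable_eball R n r.
rewrite -(setUv (eball r)) Rintegral_setU //.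
- by rewrite lerDl; apply: Rintegral_ge0.
- exact: measurableC.
- by rewrite setUv.
- by apply/disj_setPS => x [].
Qed.

End conformal_volume.

Section conformally_flat_mass.
Context (R : realType) (n k : nat) (u : 'rV[R]_n -> R) (tau : R).
Hypothesis (k0 : (0 < k)%N) (kn : (k.*2 < n)%N) (smooth_u : smooth u).
Hypothesis tau_gt : (n%:R - k.*2%:R) / k.+1%:R < tau.
Hypothesis af_u : asymptotically_flat_cf u tau.
Hypothesis Lk_int : dvol_integrable (cf_metric u) (gauss_bonnet_curv (cf_metric u) k).
Hypothesis L_ge0 : forall j, (1 <= j <= k)%N -> forall x, 0 <= gauss_bonnet_curv (cf_metric u) j x.
Local Notation lam := (lebesgue_rV R n).
Local Notation X := (mass_field u k).

Let n0 : (0 < n)%N. Proof. by apply: leq_ltn_trans kn. Qed.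

Let c1 : 0 < n%:R - k.*2%:R :> R. Proof. by rewrite subr_gt0 ltr_nat. Qed.

Let tau0 : 0 < tau.
Proof. by apply: lt_trans tau_gt; rewrite divr_gt0. Qed.

Let delta := tau * k.+1%:R - (n%:R - k.*2%:R).

Let delta0 : 0 < delta.
Proof. by rewrite subr_gt0 -ltr_pdivrMr. Qed.

Lemma sigma_ge0 (j : nat) x : (1 <= j <= k)%N -> 0 <= sigma (schouten u x) j.
Proof.
move=> jk; have := L_ge0 jk x; rewrite gauss_bonnet_curvE // pmulr_rge0 //.
rewrite mulr_gt0 ?exprn_gt0 ?expR_gt0 // gb_const_gt0 //.
by move: jk => /andP[_ jk]; rewrite (leq_trans _ (ltnW kn)) // leq_double.
Qed.

Lemma divergence_mass_field x : divergence X x = mass_density u k x.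
Proof. exact: div_mass_field. Qed.

Let C1_X i : C1 (X i) := C1_mass_field smooth_u k i.

Let weight : R := mass_weight R n k k.-1 * (k%:R * (n%:R - k.*2%:R)) / (2 * k%:R).

Let weight_gt0 : 0 < weight.
Proof.
have kR : 0 < k%:R :> R by rewrite ltr0n.
by rewrite /weight divr_gt0 ?mulr_gt0 // mass_weight_gt0.
Qed.

Lemma divergence_ge x : weight * gradsq u x ^+ k <= divergence X x.
Proof.
by rewrite divergence_mass_field; apply: mass_density_ge => // j jk; exact: sigma_ge0.
Qed.

Lemma divergence_ge0 x : 0 <= divergence X x.
Proof.
apply: le_trans (divergence_ge x); apply: mulr_ge0; first exact: ltW.
by rewrite exprn_ge0 // gradsq_ge0.
Qed.

Lemma continuous_density_rest : continuous (density_rest u k).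
Proof.
apply: continuous_bigsum => a; apply: continuous_mul; first exact: cst_continuous.
apply: (@C1_continuous R n (fun x => gradsq u x ^+ a.+1 * sigma (schouten u x) (k.-1 - a))).
apply: (C1M (C1X a.+1 (C1_gradsq smooth_u))).
exact: (C1_sigma (C1_schouten smooth_u)).
Qed.

(** The top curvature term is controlled by the integrability of [L_k], the remaining ones
    by the decay of the metric. *)
Lemma ball_integral_mass_field_bounded : exists B : R, forall r, ball_integral X r <= B.
Proof.
have [A [r1 [A0 r11 decay_u]]] := asymptotic_decay tau0 af_u.
have [U U0 bU] := bounded_conformal_exponent smooth_u A0 r11 decay_u.
have [K K0 HK] := @density_rest_decay R n u A A0 k k0.
pose rest x := `|density_rest u k x|.
have crest : continuous rest := continuous_norm continuous_density_rest.
have [B1 HB1] : exists B : R, forall r, \int[lam]_(x in eball r) rest x <= B.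
  apply: (@ball_integral_bounded R n rest K delta r1) => //.
  - exact: lt_le_trans r11.
  - by move=> x; exact: normr_ge0.
  move=> b x rb bx; have b0 : 0 < b by apply: lt_le_trans rb; exact: lt_le_trans r11.
  have x0 := lt_trans b0 bx; have rx := le_trans rb (ltW bx).
  apply: (le_trans (HK _ _ _ (decay_u x rx))); rewrite -mulrA ler_wpM2l //.
  have := decay_exponent tau k n x0; rewrite -/delta => /(canRL (mulfK _)) ->; last first.
    by rewrite gt_eqF // exprn_gt0.
  have xn : 0 < enorm x ^+ n by rewrite exprn_gt0.
  apply: ler_pM; rewrite ?powR_ge0 ?invr_ge0 ?(ltW xn) //.
    rewrite !powRN lef_pV2 ?posrE ?powR_gt0 //.
    by apply: ge0_ler_powR; rewrite ?nnegrE ?ltW.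
  by rewrite lef_pV2 ?posrE ?exprn_gt0 // lerXn2r ?nnegrE ?ltW.
pose h x := gauss_bonnet_curv (cf_metric u) k x * volume_density (cf_metric u) x.
have hi : lam.-integrable setT (EFin \o h) by exact: Lk_int.
have ni : lam.-integrable setT (EFin \o (fun x => `|h x|)) := integrable_norm hi.
pose C := k%:R / (gb_const R n k * expR (- 2 * U) ^+ k * Num.sqrt (expR (- 2 * U) ^+ n)).
have hC x : k%:R * sigma (schouten u x) k <= C * `|h x|.
  rewrite /C /h gauss_bonnet_curvE //; apply: sigma_le_curvature => //.
  - by apply: gb_const_gt0; exact: ltnW.
  - by rewrite exprn_gt0 // expR_gt0.
  - exact: conformal_weight_ge.
  - by rewrite sqrtr_gt0 exprn_gt0 // expR_gt0.
  - exact: volume_density_ge.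
  - by apply: sigma_ge0; rewrite k0 leqnn.
have C0 : 0 <= C.
  have g0 : 0 <= gb_const R n k by apply/ltW/gb_const_gt0; exact: ltnW.
  rewrite divr_ge0 //; apply: mulr_ge0; last exact: sqrtr_ge0.
  by apply: mulr_ge0 => //; rewrite exprn_ge0 // expR_ge0.
exists (C * \int[lam]_x `|h x| + B1) => r.
have mE := @measurable_eball R n r.
have ir : lam.-integrable (eball r) (EFin \o rest) := continuous_integrable_eball r crest.
have ihr : lam.-integrable (eball r) (EFin \o (fun x => `|h x|)) :=
  integrableS measurableT mE (@subsetT _ _) ni.
have iCh : lam.-integrable (eball r) (EFin \o (fun x => C * `|h x|)).
  by have := integrableZl mE C ihr; exact: eq_integrable.
apply: (@le_trans _ _ (\int[lam]_(x in eball r) (C * `|h x| + rest x))).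
  apply: le_Rintegral => //.
  - exact: continuous_integrable_eball (continuous_divergence C1_X).
  - by have := integrableD mE iCh ir; exact: eq_integrable.
  move=> x _; rewrite divergence_mass_field; apply: lerD; first exact: hC.
  exact: ler_norm.
rewrite RintegralD // RintegralZl //; apply: lerD; last exact: HB1.
by rewrite ler_wpM2l //; exact: Rintegral_eball_le_setT.
Qed.

Let L := sup (range (ball_integral X)).

(** The flux of [X] is trapped between integrals over balls, which increase to their
    supremum, and the mass integrals differ from it by a decaying error. *)
Lemma mass_flux_cvg : mass_flux (cf_metric u) k r @[r --> +oo] --> flux_const R n k * L.
Proof.
have [A [r1 [A0 r11 decay_u]]] := asymptotic_decay tau0 af_u.
have [B HB] := ball_integral_mass_field_bounded.
have GL : flux X r @[r --> +oo] --> L.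
  apply: (monotone_squeeze _ HB).
    by move=> a b; exact: (ball_integral_le C1_X divergence_ge0).
  by move=> a; exact: (flux_bounds C1_X divergence_ge0).
have [K K0 HK] := flux_dist_decay smooth_u A0 r11 decay_u n0 k0.
have FL := cvg_decaying_diff delta0 K0 HK GL.
apply: cvg_trans (cvgMl_tmp (a := flux_const R n k) FL).
apply: near_eq_cvg; exists 0; split; first exact: num_real.
by move=> r r0; rewrite mass_flux_flux.
Qed.

Let flux_const0 : 0 < flux_const R n k.
Proof. by apply: flux_const_gt0 => //; exact: ltnW. Qed.

Let mass_const0 : 0 < mass_const R n k.
Proof.
by rewrite /mass_const divr_gt0 ?mulr_gt0 ?exprn_gt0 ?ltr0n ?fact_gt0 // sphere_volume_gt0.
Qed.

Lemma gbc_massE : gbc_mass (cf_metric u) k = mass_const R n k * (flux_const R n k * L).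
Proof. by rewrite /gbc_mass (cvg_lim _ mass_flux_cvg). Qed.

Lemma ball_integral_le_limit r : ball_integral X r <= L.
Proof.
have [B HB] := ball_integral_mass_field_bounded.
by apply: ub_le_sup; [exists B => _ [s _ <-]|exists r].
Qed.

Lemma limit_ge0 : 0 <= L.
Proof. exact: le_trans (ball_integral_ge0 divergence_ge0 0) (ball_integral_le_limit 0). Qed.

Lemma gbc_mass_ge0 : 0 <= gbc_mass (cf_metric u) k.
Proof. by rewrite gbc_massE; exact: mulr_ge0 (ltW mass_const0) (mulr_ge0 (ltW flux_const0) limit_ge0). Qed.

(** A vanishing mass forces the nonnegative continuous divergence of [X], which dominates
    [|grad u|^(2k)], to have vanishing integral over every ball. *)
Lemma gbc_mass_eq0 : gbc_mass (cf_metric u) k = 0 -> forall x, u x = 0.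
Proof.
have [A [r1 [A0 r11 decay_u]]] := asymptotic_decay tau0 af_u.
move=> /eqP; rewrite gbc_massE mulf_eq0 (gt_eqF mass_const0) mulf_eq0 (gt_eqF flux_const0) => /eqP L0.
apply: (gradient0_eq0 smooth_u tau0 A0 r11 decay_u n0) => i x.
have D0 : divergence X x = 0.
  apply: continuous_integral_eq0.
  - exact: continuous_divergence C1_X.
  - exact: divergence_ge0.
  - by move=> r; rewrite -L0; exact: ball_integral_le_limit.
have := divergence_ge x; rewrite D0 pmulr_rle0 // => qk.
have /eqP : gradsq u x ^+ k = 0.
  by apply/eqP; rewrite eq_le qk exprn_ge0 // gradsq_ge0.
rewrite expf_eq0 k0 /= psumr_eq0; last by move=> j _; exact: sqr_ge0.
by move=> /allP /(_ i (mem_index_enum i)) /=; rewrite sqrf_eq0 => /eqP.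
Qed.

Lemma gbc_mass_flat : (forall x, u x = 0) -> gbc_mass (cf_metric u) k = 0.
Proof.
move=> u0; have {}u0 : u = fun=> 0 by apply/funext.
have mE r : 0 < r -> mass_flux (cf_metric u) k r = 0.
  move=> r0; rewrite mass_flux_flux // (_ : flux _ r = 0) ?mulr0 //.
  rewrite /flux /sphere_integral /Rintegral integral0_eq ?mulr0 // => x _.
  rewrite big1 // => i _; rewrite newton_gradE big1 ?mulr0 ?mul0r //.
  by move=> j _; rewrite u0 partial_cst mulr0.
have H : mass_flux (cf_metric u) k r @[r --> +oo] --> (0 : R).
  apply: cvg_near_cst; exists 0; split; first exact: num_real.
  by move=> r r0; rewrite mE.
by rewrite /gbc_mass (cvg_lim _ H) // mulr0.
Qed.

End conformally_flat_mass.

Theorem theorem1p1 (R : realType) (n k : nat) (u : 'rV[R]_n -> R) (tau : R)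
    (k_ge1 : (1 <= k)%N) (k_lt : (k.*2 < n)%N)
    (u_smooth : smooth u)
    (tau_gt : (n%:R - k.*2%:R) / k.+1%:R < tau)
    (u_af : asymptotically_flat_cf u tau)
    (Lk_int : dvol_integrable (cf_metric u) (gauss_bonnet_curv (cf_metric u) k))
    (L_ge0 : forall j, (1 <= j <= k)%N ->
       forall x, 0 <= gauss_bonnet_curv (cf_metric u) j x) :
  gbc_mass_defined (cf_metric u) k /\
  0 <= gbc_mass (cf_metric u) k /\
  (gbc_mass (cf_metric u) k = 0 <-> forall x, u x = 0).
Proof.
split; last split; last split.
- exact: cvgP (mass_flux_cvg k_ge1 k_lt u_smooth tau_gt u_af Lk_int L_ge0).
- exact: gbc_mass_ge0 k_ge1 k_lt u_smooth tau_gt u_af Lk_int L_ge0.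
- exact: gbc_mass_eq0 k_ge1 k_lt u_smooth tau_gt u_af Lk_int L_ge0.
- exact: gbc_mass_flat.
Qed.
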